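(* Let $\Omega$ be a smooth bounded domain in $\mathbb R^n$, or $(0,1)^n$, or $\mathbb T^n$ ($n\ge1$). \begin{enumerate} \item Let $s>0$, $1\le p<\infty$ and $1\le q<\infty$ be such that $sp\ge 1$. Then every integer-valued function in $B^s_{p,q}(\Omega)$ is constant (a.e.). \item The same conclusion holds when $s>0$, $1\le p<\infty$, $q=\infty$ and $sp>1$. \item Let $k\ge1$ and, for $j=1,\dots,k$, let $s_j>0$, $1\le p_j<\infty$ and $1\le q_j\le\infty$ be such that for all $j\in\{1,\dots,k\}$ either $s_jp_j=1$ and $1\le q_j<\infty$, or $s_jp_j>1$ and $1\le q_j\le\infty$. If $f_j\in B^{s_j}_{p_j,q_j}(\Omega;\mathbb R)$ for $j=1,\dots,k$ and $f_1+\cdots+f_k$ takes only integer values (a.e.), then $f_1+\cdots+f_k$ is constant (a.e.). \end{enumerate}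
   Context: $\mathbb T^n=\mathbb R^n/\mathbb Z^n$; a domain is a connected open set. Besov spaces. Let $s\in\mathbb R$, $1\le p<\infty$, $1\le q\le\infty$. Fix $(\varphi_j)_{j\ge 0}\subset\mathcal S(\mathbb R^n)$ with $\operatorname{supp}\varphi_0\subset B(0,2)$, $\operatorname{supp}\varphi_j\subset B(0,2^{j+1})\setminus B(0,2^{j-1})$ for $j\ge1$, $|\partial^\alpha\varphi_j|\le c_\alpha 2^{-j|\alpha|}$ for all multi-indices $\alpha$ and all $j$, and $\sum_{j\ge0}\varphi_j=1$. With $\mathcal F$ the Fourier transform, $B^s_{p,q}(\mathbb R^n)$ is the space of tempered distributions $f$ with $\left(\sum_{j\ge0}2^{sjq}\|\mathcal F^{-1}(\varphi_j\mathcal Ff)\|_{L^p(\mathbb R^n)}^q\right)^{1/q}<\infty$ (supremum over $j$ if $q=\infty$). For $\Omega\subset\mathbb R^n$ open, $B^s_{p,q}(\Omega)$ is the space of restrictions to $\Omega$ of elements of $B^s_{p,q}(\mathbb R^n)$. $B^s_{p,q}(\mathbb T^n)$ is the space of $\mathbb Z^n$-periodic distributions on $\mathbb R^n$ whose product with every $C^\infty_c$ cutoff function belongs to $B^s_{p,q}(\mathbb R^n)$. For $s>0$ the elements of these spaces are functions (in $L^p$, resp. $L^p_{loc}$). *)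

(* Defs.v *)
From HB Require Import structures.
From mathcomp Require Import all_boot all_order all_algebra.
From mathcomp Require Import all_classical all_reals all_analysis.
From mathcomp Require Import complex.

Set Implicit Arguments.
Unset Strict Implicit.
Unset Printing Implicit Defensive.

Import Order.TTheory GRing.Theory Num.Theory.
Import numFieldNormedType.Exports.

Local Open Scope classical_set_scope.
Local Open Scope complex_scope.
Local Open Scope ring_scope.

Definition row_display : measure_display.
Proof. exact: default_measure_display. Qed.

(* The sigma-algebra generated by the coordinates, that is, the Borel sets. *)
Section measurable_row.
Context (R : realType) (n : nat).

Let coors (i : 'I_n) (x : 'rV[R]_n) : R := x 0 i.

Let row_set0 : g_sigma_preimage coors set0.
Proof. exact: sigma_algebra0. Qed.

Let row_setC A : g_sigma_preimage coors A -> g_sigma_preimage coors (~` A).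
Proof. exact: sigma_algebraC. Qed.

Let row_bigcup (F : (set 'rV[R]_n)^nat) :
  (forall i, g_sigma_preimage coors (F i)) ->
  g_sigma_preimage coors (\bigcup_i (F i)).
Proof. exact: sigma_algebra_bigcup. Qed.

HB.instance Definition _ := @isMeasurable.Build
  row_display
  'rV[R]_n (g_sigma_preimage coors) row_set0 row_setC row_bigcup.

Lemma measurable_coord (i : 'I_n) :
  measurable_fun [set: 'rV[R]_n] (fun x : 'rV[R]_n => x 0 i).
Proof.
move=> _ Y mY; rewrite setTI; apply: sub_sigma_algebra => /=.
rewrite -bigcup_seq/=; exists i => /=; first by rewrite mem_index_enum.
by exists Y => //; rewrite setTI.
Qed.

Lemma measurable_fun_coordP d (T : measurableType d) (f : T -> 'rV[R]_n) :
  (forall i, measurable_fun [set: T] (fun t => f t 0 i)) ->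
  measurable_fun [set: T] f.
Proof.
move=> mf; have : g_sigma_preimage (fun i t => f t 0 i) `<=` measurable.
  apply: smallest_sub; first exact: sigma_algebra_measurable.
  rewrite -bigcup_seq; apply: bigcup_sub => i _ A [B mB <-]; exact: mf.
rewrite (g_sigma_preimage_comp coors f) => prefS _ A mA.
by apply: prefS; exists A.
Qed.
End measurable_row.

Definition row_cons (R : realType) (n : nat) (z : R * 'rV[R]_n) : 'rV[R]_n.+1 :=
  \row_(i < n.+1) oapp (fun j => z.2 0 j) z.1 (unlift ord0 i).

Lemma measurable_row_cons (R : realType) (n : nat) :
  measurable_fun [set: R * 'rV[R]_n] (@row_cons R n).
Proof.
apply: measurable_fun_coordP => i; rewrite /row_cons.
under eq_fun do rewrite mxE.
case: unliftP => [j _|_] /=; last exact: measurable_fst.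
apply: (@measurableT_comp _ _ _ _ _ _ (fun x : 'rV[R]_n => x 0 j)).
  exact: measurable_coord.
exact: measurable_snd.
Qed.

Definition lebesgue_cons (R : realType) (n : nat)
    (mu : {sigma_finite_measure set 'rV[R]_n -> \bar R}) : set 'rV[R]_n.+1 -> \bar R :=
  pushforward (lebesgue_measure \x mu)%E (@row_cons R n).

Section lebesgue_cons.
Context (R : realType) (n : nat).
Variable mu : {sigma_finite_measure set 'rV[R]_n -> \bar R}.

Let lebesgue_cons0 : lebesgue_cons mu set0 = 0%E.
Proof. by rewrite /lebesgue_cons /pushforward preimage_set0 measure0. Qed.

Let lebesgue_cons_ge0 A : (0 <= lebesgue_cons mu A)%E.
Proof. rewrite /lebesgue_cons /pushforward; exact: measure_ge0. Qed.

Let lebesgue_cons_sigma_additive : semi_sigma_additive (lebesgue_cons mu).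
Proof.
move=> F mF tF mUF; rewrite /lebesgue_cons /pushforward preimage_bigcup.
apply: measure_semi_sigma_additive.
- by move=> k; rewrite -[X in measurable X]setTI; exact: measurable_row_cons.
- apply/trivIsetP => /= i j _ _ ij; rewrite -preimage_setI.
  by move/trivIsetP : tF => /(_ _ _ _ _ ij) ->//; rewrite preimage_set0.
- by rewrite -preimage_bigcup -[X in measurable X]setTI; exact: measurable_row_cons.
Qed.

HB.instance Definition _ := isMeasure.Build _ _ _ (lebesgue_cons mu)
  lebesgue_cons0 lebesgue_cons_ge0 lebesgue_cons_sigma_additive.

Let lebesgue_cons_sigma_finite : sigma_finite setT (lebesgue_cons mu).
Proof.
have /sigma_finiteP[F [TF ndF Foo]] := sigma_finiteT (@lebesgue_measure R).
have /sigma_finiteP[G [TG ndG Goo]] := sigma_finiteT mu.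
pose h (x : 'rV[R]_n.+1) : R * 'rV[R]_n := (x 0 ord0, \row_j x 0 (lift ord0 j)).
have mh : measurable_fun setT h.
  apply/measurable_fun_pairP; split => /=.
    exact: measurable_coord.
  apply: measurable_fun_coordP => i; rewrite /comp /=.
  under eq_fun do rewrite mxE.
  exact: measurable_coord.
have hK z : h (row_cons z) = z.
  case: z => t x; rewrite /h /row_cons; congr pair.
    by rewrite mxE unlift_none.
  by apply/rowP => j; rewrite !mxE liftK.
exists (fun k => h @^-1` (F k `*` G k)).
  rewrite -preimage_bigcup (_ : \bigcup_k (F k `*` G k) = setT) ?preimage_setT//.
  rewrite -setXTT TF TG predeqE => -[x y]; split.
    by move=> [k _ []/= ? ?]; split; exists k.
  move=> [/= [k _ Fkx] [l _ Gly]]; exists (maxn k l) => //; split.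
  - by move: x Fkx; exact/subsetPset/ndF/leq_maxl.
  - by move: y Gly; exact/subsetPset/ndG/leq_maxr.
move=> k; have [mF Fk] := Foo k; have [mG Gk] := Goo k; split.
  by rewrite -[X in measurable X]setTI; apply: mh => //; exact: measurableX.
rewrite /lebesgue_cons /pushforward -comp_preimage.
rewrite (_ : h \o _ = id); last by apply/funext => z; exact: hK.
by rewrite preimage_id product_measure1E// lte_mul_pinfty// ge0_fin_numE.
Qed.

HB.instance Definition _ := Measure_isSigmaFinite.Build _ _ _ (lebesgue_cons mu)
  lebesgue_cons_sigma_finite.
End lebesgue_cons.

Fixpoint lebesgue_row (R : realType) (n : nat) :
    {sigma_finite_measure set 'rV[R]_n -> \bar R} :=
  match n with
  | 0 => dirac (0 : 'rV[R]_0)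
  | m.+1 => lebesgue_cons (lebesgue_row R m)
  end.

Lemma lebesgue_row_rect (R : realType) (n : nat) (A : 'I_n -> set R) :
  (forall i, measurable (A i)) ->
  lebesgue_row R n [set x | forall i, A i (x 0 i)] =
  (\prod_(i < n) lebesgue_measure (A i))%E.
Proof.
elim: n A => [|n IH] A mA.
  rewrite big_ord0 /= diracE (_ : (0 : 'rV_0) \in _)//.
  by rewrite inE => -[].
rewrite big_ord_recl -IH; last by move=> i; exact: mA.
have mB : measurable [set x : 'rV[R]_n | forall i, A (lift ord0 i) (x 0 i)].
  rewrite (_ : mkset _ = \bigcap_(i : 'I_n)
      ((fun x : 'rV[R]_n => x 0 i) @^-1` A (lift ord0 i))).
    apply: fin_bigcap_measurable => // i _.
    by rewrite -[X in measurable X]setTI; apply: measurable_coord.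
  by apply/seteqP; split => x /= h i; [move=> _|]; exact: h.
have := product_measure1E (@lebesgue_measure R) (lebesgue_row R n) (mA ord0) mB.
move=> <-.
rewrite /= /lebesgue_cons /pushforward; congr (_ _).
apply/seteqP; split => -[t x] /=.
  move=> h; split; first by have := h ord0; rewrite mxE unlift_none.
  by move=> i; have := h (lift ord0 i); rewrite mxE liftK.
by move=> [h0 h] i; rewrite mxE; case: unliftP => [j ->|->] /=.
Qed.

Section real_derivatives.
Context (R : realType) (n : nat).
Local Notation Rn := 'rV[R]_n.

(* A word [:: i_1; ...; i_m] encodes the multi-index of order m of
   d_{i_1} ... d_{i_m}; on smooth functions the order is irrelevant. *)
Definition partials (l : seq 'I_n) (f : Rn -> R) : Rn -> R :=
  foldr (fun i g x => 'D_('e_i) g x) f l.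

Definition smooth (f : Rn -> R) : Prop :=
  forall l : seq 'I_n,
    continuous (partials l f) /\
    forall (i : 'I_n) (x : Rn), derivable (partials l f) x 'e_i.

End real_derivatives.

Section function_spaces.
Context (R : realType) (n : nat).

Local Notation C := R[i].
Local Notation Rn := 'rV[R]_n.
Local Notation mu := (lebesgue_row R n).

(* The library norm on ['rV[R]_n] is the sup norm. *)
Definition enorm (x : Rn) : R := Num.sqrt (\sum_(i < n) x 0 i ^+ 2).

Definition dotp (x y : Rn) : R := \sum_(i < n) x 0 i * y 0 i.

Definition eball (r : R) : set Rn := [set x | enorm x < r].

Definition cpartials (l : seq 'I_n) (f : Rn -> C) (x : Rn) : C :=
  partials l (fun y => complex.Re (f y)) x +i*
  partials l (fun y => complex.Im (f y)) x.

Definition csmooth (f : Rn -> C) : Prop :=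
  smooth (fun x => complex.Re (f x)) /\ smooth (fun x => complex.Im (f x)).

Definition cmeasurable (D : set Rn) (f : Rn -> C) : Prop :=
  measurable_fun D (fun x => complex.Re (f x)) /\
  measurable_fun D (fun x => complex.Im (f x)).

Definition cintegral (D : set Rn) (f : Rn -> C) : C :=
  Rintegral mu D (fun x => complex.Re (f x)) +i*
  Rintegral mu D (fun x => complex.Im (f x)).

Definition csupp (f : Rn -> C) : set Rn := closure [set x | f x != 0].

Definition schwartz (f : Rn -> C) : Prop :=
  csmooth f /\
  forall (N : nat) (l : seq 'I_n), exists M : R, forall x : Rn,
    (1 + enorm x) ^+ N * Normc.normc (cpartials l f x) <= M.

Definition test_function (U : set Rn) (f : Rn -> C) : Prop :=
  [/\ csmooth f, compact (csupp f) & csupp f `<=` U].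

(* Distributions are functionals on all of [Rn -> C]; only their values on
   the relevant test space are meaningful. *)
Definition linear_on (S : set (Rn -> C)) (u : (Rn -> C) -> C) : Prop :=
  forall (a : C) (f g : Rn -> C), S f -> S g ->
    u (fun x => a * f x + g x) = a * u f + u g.

Definition distribution_on (U : set Rn) (u : (Rn -> C) -> C) : Prop :=
  linear_on (test_function U) u /\
  forall K : set Rn, compact K -> K `<=` U ->
    exists (N : nat) (M : R), forall (f : Rn -> C) (B : R),
      test_function U f -> csupp f `<=` K ->
      (forall (l : seq 'I_n) (x : Rn), (size l <= N)%N ->
         Normc.normc (cpartials l f x) <= B) ->
      Normc.normc (u f) <= M * B.

Definition tempered (u : (Rn -> C) -> C) : Prop :=
  linear_on schwartz u /\
  exists (N : nat) (M : R), forall (f : Rn -> C) (B : R),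
    schwartz f ->
    (forall (l : seq 'I_n) (x : Rn), (size l <= N)%N ->
       (1 + enorm x) ^+ N * Normc.normc (cpartials l f x) <= B) ->
    Normc.normc (u f) <= M * B.

Definition cis (t : R) : C := cos t +i* sin t.

Definition fourier (f : Rn -> C) (xi : Rn) : C :=
  cintegral setT (fun x => f x * cis (- dotp x xi)).

Definition inv_fourier (f : Rn -> C) (x : Rn) : C :=
  ((2 * pi) ^- n)%:C * cintegral setT (fun xi => f xi * cis (dotp x xi)).

Definition distr_fourier (u : (Rn -> C) -> C) : (Rn -> C) -> C :=
  fun f => u (fourier f).

Definition distr_inv_fourier (u : (Rn -> C) -> C) : (Rn -> C) -> C :=
  fun f => u (inv_fourier f).

Definition distr_mul (g : Rn -> C) (u : (Rn -> C) -> C) : (Rn -> C) -> C :=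
  fun f => u (fun x => g x * f x).

Definition regular_distr (U : set Rn) (g : Rn -> C) : (Rn -> C) -> C :=
  fun f => cintegral U (fun x => g x * f x).

Definition cLnorm (p : R) (g : Rn -> C) : \bar R :=
  ('N[mu]_(p%:E)[(fun x => (Normc.normc (g x))%:E)])%E.

Definition LpC (p : R) (g : Rn -> C) : Prop :=
  cmeasurable setT g /\ (cLnorm p g < +oo)%E.

(* [+oo] if the tempered distribution [v] is not given by an L^p function;
   otherwise that function is unique a.e. and the infimum is its norm. *)
Definition distr_Lnorm (p : R) (v : (Rn -> C) -> C) : \bar R :=
  ereal_inf [set cLnorm p g | g in
    [set g | LpC p g /\
             forall f, schwartz f -> v f = regular_distr setT g f]].

Definition dyadic_partition (phi : nat -> Rn -> C) : Prop :=
  [/\ forall j, schwartz (phi j),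
      csupp (phi 0%N) `<=` eball 2,
      forall j, csupp (phi j.+1) `<=` eball (2 ^+ j.+2) `\` eball (2 ^+ j),
      forall l : seq 'I_n, exists c : R, forall (j : nat) (x : Rn),
        Normc.normc (cpartials l (phi j) x) <= c * 2 ^- (j * size l) &
      forall x : Rn,
        (fun m => \sum_(0 <= j < m) complex.Re (phi j x)) @ \oo --> (1 : R) /\
        (fun m => \sum_(0 <= j < m) complex.Im (phi j x)) @ \oo --> (0 : R)].

Definition dyadic_block (phi : nat -> Rn -> C) (j : nat)
    (u : (Rn -> C) -> C) : (Rn -> C) -> C :=
  distr_inv_fourier (distr_mul (phi j) (distr_fourier u)).

Definition besov_norm (phi : nat -> Rn -> C) (s p : R) (q : \bar R)
    (u : (Rn -> C) -> C) : \bar R :=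
  match q with
  | r%:E => ((\sum_(0 <= j <oo)
                (2 `^ (s * j%:R * r))%:E *
                distr_Lnorm p (dyadic_block phi j u) `^ r) `^ r^-1)%E
  | +oo%E => ereal_sup [set ((2 `^ (s * j%:R))%:E *
                distr_Lnorm p (dyadic_block phi j u))%E | j in [set: nat]]
  | -oo%E => +oo%E
  end.

Definition besov_Rn (phi : nat -> Rn -> C) (s p : R) (q : \bar R)
    (u : (Rn -> C) -> C) : Prop :=
  tempered u /\ (besov_norm phi s p q u < +oo)%E.

Definition besov_open (phi : nat -> Rn -> C) (U : set Rn) (s p : R)
    (q : \bar R) (v : (Rn -> C) -> C) : Prop :=
  exists2 u, besov_Rn phi s p q u &
    forall f, test_function U f -> v f = u f.

Definition periodic_distr (v : (Rn -> C) -> C) : Prop :=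
  forall (k : 'rV[int]_n) (f : Rn -> C), test_function setT f ->
    v (fun x => f (x + map_mx intr k)) = v f.

Definition besov_torus (phi : nat -> Rn -> C) (s p : R) (q : \bar R)
    (v : (Rn -> C) -> C) : Prop :=
  [/\ distribution_on setT v, periodic_distr v &
      forall chi, test_function setT chi ->
        besov_Rn phi s p q (distr_mul chi v)].

(* Near each boundary point, U is one side of the graph of a smooth function
   of the other n - 1 coordinates; [e] selects the side. *)
Definition smooth_boundary (U : set Rn) : Prop :=
  forall x0 : Rn, (closure U `\` U) x0 ->
  exists (r : R) (i : 'I_n) (e : bool) (g : 'rV[R]_n.-1 -> R),
    [/\ 0 < r, smooth g &
        forall x : Rn, enorm (x - x0) < r ->
          (U x <-> g (col' i x) < (-1) ^+ e * x 0 i)].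

Definition smooth_bounded_domain (U : set Rn) : Prop :=
  [/\ open U, connected U, bounded_set U & smooth_boundary U].

Definition open_unit_cube : set Rn :=
  [set x | forall i, 0 < x 0 i < 1].

End function_spaces.
Arguments open_unit_cube {R n}.

(* Functions on the torus are Z^n-periodic functions on R^n. *)
Variant region (R : realType) (n : nat) :=
  | OpenRegion of set 'rV[R]_n
  | Torus.

Section statement.
Context (R : realType) (n : nat).

Local Notation C := R[i].
Local Notation Rn := 'rV[R]_n.
Local Notation mu := (lebesgue_row R n).

Definition admissible (Om : region R n) : Prop :=
  match Om with
  | OpenRegion U => smooth_bounded_domain U \/ U = open_unit_cube
  | Torus => True
  end.

Definition carrier (Om : region R n) : set Rn :=
  if Om is OpenRegion U then U else setT.

Definition besov (phi : nat -> Rn -> C) (Om : region R n) (s p : R)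
    (q : \bar R) (v : (Rn -> C) -> C) : Prop :=
  match Om with
  | OpenRegion U => besov_open phi U s p q v
  | Torus => besov_torus phi s p q v
  end.

Definition ae_on (Om : region R n) (P : Rn -> Prop) : Prop :=
  \forall x \ae mu, carrier Om x -> P x.

Definition locally_integrable_on (U : set Rn) (g : Rn -> R) : Prop :=
  measurable_fun U g /\
  forall K, compact K -> K `<=` U -> mu.-integrable K (EFin \o g).

(* Functions are taken modulo a.e. equality; the Borel representative [g]
   makes this cover all Lebesgue measurable [f]. *)
Definition besov_fun (phi : nat -> Rn -> C) (Om : region R n) (s p : R)
    (q : \bar R) (f : Rn -> R) : Prop :=
  exists g : Rn -> R,
    [/\ locally_integrable_on (carrier Om) g,
        ae_on Om (fun x => f x = g x) &
        besov phi Om s p q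
          (regular_distr (carrier Om) (fun x => (g x)%:C))].

Definition integer_valued (Om : region R n) (f : Rn -> R) : Prop :=
  ae_on Om (fun x => f x \is a Num.int).

Definition ae_constant (Om : region R n) (f : Rn -> R) : Prop :=
  exists c : R, ae_on Om (fun x => f x = c).

End statement.

(* Main.v *)
Require Import Defs.
From mathcomp Require Import all_boot all_order all_algebra.
From mathcomp Require Import all_classical all_reals all_analysis.
From mathcomp Require Import complex measurable_realfun.
From mathcomp Require Import ring lra zify.

Set Implicit Arguments.
Unset Strict Implicit.
Unset Printing Implicit Defensive.

Import Order.TTheory GRing.Theory Num.Theory.
Import numFieldNormedType.Exports.

Local Open Scope classical_set_scope.
Local Open Scope complex_scope.
Local Open Scope ring_scope.

(** Write [mu] for Lebesgue measure and [D_h f x = f (x + 2h) - 2 f (x + h) + f x].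
    Let [g_j] be the dyadic blocks of [f]. In all the cases allowed,
    [2^j * int |g_j|^p = nu_j] tends to 0: this is where [q < oo] is needed when [s p = 1].

    Since [g_j] is reproduced by convolution with a kernel at scale [2^-j], for
    [h = 2^-J t e_i] the set where [|D_h g_j|] exceeds [c_j] has measure at most
    [A (4^(j-J) / c_j)^p 2^-j nu_j] if [j <= J], and trivially at most
    [A c_j^-p 2^-j nu_j] if [j > J]. Taking [c_j] geometric in [|J - j|] and summing,
    [mu {|D_h f| > c} = o(2^-J)]. This bound does not see [p], hence it is inherited
    by a finite sum of functions from different spaces.

    If the sum [f] is integer valued then [D_h f] is too, so [D_h f = 0] outside a set
    of measure [o(2^-J)]. Outside a set of measure [o(1)], [D_h f] thus vanishes along
    the whole progression [x, x + h, ..., x + 2^J h = x + t e_i], so [f] is an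
    arithmetic progression there and [f (x + t e_i) - f x] is a multiple of [2^J].
    Letting [J] tend to infinity, [f (x + t e_i) = f x] a.e.; by Fubini [f] is a.e.
    constant near every point, and by connectedness on the whole domain. *)

(** * Lebesgue measure on row vectors *)

(** Two losses have to be balanced. Integrality turns the bound on [D_h f] into an equation only off
    an exceptional set, and following [2^J] steps costs [2^J] translates of that set; so its measure
    must be [o(2^-J)], and the [O(2^-J)] that bounded [nu_j] would give is too weak. Second
    differences are imposed by [p = 1]. For a block with [j = J - d], a first difference gains only
    [2^-d], which the factor [2^-j = 2^d 2^-J] cancels, and nothing summable in [d] is left; the
    gain [4^-d] of a second difference leaves [2^-d], enough to pay also for the decreasing
    thresholds [c_j]. The price is that [f] is known only to be an arithmetic progression along the
    steps. Integrality pays it: a nonzero common difference forces a jump of at least [2^J]. The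
    smallness is measured by exceptional sets rather than by norms, because summands with different
    [p] share no [L^p] estimate while exceptional sets can simply be united. Everything takes place
    in a small ball, on which the distribution is an integrable function; this brings the torus, the
    cube and the domain to one common form. *)

Section row_borel.
Context (R : realType) (n : nat).
Local Notation Rn := 'rV[R]_n.

Lemma row_norm_le (x : Rn) (e : R) : 0 <= e ->
  (`|x| <= e) = [forall i, `|x 0 i| <= e].
Proof.
move=> e0; apply/idP/forallP => [xe i|xe].
  rewrite (le_trans _ xe)//.
  rewrite [leRHS]mx_normrE.
  exact: (le_bigmax _ (fun i : 'I_1 * 'I_n => `|x i.1 i.2|) (0, i)).
rewrite [leLHS]mx_normrE; apply/bigmax_leP; split => // -[i j] _ /=.
by rewrite (ord1 i).
Qed.

Lemma row_coord_le (x : Rn) i : `|x 0 i| <= `|x|.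
Proof.
by have := row_norm_le x (normr_ge0 x); rewrite lexx => /esym/forallP.
Qed.

Lemma row_norm_lt (x : Rn) (e : R) : 0 < e ->
  (`|x| < e) = [forall i, `|x 0 i| < e].
Proof.
move=> e0; apply/idP/forallP => [xe i|xe].
  exact: le_lt_trans (row_coord_le x i) xe.
rewrite [ltLHS]mx_normrE; apply/bigmax_ltP; split => // -[i j] _ /=.
by rewrite (ord1 i).
Qed.

Lemma measurable_row_rect (A : 'I_n -> set R) :
  (forall i, measurable (A i)) -> measurable [set x : Rn | forall i, A i (x 0 i)].
Proof.
move=> mA; rewrite (_ : mkset _ = \bigcap_(i : 'I_n)
    ((fun x : Rn => x 0 i) @^-1` A i)).
  apply: fin_bigcap_measurable => // i _.
  by rewrite -[X in measurable X]setTI; exact: measurable_coord.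
by apply/seteqP; split => x /= h i; [move=> _|]; exact: h.
Qed.

(** Half-open cubes of side [2^-c.1] on the dyadic grid. The countable index type makes every open
    set a union over [nat] through [unpickle]; the same enumeration later collects null sets in
    [connected_ae_constant]. *)
Definition dyadic_cell (c : nat * 'rV[int]_n) : set Rn :=
  [set x | forall i, (c.2 0 i)%:~R <= 2 ^+ c.1 * x 0 i < (c.2 0 i + 1)%:~R].

Lemma measurable_dyadic_cell c : measurable (dyadic_cell c).
Proof.
apply: (@measurable_row_rect (fun i =>
  [set t : R | (c.2 0 i)%:~R <= 2 ^+ c.1 * t < (c.2 0 i + 1)%:~R])) => i.
rewrite (_ : mkset _ = `[(c.2 0 i)%:~R / 2 ^+ c.1, (c.2 0 i + 1)%:~R / 2 ^+ c.1[%classic)//.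
apply/seteqP; split => t /=; rewrite in_itv/= ler_pdivrMr ?exprn_gt0//;
  by rewrite ltr_pdivlMr ?exprn_gt0// mulrC.
Qed.

Lemma dyadic_cell_nbhs (x : Rn) (U : set Rn) : nbhs x U ->
  exists c, dyadic_cell c x /\ dyadic_cell c `<=` U.
Proof.
move=> /nbhs_ballP[e /= e0 xU].
have [m hm] : exists m, 2 ^- m < e :> R.
  have h : (2 ^- m : R) @[m --> \oo] --> 0.
    under eq_fun do rewrite -exprVn.
    apply: cvg_expr; rewrite ger0_norm ?invr_ge0// invf_lt1//; lra.
  near \oo => m; exists m.
  by near: m; apply: (cvgr_lt 0).
exists (m, \row_i Num.floor (2 ^+ m * x 0 i)); split.
  by move=> i /=; rewrite mxE floor_itv.
move=> y xy; apply: xU; rewrite -ball_normE /ball_ /= (row_norm_lt _ e0).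
apply/forallP => i; rewrite !mxE; apply: lt_trans hm.
have := xy i; rewrite /= mxE => /andP[y1 y2].
have /andP[x1 x2] := floor_itv (2 ^+ m * x 0 i).
rewrite -[ltRHS]mul1r ltr_pdivlMr ?exprn_gt0//.
rewrite -{1}(@ger0_norm _ (2 ^+ m)) ?exprn_ge0//  -normrM ltr_norml.
move: y1 y2 x1 x2; rewrite intrD /=; nra.
Unshelve. end_near. Qed.

Lemma open_dyadic_cells (U : set Rn) : open U ->
  U = \bigcup_(k in [set k : nat | exists2 c, unpickle k = Some c & dyadic_cell c `<=` U])
         (if unpickle k is Some c then dyadic_cell c else set0).
Proof.
move=> oU; apply/seteqP; split => x.
  move=> Ux; have [c [cx cU]] := dyadic_cell_nbhs (open_nbhs_nbhs (conj oU Ux)).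
  by exists (pickle c); rewrite /= pickleK//; exists c.
by move=> [k /= [c ->] cU]; exact: cU.
Qed.

Lemma open_measurable_row (U : set Rn) : open U -> measurable U.
Proof.
move=> /open_dyadic_cells ->; apply: bigcup_measurable => k _.
by case: unpickle => [c|//]; exact: measurable_dyadic_cell.
Qed.

Lemma closed_measurable_row (U : set Rn) : closed U -> measurable U.
Proof.
by move=> cU; rewrite -(setCK U); apply: measurableC; apply: open_measurable_row; exact: closed_openC.
Qed.

Lemma continuous_measurable_row (f : Rn -> R) : continuous f -> measurable_fun setT f.
Proof.
move=> /continuousP cf; apply: (measurability _ (RGenOpens.measurableE R)).
move=> _ [_ [a [b ->] <-]]; rewrite setTI; apply: open_measurable_row.
exact/cf/interval_open.
Qed.

Lemma measurable_row_comp d (T : measurableType d) (f : T -> Rn) (i : 'I_n) :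
  measurable_fun setT f -> measurable_fun setT (fun t => f t 0 i).
Proof.
by move=> mf; apply: (measurableT_comp (measurable_coord i) mf).
Qed.

Lemma measurable_rowD d (T : measurableType d) (f g : T -> Rn) :
  measurable_fun setT f -> measurable_fun setT g ->
  measurable_fun setT (fun t => f t + g t).
Proof.
move=> mf mg; apply: measurable_fun_coordP => i; under eq_fun do rewrite mxE.
by apply: measurable_funD; exact: measurable_row_comp.
Qed.

Lemma measurable_rowZ d (T : measurableType d) c (f : T -> Rn) :
  measurable_fun setT f -> measurable_fun setT (fun t => c *: f t).
Proof.
move=> mf; apply: measurable_fun_coordP => i; under eq_fun do rewrite mxE.
by apply: measurable_funM => //; exact: measurable_row_comp.
Qed.

Lemma measurable_rowN d (T : measurableType d) (f : T -> Rn) :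
  measurable_fun setT f -> measurable_fun setT (fun t => - f t).
Proof.
move=> mf; under eq_fun do rewrite -scaleN1r; exact: measurable_rowZ.
Qed.

End row_borel.

(** * Affine changes of variables *)

Section row_affine.
Context (R : realType).
Local Open Scope ereal_scope.

(** Uniqueness of Lebesgue measure reduces this to intervals []a, b]]. For negative [c] the preimage
    is closed on the left instead of on the right, hence the two cases. *)
Lemma lebesgue_measure_affine (c t0 : R) (A : set R) : c != 0%R -> measurable A ->
  `|c|%:E * lebesgue_measure ((fun t : R => c * t + t0)%R @^-1` A) = lebesgue_measure A.
Proof.
move=> c0 mA.
have maff : measurable_fun setT (fun t : measurableTypeR R => c * t + t0 : measurableTypeR R)%R.
  by apply: measurable_funD => //; exact: measurable_funM.
pose nu0 : {measure set (measurableTypeR R) -> \bar R} :=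
  mscale (NngNum (normr_ge0 c)) (pushforward lebesgue_measure
    (fun t : measurableTypeR R => c * t + t0 : measurableTypeR R)%R).
pose nu := nu0 maff.
apply/esym; apply: (@lebesgue_measure_unique R nu) => // _ [[a b]] _ <-.
rewrite /nu/nu0 /= /mscale /= /pushforward /=.
have [cp|cn|c00] := (ltgtP c 0)%R; last by rewrite c00 eqxx in c0.
- rewrite [X in _ * lebesgue_measure X](_ : _ = `[((b - t0) / c)%R, ((a - t0) / c)%R[%classic); last first.
    by apply/seteqP; split => t /=; rewrite !in_itv/= ler_ndivrMr// ltr_ndivlMr//;
      move=> /andP[? ?]; apply/andP; split; lra.
  rewrite !lebesgue_measure_itv/= !lte_fin ltr_nM2r ?invr_lt0// ltrD2r.
  case: ifPn => _; last by rewrite mule0.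
  by rewrite -!EFinD -EFinM; congr EFin; rewrite ltr0_norm//; field.
- rewrite [X in _ * lebesgue_measure X](_ : _ = `]((a - t0) / c)%R, ((b - t0) / c)%R]%classic); last first.
    by apply/seteqP; split => t /=; rewrite !in_itv/= ltr_pdivrMr// ler_pdivlMr//;
      move=> /andP[? ?]; apply/andP; split; lra.
  rewrite !lebesgue_measure_itv/= !lte_fin ltr_pM2r ?invr_gt0// ltrD2r.
  case: ifPn => _; last by rewrite mule0.
  by rewrite -!EFinD -EFinM; congr EFin; rewrite gtr0_norm//; field.
Qed.

Lemma ge0_integral_affine1 (c t0 : R) (F : R -> \bar R) : c != 0%R ->
  measurable_fun setT F -> (forall t, 0 <= F t) ->
  `|c|%:E * (\int[lebesgue_measure]_t F (c * t + t0)%R) = \int[lebesgue_measure]_t F t.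
Proof.
move=> c0 mF F0.
have maff : measurable_fun setT (fun t : measurableTypeR R => c * t + t0 : measurableTypeR R)%R.
  by apply: measurable_funD => //; exact: measurable_funM.
pose nu0 : {measure set (measurableTypeR R) -> \bar R} :=
  mscale (NngNum (normr_ge0 c)) (pushforward lebesgue_measure
    (fun t : measurableTypeR R => c * t + t0 : measurableTypeR R)%R).
pose nu := nu0 maff.
have -> : \int[lebesgue_measure]_t F t = \int[nu]_t F t.
  by apply: eq_measure_integral => //= A mA _; rewrite -(lebesgue_measure_affine t0 c0).
rewrite /nu/nu0 ge0_integral_mscale//.
by rewrite ge0_integral_pushforward.
Qed.

Lemma ge0_integral_row_cons n (F : 'rV[R]_n.+1 -> \bar R) :
  measurable_fun setT F -> (forall x, 0 <= F x) ->
  \int[lebesgue_row R n.+1]_x F x =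
  \int[lebesgue_measure]_t \int[lebesgue_row R n]_x F (row_cons (t, x)).
Proof.
move=> mF F0; rewrite /= ge0_integral_pushforward//; last exact: measurable_row_cons.
rewrite preimage_setT fubini_tonelli1//.
  by apply: measurableT_comp => //; exact: measurable_row_cons.
by move=> x; exact: F0.
Qed.

(** Induction on the dimension: Tonelli splits off the head coordinate, which contributes one factor
    [|c|] by the one-dimensional formula. *)
Lemma ge0_integral_affine n (c : R) (x0 : 'rV[R]_n) (F : 'rV[R]_n -> \bar R) : c != 0%R ->
  measurable_fun setT F -> (forall x, 0 <= F x) ->
  (`|c| ^+ n)%:E * (\int[lebesgue_row R n]_x F (c *: x + x0)%R) = \int[lebesgue_row R n]_x F x.
Proof.
move=> c0; elim: n x0 F => [|n IH] x0 F mF F0.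
  rewrite expr0 mul1e; apply: eq_integral => x _; congr F.
  by rewrite !thinmx0.
rewrite !ge0_integral_row_cons//; last first.
  apply: (measurableT_comp mF) => //; apply: measurable_rowD => //; exact: measurable_rowZ.
pose x0' : 'rV[R]_n := \row_j x0 0%R (lift ord0 j).
have E t (x : 'rV[R]_n) :
    (c *: row_cons (t, x) + x0)%R = row_cons ((c * t + x0 0 ord0)%R, (c *: x + x0')%R).
  apply/rowP => i; rewrite !mxE; case: unliftP => [j ->|->] //=.
  by rewrite !mxE.
have mFc t : measurable_fun setT (fun x : 'rV[R]_n => F (row_cons (t, x))).
  apply: (measurableT_comp mF); apply: (measurableT_comp (@measurable_row_cons R n)).
  exact: pair1_measurable.
pose G t := \int[lebesgue_row R n]_x F (row_cons (t, x)).
have mG : measurable_fun setT G.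
  rewrite /G; apply: (@measurable_fun_fubini_tonelli_F _ _ _ _ _ _ (fun z => F (row_cons z))) => //.
  exact: (measurableT_comp mF (@measurable_row_cons R n)).
rewrite exprS EFinM -muleA -ge0_integralZl//.
- rewrite -/G -(@ge0_integral_affine1 c (x0 0 ord0)%R G)//; last by move=> t; exact: integral_ge0.
  congr *%E; apply: eq_integral => t _.
  by rewrite /G -(IH x0' (fun x => F (row_cons _)))//; congr *%E; apply: eq_integral => x _; rewrite E.
- apply: (@measurable_fun_fubini_tonelli_F _ _ _ _ _ _ (fun z => F (c *: row_cons z + x0)%R)) => //.
  apply: (measurableT_comp mF); apply: measurable_rowD => //; apply: measurable_rowZ.
  exact: measurable_row_cons.
- by move=> t _; exact: integral_ge0.
Qed.

End row_affine.

Section row_integral.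
Context (R : realType) (n : nat).
Local Notation Rn := 'rV[R]_n.
Local Notation mu := (lebesgue_row R n).

Lemma measure_row_affine (c : R) (x0 : Rn) (A : set Rn) : c != 0 -> measurable A ->
  ((`|c| ^+ n)%:E * mu ((fun x => (c *: x + x0)%R) @^-1` A) = mu A)%E.
Proof.
move=> c0 mA.
have maff : measurable_fun setT (fun x : Rn => (c *: x + x0)%R).
  by apply: measurable_rowD => //; exact: measurable_rowZ.
have := @ge0_integral_affine R n c x0 (EFin \o \1_A) c0.
rewrite [X in _ -> _ -> _ = X](_ : _ = mu A); last by rewrite integral_indic// setIT.
move=> <-.
- congr *%E; rewrite -[X in mu X]setIT -integral_indic//.
  by rewrite -[X in measurable X]setTI; exact: maff.
- exact/measurable_EFinP/measurable_indic.
- by move=> x; rewrite lee_fin.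
Qed.

Lemma integrable_row_affine (c : R) (x0 : Rn) (F : Rn -> R) : c != 0 ->
  mu.-integrable setT (EFin \o F) ->
  mu.-integrable setT (EFin \o (fun x => F (c *: x + x0))).
Proof.
move=> c0 /integrableP[mF Foo].
have maff : measurable_fun setT (fun x : Rn => (c *: x + x0)%R).
  by apply: measurable_rowD => //; exact: measurable_rowZ.
apply/integrableP; split; first exact: (measurableT_comp mF maff).
move: Foo; rewrite -(ge0_integral_affine x0 c0)//; last exact: measurableT_comp mF.
set I := (X in (_ * X < _)%E -> _) => Ioo.
have I0 : (0 <= I)%E by exact: integral_ge0.
rewrite ltNge leye_eq; apply/negP => /eqP IE.
have : I = +oo%E by [].
move=> E; move: Ioo; rewrite E mulry gtr0_sg ?mul1e ?ltxx//.
by rewrite exprn_gt0// normr_gt0.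
Qed.

Lemma Rintegral_row_affine (c : R) (x0 : Rn) (F : Rn -> R) : c != 0 ->
  mu.-integrable setT (EFin \o F) ->
  `|c| ^+ n * (\int[mu]_x F (c *: x + x0)) = \int[mu]_x F x.
Proof.
move=> c0 iF; have iFa := integrable_row_affine x0 c0 iF.
have [mF _] := integrableP _ _ _ iF.
rewrite /Rintegral.
rewrite -[`|c| ^+ n]/(fine (`|c| ^+ n)%:E) -fineM//; last exact: integrable_fin_num.
congr fine; rewrite integralE [RHS]integralE.
have mp : measurable_fun setT (EFin \o F)^\+%E by exact: measurable_funepos.
have mn : measurable_fun setT (EFin \o F)^\-%E by exact: measurable_funeneg.
rewrite -[X in (_ = X - _)%E](ge0_integral_affine x0 c0)//.
rewrite -[X in (_ = _ - X)%E](ge0_integral_affine x0 c0)//.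
rewrite muleBr//.
  by congr (_ * _ - _ * _)%E; apply: eq_integral => x _; rewrite ?funeposE ?funenegE.
by apply: fin_num_adde_defl; rewrite fin_numN; apply: integrable_fin_num => //; exact: integrable_funeneg.
Qed.

Lemma row_translate (x0 : Rn) (F : Rn -> R) :
  mu.-integrable setT (EFin \o F) ->
  mu.-integrable setT (EFin \o (fun x => F (x + x0))) /\
  \int[mu]_x F (x + x0) = \int[mu]_x F x.
Proof.
move=> iF; split.
  have := integrable_row_affine x0 (oner_neq0 R) iF.
  by under eq_fun do rewrite /= scale1r.
have := Rintegral_row_affine x0 (oner_neq0 R) iF.
rewrite normr1 expr1n mul1r => <-.
by apply: eq_Rintegral => x _; rewrite scale1r.
Qed.

(** An integrable majorant in product form: Tonelli reduces its integral to that of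
    [1 / (1 + t ^ 2)] over the line. It serves to dominate [decay]. *)
Definition weight (x : Rn) : R := \prod_(i < n) (1 + x 0 i ^+ 2)^-1.

Lemma weight_gt0 x : 0 < weight x.
Proof. by apply: prodr_gt0 => i _; rewrite invr_gt0 ltr_pwDl// sqr_ge0. Qed.

Lemma weight_ge0 x : 0 <= weight x. Proof. exact/ltW/weight_gt0. Qed.

Lemma measurable_weight : measurable_fun setT weight.
Proof.
apply: measurable_prod => i _.
apply: (measurableT_comp (f := fun t : R => (1 + t ^+ 2)^-1)); last exact: measurable_coord.
by apply: continuous_measurable_fun; exact: continuous_oneDsqrV.
Qed.

Lemma enorm_ge0 (x : Rn) : 0 <= enorm x. Proof. exact: sqrtr_ge0. Qed.

Lemma coord_le_enorm (x : Rn) i : `|x 0 i| <= enorm x.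
Proof.
rewrite -sqrtr_sqr ler_sqrt; last by apply: sumr_ge0 => ? _; exact: sqr_ge0.
by rewrite (bigD1 i)//= lerDl sumr_ge0// => ? _; exact: sqr_ge0.
Qed.

Lemma norm_le_enorm (x : Rn) : `|x| <= enorm x.
Proof.
rewrite row_norm_le ?enorm_ge0//; apply/forallP => i; exact: coord_le_enorm.
Qed.

Lemma enorm_le_sum (x : Rn) : enorm x <= \sum_(i < n) `|x 0 i|.
Proof.
have h : 0 <= \sum_(i < n) `|x 0 i| by exact: sumr_ge0.
rewrite -[leRHS]ger0_norm// -sqrtr_sqr ler_sqrt ?sqr_ge0//.
rewrite expr2 mulr_suml ler_sum// => i _.
rewrite -normr_id -real_normK ?num_real// normr_id expr2 ler_wpM2l//.
by rewrite (bigD1 i)//= lerDl sumr_ge0.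
Qed.

Lemma enorm_le_norm (x : Rn) : enorm x <= n%:R * `|x|.
Proof.
apply: (le_trans (enorm_le_sum x)).
have -> : n%:R * `|x| = \sum_(i < n) `|x| by rewrite sumr_const card_ord mulr_natl.
rewrite ler_sum// => i _.
exact: row_coord_le.
Qed.

Lemma weight_norm (x : Rn) : 1 <= (1 + `|x|) ^+ (n * 2) * weight x.
Proof.
rewrite /weight prodfV ler_pdivlMr ?mul1r; last first.
  by apply: prodr_gt0 => i _; rewrite ltr_pwDl// sqr_ge0.
have -> : (1 + `|x|) ^+ (n * 2) = \prod_(i < n) (1 + `|x|) ^+ 2.
  by rewrite prodr_const card_ord -exprM mulnC.
apply: ler_prod => i _.
rewrite addr_ge0 ?sqr_ge0//=.
have := row_coord_le x i; have := normr_ge0 x; rewrite -(real_normK (num_real (x 0 i))).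
have := normr_ge0 (x 0 i); nra.
Qed.

End row_integral.

Section weight_integrable.
Context (R : realType).

Lemma integral_oneDsqrV : (\int[@lebesgue_measure R]_t ((1 + t ^+ 2)^-1)%:E < +oo)%E.
Proof.
have mf : measurable_fun [set: R] (fun t : R => ((1 + t ^+ 2)^-1)%:E).
  apply/measurable_EFinP; apply: continuous_measurable_fun; exact: continuous_oneDsqrV.
have f0 (t : R) : (0 <= ((1 + t ^+ 2)^-1)%:E)%E.
  by rewrite lee_fin invr_ge0 addr_ge0// sqr_ge0.
have h1 := integral0y_oneDsqr R.
have h2 := ge0_integration_by_substitution0 mf f0.
have -> : [set: R] = `]-oo, 0[ `|` `[0, +oo[.
  by apply/seteqP; split => // t _ /=; rewrite !in_itv/= andbT; case: (ltP t 0); [left|right].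
rewrite ge0_integral_setU//=; last 2 first.
- exact: measurable_funTS.
- rewrite disj_set2E; apply/eqP; rewrite -subset0 => t [] /=.
  by rewrite !in_itv/= andbT leNgt => ->.
apply: lte_add_pinfty; last by rewrite h1 ltry.
apply: (@le_lt_trans _ _ (\int[@lebesgue_measure R]_(t in `]-oo, 0%R]) ((1 + t ^+ 2)^-1)%:E)%E).
  apply: ge0_subset_integral => //; first exact: measurable_funTS.
  by move=> t /=; rewrite !in_itv/= => /ltW.
under eq_integral do rewrite -sqrrN.
by rewrite -h2 h1 ltry.
Qed.

Lemma integrable_weight n : (lebesgue_row R n).-integrable setT (EFin \o @weight R n).
Proof.
apply/integrableP; split; first by apply/measurable_EFinP; exact: measurable_weight.
under eq_integral do rewrite /= ger0_norm ?weight_ge0//.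
elim: n => [|n IH].
  under eq_integral do rewrite /weight big_ord0.
  by rewrite /= integral_cst//= mul1e diracT ltry.
rewrite ge0_integral_row_cons; first last.
- by move=> x; rewrite lee_fin weight_ge0.
- by apply/measurable_EFinP; exact: measurable_weight.
have E t (x : 'rV[R]_n) : (weight (row_cons (t, x)) = (1 + t ^+ 2)^-1 * weight x)%R.
  rewrite /weight big_ord_recl; congr (_ * _)%R; first by rewrite mxE unlift_none.
  by apply: eq_bigr => i _; rewrite mxE liftK.
under eq_integral => t _.
  under eq_integral do rewrite E EFinM.
  rewrite ge0_integralZl//; first last.
  - by rewrite lee_fin invr_ge0 addr_ge0// sqr_ge0.
  - by move=> x _; rewrite lee_fin weight_ge0.
  - by apply/measurable_EFinP; exact: measurable_weight.
  over.
rewrite ge0_integralZr//; first last.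
- by apply: integral_ge0 => x _; rewrite lee_fin weight_ge0.
- by move=> t _; rewrite lee_fin invr_ge0 addr_ge0// sqr_ge0.
- by apply/measurable_EFinP; apply: continuous_measurable_fun; exact: continuous_oneDsqrV.
apply: lte_mul_pinfty IH.
  by apply: integral_ge0 => t _; rewrite lee_fin invr_ge0 addr_ge0// sqr_ge0.
rewrite ge0_fin_numE ?integral_oneDsqrV//.
by apply: integral_ge0 => t _; rewrite lee_fin invr_ge0 addr_ge0// sqr_ge0.
Qed.

(** The norm on rows is the sup norm, so balls are cubes. *)
Lemma row_ball_measure n (x : 'rV[R]_n) (r : R) : 0 < r ->
  lebesgue_row R n (ball x r) = ((2 * r) ^+ n)%:E.
Proof.
move=> r0; rewrite (_ : ball x r = [set y | forall i, ball (x 0 i) r (y 0 i)]); last first.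
  apply/seteqP; split => y; rewrite -!ball_normE /ball_/= row_norm_lt//.
    by move=> /forallP h i; have := h i; rewrite !mxE.
  by move=> h; apply/forallP => i; rewrite !mxE; exact: h.
rewrite (@lebesgue_row_rect R n (fun i => ball (x 0 i) r : set R)); last by move=> i; exact: measurable_ball.
under eq_bigr do rewrite lebesgue_measure_ball ?ltW//.
rewrite big_const card_ord mulr_natl.
by elim: n {x} => [|k IH] //=; rewrite IH -EFinM exprS.
Qed.

End weight_integrable.

(** * Real and imaginary parts, modulus *)

Section complex_facts.
Context (R : realType).
Local Notation C := R[i].
Implicit Types z w : C.

Lemma cext z w : complex.Re z = complex.Re w -> complex.Im z = complex.Im w -> z = w.
Proof. by case: z => a b; case: w => c d /= -> ->. Qed.

Lemma Re_addc z w : complex.Re (z + w) = complex.Re z + complex.Re w.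
Proof. by case: z; case: w. Qed.
Lemma Im_addc z w : complex.Im (z + w) = complex.Im z + complex.Im w.
Proof. by case: z; case: w. Qed.
Lemma Re_mulc z w : complex.Re (z * w) = complex.Re z * complex.Re w - complex.Im z * complex.Im w.
Proof. by case: z; case: w. Qed.
Lemma Im_mulc z w : complex.Im (z * w) = complex.Re z * complex.Im w + complex.Im z * complex.Re w.
Proof. by case: z => a b; case: w => c d. Qed.
Lemma Re_oppc z : complex.Re (- z) = - complex.Re z. Proof. by case: z. Qed.
Lemma Im_oppc z : complex.Im (- z) = - complex.Im z. Proof. by case: z. Qed.
Definition cE := (Re_addc, Im_addc, Re_mulc, Im_mulc, Re_oppc, Im_oppc).

Lemma normc_ge0 z : 0 <= Normc.normc z.
Proof. by case: z => a b /=; exact: sqrtr_ge0. Qed.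

Lemma Re_le_normc z : `|complex.Re z| <= Normc.normc z.
Proof.
by case: z => a b /=; rewrite -sqrtr_sqr ler_sqrt ?addr_ge0 ?sqr_ge0// lerDl sqr_ge0.
Qed.

Lemma Im_le_normc z : `|complex.Im z| <= Normc.normc z.
Proof.
by case: z => a b /=; rewrite -sqrtr_sqr ler_sqrt ?addr_ge0 ?sqr_ge0// lerDr sqr_ge0.
Qed.

Lemma normc_le z : Normc.normc z <= `|complex.Re z| + `|complex.Im z|.
Proof.
case: z => a b /=; rewrite -[leRHS]ger0_norm ?addr_ge0// -sqrtr_sqr ler_sqrt ?sqr_ge0//.
by rewrite sqrrD !real_normK ?num_real// -addrA lerD2l lerDr mulrn_wge0// mulr_ge0.
Qed.

Lemma normcM z w : Normc.normc (z * w) = Normc.normc z * Normc.normc w.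
Proof. exact: Normc.normcM. Qed.

Lemma normcD z w : Normc.normc (z + w) <= Normc.normc z + Normc.normc w.
Proof. exact: le_normcD. Qed.

Lemma normcR (x : R) : Normc.normc x%:C = `|x|.
Proof. by rewrite /= expr0n/= addr0 sqrtr_sqr. Qed.

Lemma normc_cis t : Normc.normc (cis t : C) = 1.
Proof. by rewrite /cis /= cos2Dsin2 sqrtr1. Qed.

Lemma cisD s t : cis (s + t) = cis s * cis t :> C.
Proof. by apply: cext; rewrite /cis /= ?cosD ?sinD// addrC mulrC [X in _ + X]mulrC. Qed.

End complex_facts.

(** * Smooth functions *)

Section directional.
Context (R : realType) (V : normedModType R).
Implicit Types f g : V -> R.

(** Directional derivatives are derivatives of restrictions to lines; the mean value theorem, the
    chain rule and differentiation under the integral sign are all used in this form. *)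
Lemma is_derive_line f (y v : V) (t d : R) :
  is_derive (t *: v + y) v f d <-> is_derive t 1 (fun s : R => f (s *: v + y)) d.
Proof.
have E : (fun h : R => h^-1 *: (((fun s : R => f (s *: v + y)) \o shift t) (h *: 1) - f (t *: v + y))) =
  (fun h : R => h^-1 *: ((f \o shift (t *: v + y)) (h *: v) - f (t *: v + y))).
  apply/funext => h /=; congr (_ *: (f _ - _)).
  by rewrite /GRing.scale /= mulr1 -/(GRing.scale _ _) scalerDl addrA.
split=> -[df dv]; constructor; rewrite -?dv; move: df; rewrite /derivable /derive E//.
Qed.

Lemma is_derive_line0 f (y v : V) (d : R) :
  is_derive y v f d <-> is_derive (0 : R) 1 (fun s : R => f (s *: v + y)) d.
Proof. by have := is_derive_line f y v 0 d; rewrite scale0r add0r. Qed.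

Lemma derivable_line f (y v : V) (t : R) : derivable f (t *: v + y) v ->
  is_derive t 1 (fun s : R => f (s *: v + y)) ('D_v f (t *: v + y)).
Proof. by move=> df; apply/is_derive_line; exact: derivableP. Qed.

Lemma is_derive_affine f (c : R) (x x0 v : V) (d : R) :
  is_derive (c *: x + x0) v f d ->
  is_derive x v (fun z => f (c *: z + x0)) (c * d).
Proof.
move=> /is_derive_line0 df; apply/is_derive_line0.
have -> : (fun s : R => f (c *: (s *: v + x) + x0)) =
    (fun s : R => f (s *: v + (c *: x + x0))) \o (fun s => c * s).
  by apply/funext => s /=; rewrite scalerDr scalerA addrA.
have h : is_derive (0 : R) 1 (fun s => c * s) c.
  by apply: is_derive_eq; rewrite /GRing.scale/= !(mulr0, add0r, addr0, mulr1).
rewrite mulrC; apply: is_derive1_comp => //.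
by rewrite mulr0.
Qed.

Lemma mvt_line f (x v : V) (t B : R) : 0 <= t ->
  (forall y, derivable f y v) ->
  (forall s, 0 <= s <= t -> `|'D_v f (s *: v + x)| <= B) ->
  `|f (t *: v + x) - f x| <= t * B.
Proof.
move=> t0 df hB.
have [|c] := @MVT_segment R (fun s => f (s *: v + x)) (fun s => 'D_v f (s *: v + x)) 0 t t0
  (fun s _ => derivable_line (df _)).
  apply: derivable_within_continuous => s _.
  by have [] := derivable_line (df (s *: v + x)).
rewrite in_itv/= => ct; rewrite scale0r add0r => ->.
by rewrite subr0 normrM (ger0_norm t0) mulrC ler_wpM2l// hB.
Qed.

End directional.

Section smooth_theory.
Context (R : realType) (n : nat).
Local Notation Rn := 'rV[R]_n.
Implicit Types f g : Rn -> R.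

Lemma row_continuousD f g : continuous f -> continuous g -> continuous (fun x => f x + g x).
Proof. by move=> cf cg x; exact: (continuousD (cf x) (cg x)). Qed.

Lemma row_continuousM f g : continuous f -> continuous g -> continuous (fun x => f x * g x).
Proof. by move=> cf cg x; exact: (continuousM (cf x) (cg x)). Qed.

Lemma row_continuous_cst (c : R) : continuous (fun _ : Rn => c).
Proof. by move=> x; exact: cst_continuous. Qed.

(** [partials] applies the last letter of a word first, so inductions on words peel letters from the
    right; this is why [last_ind] recurs below. *)
Lemma partials_rcons l i f :
  partials (rcons l i) f = partials l (fun x => 'D_('e_i) f x).
Proof. by rewrite /partials foldr_rcons. Qed.

Fixpoint Ck k f : Prop :=
  continuous f /\ (if k is k'.+1 then
    forall i, (forall x, derivable f x 'e_i) /\ Ck k' (fun x => 'D_('e_i) f x)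
  else True).

Lemma smooth_derive f i : smooth f -> smooth (fun x => 'D_('e_i) f x).
Proof. by move=> sf l; have := sf (rcons l i); rewrite partials_rcons. Qed.

Lemma smooth_continuous f : smooth f -> continuous f.
Proof. by move=> /(_ [::])[]. Qed.

Lemma smooth_derivable f i x : smooth f -> derivable f x 'e_i.
Proof. by move=> /(_ [::])[_]; exact. Qed.

Lemma smoothP f : smooth f <-> forall k, Ck k f.
Proof.
split=> [sf k|].
  elim: k f sf => [|k IH] f sf /=; split=> //; try exact: smooth_continuous.
  move=> i; split=> [x|]; first exact: smooth_derivable.
  by apply: IH; exact: smooth_derive.
move=> + l; elim/last_ind: l f => [|l i IH] f Cf.
  split; first by case: (Cf 0%N).
  by move=> i x; case: (Cf 1%N) => _ /(_ i)[].
by rewrite partials_rcons; apply: IH => k; case: (Cf k.+1) => _ /(_ i)[].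
Qed.

(** Coinduction: stability of a class of continuous functions under partial derivatives replaces
    formulas for iterated derivatives. It is applied to affine substitutions, to Fourier transforms
    and to polynomials in a logistic function. *)
Lemma smooth_coind (S : set (Rn -> R)) :
  (forall f, S f -> continuous f /\ forall i,
    (forall x, derivable f x 'e_i) /\ S (fun x => 'D_('e_i) f x)) ->
  forall f, S f -> smooth f.
Proof.
move=> hS f Sf; apply/smoothP => k; elim: k f Sf => [|k IH] f Sf /=.
  by case: (hS f Sf).
by case: (hS f Sf) => cf df; split=> // i; split; [exact: (df i).1|apply: IH; exact: (df i).2].
Qed.

Lemma CkS k f : Ck k.+1 f -> Ck k f.
Proof.
elim: k f => [|k IH] f; first by case.
by move=> [cf df]; split=> // i; split; [exact: (df i).1|apply: IH; exact: (df i).2].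
Qed.

Lemma Ck_add k f g : Ck k f -> Ck k g -> Ck k (fun x => f x + g x).
Proof.
elim: k f g => [|k IH] f g /= [cf df] [cg dg]; split => //; try exact: row_continuousD.
move=> i; split=> [x|]; first by apply: derivableD; [exact: (df i).1|exact: (dg i).1].
rewrite (_ : (fun x => _) = (fun x => 'D_('e_i) f x + 'D_('e_i) g x)); last first.
  by apply/funext => x; rewrite deriveD//; [exact: (df i).1|exact: (dg i).1].
by apply: IH; [exact: (df i).2|exact: (dg i).2].
Qed.

Lemma deriveM_row f g x i : derivable f x 'e_i -> derivable g x 'e_i ->
  'D_('e_i) (fun x => f x * g x) x = 'D_('e_i) f x * g x + f x * 'D_('e_i) g x.
Proof.
by move=> df dg; rewrite (deriveM df dg) addrC; congr (_ + _); rewrite /GRing.scale/= mulrC.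
Qed.

Lemma deriveD_row f g x i : derivable f x 'e_i -> derivable g x 'e_i ->
  'D_('e_i) (fun x => f x + g x) x = 'D_('e_i) f x + 'D_('e_i) g x.
Proof. exact: deriveD. Qed.

Lemma deriveB_row f g x i : derivable f x 'e_i -> derivable g x 'e_i ->
  'D_('e_i) (fun x => f x - g x) x = 'D_('e_i) f x - 'D_('e_i) g x.
Proof. exact: deriveB. Qed.

Lemma deriveN_row f x i : derivable f x 'e_i ->
  'D_('e_i) (fun x => - f x) x = - 'D_('e_i) f x.
Proof. exact: deriveN. Qed.

Lemma derivableM_row f g x i : derivable f x 'e_i -> derivable g x 'e_i ->
  derivable (fun x => f x * g x) x 'e_i.
Proof. exact: derivableM. Qed.

Lemma Ck_mul k f g : Ck k f -> Ck k g -> Ck k (fun x => f x * g x).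
Proof.
elim: k f g => [|k IH] f g; first by move=> [cf _] [cg _]; split => //; exact: row_continuousM.
move=> Cf Cg; have [cf df] := Cf; have [cg dg] := Cg; split.
  exact: row_continuousM.
move=> i; split=> [x|]; first by apply: derivableM; [exact: (df i).1|exact: (dg i).1].
rewrite (_ : (fun x => _) = (fun x => 'D_('e_i) f x * g x + f x * 'D_('e_i) g x)); last first.
  by apply/funext => x; rewrite deriveM_row//; [exact: (df i).1|exact: (dg i).1].
by apply: Ck_add; apply: IH; try exact: CkS; [exact: (df i).2|exact: (dg i).2].
Qed.

Lemma smoothD f g : smooth f -> smooth g -> smooth (fun x => f x + g x).
Proof. by move=> /smoothP sf /smoothP sg; apply/smoothP => k; exact: Ck_add. Qed.

Lemma smoothM f g : smooth f -> smooth g -> smooth (fun x => f x * g x).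
Proof. by move=> /smoothP sf /smoothP sg; apply/smoothP => k; exact: Ck_mul. Qed.

Lemma smooth_cst (c : R) : smooth (fun _ : Rn => c).
Proof.
apply: (@smooth_coind [set f | exists c, f = fun=> c]); last by exists c.
move=> _ [{}c ->]; split; first exact: row_continuous_cst.
move=> i; split=> [x|]; first exact: derivable_cst.
by exists 0; apply/funext => x; rewrite derive_cst.
Qed.

Lemma smoothZ (c : R) f : smooth f -> smooth (fun x => c * f x).
Proof. by move=> sf; exact: (smoothM (smooth_cst c) sf). Qed.

Lemma smoothN f : smooth f -> smooth (fun x => - f x).
Proof. by move=> sf; under eq_fun do rewrite -mulN1r; exact: smoothZ. Qed.

Lemma smoothB f g : smooth f -> smooth g -> smooth (fun x => f x - g x).
Proof. by move=> sf sg; exact: (smoothD sf (smoothN sg)). Qed.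

Lemma is_derive_coord (i j : 'I_n) (x : Rn) :
  is_derive x 'e_i (fun y : Rn => y 0 j) (i == j)%:R.
Proof.
apply/is_derive_line0; under eq_fun do rewrite !mxE eqxx/= eq_sym.
apply: is_derive_eq.
by rewrite scaler0 !add0r addr0 /GRing.scale/= mulr1.
Qed.

Lemma smooth_coord (j : 'I_n) : smooth (fun x : Rn => x 0 j).
Proof.
apply: (@smooth_coind [set f | f = (fun x : Rn => x 0 j) \/ exists c, f = fun=> c]); last by left.
move=> f [->|[c ->]]; split.
- exact: coord_continuous.
- move=> i; split=> [x|]; first by have [] := is_derive_coord i j x.
  right; exists (i == j)%:R; apply/funext => x.
  by have [_ ->] := is_derive_coord i j x.
- exact: row_continuous_cst.
- move=> i; split=> [x|]; first exact: derivable_cst.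
  by right; exists 0; apply/funext => x; rewrite derive_cst.
Qed.

Lemma derive_affine f (c : R) (x0 x v : Rn) : derivable f (c *: x + x0) v ->
  'D_v (fun z => f (c *: z + x0)) x = c * 'D_v f (c *: x + x0).
Proof. by move=> /derivableP /is_derive_affine[]. Qed.

Lemma smooth_affine f (c : R) (x0 : Rn) : smooth f -> smooth (fun x => f (c *: x + x0)).
Proof.
move=> sf.
(* The scalar [a] absorbs the factors [c] produced by the chain rule, which makes the class
   stable. *)
apply: (@smooth_coind [set h | exists2 g, smooth g & exists a, h = fun x => a * g (c *: x + x0)]); last first.
  by exists f => //; exists 1; apply/funext => x; rewrite mul1r.
move=> _ [g sg [a ->]]; split.
  apply: row_continuousM; first exact: row_continuous_cst.
  move=> x; apply: (@continuous_comp _ _ _ (fun x : Rn => c *: x + x0) g); last exact: smooth_continuous.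
  by apply: continuousD; [exact: scaler_continuous|exact: cst_continuous].
have dg i x : derivable (fun x => g (c *: x + x0)) x 'e_i.
  by have [] := is_derive_affine (derivableP (@smooth_derivable g i (c *: x + x0) sg)).
move=> i; split=> [x|]; first by apply: derivableM => //; exact: derivable_cst.
exists (fun x => 'D_('e_i) g x); first exact: smooth_derive.
exists (a * c); apply/funext => x.
rewrite (deriveM_row (derivable_cst (V := Rn) a x 'e_i) (dg i x)).
by rewrite derive_cst mul0r add0r derive_affine ?mulrA//; exact: smooth_derivable.
Qed.

Lemma derive_near0 f (U : set Rn) v : open U -> (forall x, U x -> f x = 0) ->
  forall x, U x -> 'D_v f x = 0.
Proof.
move=> oU f0 x Ux; have [->|v0] := eqVneq v 0; first exact: derive0.
rewrite -(derive_cst (V := Rn) (0 : R) x v); apply: near_eq_derive => //.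
by near=> y; apply: f0; near: y; exact: open_nbhs_nbhs.
Unshelve. all: by end_near. Qed.

Lemma partials_near0 f (U : set Rn) l : open U -> (forall x, U x -> f x = 0) ->
  forall x, U x -> partials l f x = 0.
Proof. by move=> oU f0; elim: l => [//|i l IH] /=; exact: derive_near0. Qed.

End smooth_theory.

(** * Calculus of complex-valued smooth functions *)

Section csmooth_theory.
Context (R : realType) (n : nat).
Local Notation Rn := 'rV[R]_n.
Local Notation C := R[i].
Implicit Types f g : Rn -> C.

Definition cD i f : Rn -> C := fun x =>
  'D_('e_i) (fun y => complex.Re (f y)) x +i* 'D_('e_i) (fun y => complex.Im (f y)) x.

Lemma cpartials_rcons l i f : cpartials (rcons l i) f = cpartials l (cD i f).
Proof. by apply/funext => x; rewrite /cpartials !partials_rcons. Qed.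

Lemma cpartials_nil f : cpartials [::] f = f.
Proof. by apply/funext => x; rewrite /cpartials /=; case: (f x). Qed.

Lemma csmooth_cD i f : csmooth f -> csmooth (cD i f).
Proof. by move=> [sr si]; split; [exact: (smooth_derive i sr)|exact: (smooth_derive i si)]. Qed.

Lemma csmooth_cst c : csmooth (fun _ : Rn => c).
Proof. by split; exact: smooth_cst. Qed.

Lemma csmoothD f g : csmooth f -> csmooth g -> csmooth (fun x => f x + g x).
Proof.
move=> [fr fi] [gr gi]; split; under eq_fun do rewrite cE; [exact: (smoothD fr gr)|exact: (smoothD fi gi)].
Qed.

Lemma csmoothM f g : csmooth f -> csmooth g -> csmooth (fun x => f x * g x).
Proof.
move=> [fr fi] [gr gi]; split; under eq_fun do rewrite cE.
  exact: (smoothB (smoothM fr gr) (smoothM fi gi)).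
exact: (smoothD (smoothM fr gi) (smoothM fi gr)).
Qed.

Lemma csmooth_conj f : csmooth f -> csmooth (fun x => (f x)^*%C).
Proof.
move=> [fr fi]; split.
  by rewrite (_ : (fun x => _) = fun x => complex.Re (f x))//; apply/funext => x; case: (f x).
rewrite (_ : (fun x => _) = fun x => - complex.Im (f x)); first exact: smoothN.
by apply/funext => x; case: (f x).
Qed.

Lemma csmooth_real (f : Rn -> R) : smooth f -> csmooth (fun x => (f x)%:C).
Proof. by move=> sf; split; [exact: sf|exact: (@smooth_cst R n 0)]. Qed.

Lemma csmooth_affine (c : R) (x0 : Rn) f : csmooth f -> csmooth (fun x => f (c *: x + x0)).
Proof.
move=> [fr fi]; split.
  exact: (smooth_affine c x0 fr).
exact: (smooth_affine c x0 fi).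
Qed.

Lemma csmooth_sum (I : Type) (r : seq I) (F : I -> Rn -> C) :
  (forall i, csmooth (F i)) -> csmooth (fun x => \sum_(i <- r) F i x).
Proof.
move=> sF; elim: r => [|i r IH].
  by under eq_fun do rewrite big_nil; exact: csmooth_cst.
by under eq_fun do rewrite big_cons; exact: (csmoothD (sF i) IH).
Qed.

Lemma cDD i f g : csmooth f -> csmooth g ->
  cD i (fun x => f x + g x) = (fun x => cD i f x + cD i g x).
Proof.
move=> [fr fi] [gr gi]; apply/funext => x; apply: cext; rewrite /cD ?cE /=.
  under eq_fun do rewrite cE.
  exact: (deriveD_row (@smooth_derivable _ _ _ i x fr) (@smooth_derivable _ _ _ i x gr)).
under eq_fun do rewrite cE.
exact: (deriveD_row (@smooth_derivable _ _ _ i x fi) (@smooth_derivable _ _ _ i x gi)).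
Qed.

Lemma cDM i f g : csmooth f -> csmooth g ->
  cD i (fun x => f x * g x) = (fun x => cD i f x * g x + f x * cD i g x).
Proof.
move=> [fr fi] [gr gi]; apply/funext => x.
have dfr := @smooth_derivable _ _ _ i x fr; have dfi := @smooth_derivable _ _ _ i x fi.
have dgr := @smooth_derivable _ _ _ i x gr; have dgi := @smooth_derivable _ _ _ i x gi.
apply: cext; rewrite /cD !cE /=.
  under eq_fun do rewrite cE.
  rewrite (deriveB_row (derivableM_row dfr dgr) (derivableM_row dfi dgi)).
  by rewrite (deriveM_row dfr dgr) (deriveM_row dfi dgi); ring.
under eq_fun do rewrite cE.
rewrite (deriveD_row (derivableM_row dfr dgi) (derivableM_row dfi dgr)).
by rewrite (deriveM_row dfr dgi) (deriveM_row dfi dgr); ring.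
Qed.

Lemma cD_cst i c : cD i (fun _ : Rn => c) = (fun=> 0).
Proof. by apply/funext => x; rewrite /cD !derive_cst. Qed.

Lemma cDZ i c f : csmooth f -> cD i (fun x => c * f x) = (fun x => c * cD i f x).
Proof.
move=> sf; rewrite (cDM i (csmooth_cst c) sf).
by apply/funext => x; rewrite cD_cst mul0r add0r.
Qed.

Lemma cD_coord i j : cD i (fun x : Rn => (x 0 j)%:C) = (fun=> (i == j)%:R%:C).
Proof.
apply/funext => x; apply: cext; rewrite /cD /=; last exact: derive_cst.
by have [_ ->] := is_derive_coord i j x.
Qed.

Lemma cD_conj i f : csmooth f -> cD i (fun x => (f x)^*%C) = (fun x => (cD i f x)^*%C).
Proof.
move=> [fr fi]; apply/funext => x; apply: cext; rewrite /cD /=.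
  by congr ('D_ _ _ _); apply/funext => y; case: (f y).
have -> : (fun y => complex.Im (f y)^*%C) = (fun y => - complex.Im (f y)).
  by apply/funext => y; case: (f y).
by rewrite deriveN_row//; exact: smooth_derivable.
Qed.

Lemma cD_affine i (c : R) (x0 : Rn) f : csmooth f ->
  cD i (fun x => f (c *: x + x0)) = (fun x => c%:C * cD i f (c *: x + x0)).
Proof.
move=> [fr fi]; apply/funext => x; apply: cext; rewrite /cD !cE/= mul0r ?subr0 ?addr0.
  by rewrite -(derive_affine (@smooth_derivable _ _ _ i _ fr)).
by rewrite -(derive_affine (@smooth_derivable _ _ _ i _ fi)).
Qed.

Lemma cpartialsD l f g : csmooth f -> csmooth g ->
  cpartials l (fun x => f x + g x) = (fun x => cpartials l f x + cpartials l g x).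
Proof.
elim/last_ind: l f g => [|l i IH] f g sf sg; first by rewrite !cpartials_nil.
by rewrite !cpartials_rcons (cDD i sf sg) (IH _ _ (csmooth_cD i sf) (csmooth_cD i sg)).
Qed.

Lemma cpartialsZ l c f : csmooth f ->
  cpartials l (fun x => c * f x) = (fun x => c * cpartials l f x).
Proof.
elim/last_ind: l f => [|l i IH] f sf; first by rewrite !cpartials_nil.
by rewrite !cpartials_rcons (cDZ i c sf) (IH _ (csmooth_cD i sf)).
Qed.

Lemma cpartials_conj l f : csmooth f ->
  cpartials l (fun x => (f x)^*%C) = (fun x => (cpartials l f x)^*%C).
Proof.
elim/last_ind: l f => [|l i IH] f sf; first by rewrite !cpartials_nil.
by rewrite !cpartials_rcons (cD_conj i sf) (IH _ (csmooth_cD i sf)).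
Qed.

Lemma cpartials_affine l (c : R) (x0 : Rn) f : csmooth f ->
  cpartials l (fun x => f (c *: x + x0)) =
  (fun x => c%:C ^+ size l * cpartials l f (c *: x + x0)).
Proof.
elim/last_ind: l f => [|l i IH] f sf.
  by rewrite !cpartials_nil; apply/funext => x; rewrite mul1r.
rewrite !cpartials_rcons (cD_affine i c x0 sf).
rewrite (cpartialsZ _ _ (csmooth_affine c x0 (csmooth_cD i sf))) (IH _ (csmooth_cD i sf)).
by apply/funext => x; rewrite size_rcons exprS mulrA.
Qed.

Lemma cpartials_near0 f (U : set Rn) l : open U -> (forall x, U x -> f x = 0) ->
  forall x, U x -> cpartials l f x = 0.
Proof.
move=> oU f0 x Ux; apply: cext; rewrite /cpartials /=.
  by apply: (partials_near0 l oU _ Ux) => y /f0 ->.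
by apply: (partials_near0 l oU _ Ux) => y /f0 ->.
Qed.

Lemma csmooth_measurable f : csmooth f -> cmeasurable setT f.
Proof.
by move=> [fr fi]; split; apply: continuous_measurable_row; [exact: (smooth_continuous fr)|exact: (smooth_continuous fi)].
Qed.

End csmooth_theory.

(** * Schwartz functions and the Fourier transform *)

Section row_integration.
Context (R : realType) (n : nat).
Local Notation Rn := 'rV[R]_n.
Local Notation mu := (lebesgue_row R n).
Local Notation "f ^E" := (EFin \o f) (at level 2, only parsing).

Lemma integrable_dom (f G : Rn -> R) : measurable_fun setT f ->
  mu.-integrable setT (EFin \o G) -> (forall x, `|f x| <= G x) ->
  mu.-integrable setT (EFin \o f).
Proof.
move=> mf iG fG; apply: le_integrable iG => //.
  exact/measurable_EFinP.
by move=> x _ /=; rewrite lee_fin (le_trans (fG x))// ler_norm.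
Qed.

Lemma Rintegral_dom (f G : Rn -> R) : measurable_fun setT f ->
  mu.-integrable setT (EFin \o G) -> (forall x, `|f x| <= G x) ->
  `|\int[mu]_x f x| <= \int[mu]_x G x.
Proof.
move=> mf iG fG; have iF := integrable_dom mf iG fG.
apply: (le_trans (le_normr_Rintegral _ _)) => //.
apply: le_Rintegral => //; exact: integrable_norm.
Qed.

Lemma Rintegral_dct (f_ : nat -> Rn -> R) (f G : Rn -> R) :
  (forall m, measurable_fun setT (f_ m)) ->
  mu.-integrable setT (EFin \o G) -> (forall m x, `|f_ m x| <= G x) ->
  (forall x, f_ m x @[m --> \oo] --> f x) ->
  \int[mu]_x f_ m x @[m --> \oo] --> \int[mu]_x f x.
Proof.
move=> mf iG fG fcvg.
have mff : measurable_fun setT f.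
  by apply: (measurable_fun_cvg mf) => x _; exact: fcvg.
have fGl x : `|f x| <= G x.
  have cn : `|f_ m x| @[m --> \oo] --> `|f x| by apply: cvg_norm; exact: fcvg.
  rewrite -(cvg_lim _ cn)//; apply: limr_le; first by apply/cvg_ex; exists `|f x|.
  by near=> m.
have iF := integrable_dom mff iG fGl.
apply: fine_cvg.
rewrite fineK; last exact: integrable_fin_num.
apply: (@dominated_cvg _ _ _ mu setT _ (fun m x => (f_ m x)%:E) _ (EFin \o G)) => //.
- by move=> m; exact/measurable_EFinP.
- by move=> x _; apply: cvg_EFin; [exact: nearW|exact: fcvg].
- by move=> m x _; rewrite /= lee_fin.
Unshelve. all: by end_near. Qed.

(** The exponent [2 n] gives [decay <= weight], hence integrability. As a function of the norm
    alone, [decay] is comparable with its translates by vectors of norm at most 1. *)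
Definition decay (x : Rn) : R := (1 + `|x|) ^- (n * 2).

Lemma norm1_gt0 (x : Rn) : 0 < 1 + `|x|. Proof. by rewrite ltr_pwDl. Qed.
Lemma norm1_ge1 (x : Rn) : 1 <= 1 + `|x|. Proof. by rewrite lerDl. Qed.
Lemma norm1X_gt0 (x : Rn) N : 0 < (1 + `|x|) ^+ N.
Proof. by rewrite exprn_gt0// norm1_gt0. Qed.

Lemma decay_gt0 x : 0 < decay x.
Proof. by rewrite invr_gt0 norm1X_gt0. Qed.

Lemma decay_weight x : decay x <= weight x.
Proof. by rewrite /decay -[leLHS]mul1r ler_pdivrMr ?norm1X_gt0// mulrC weight_norm. Qed.

Lemma measurable_normrow : measurable_fun setT (fun x : Rn => `|x|).
Proof. by apply: continuous_measurable_row => x; exact: norm_continuous. Qed.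

Lemma integrable_decay : mu.-integrable setT (EFin \o decay).
Proof.
apply: (integrable_dom _ (integrable_weight R n)) => [|x].
  rewrite (_ : decay = fun x => ((1 + `|x|) ^+ (n * 2)) `^ (-1)); last first.
    by apply/funext => x; rewrite powR_inv1// ltW// norm1X_gt0.
  apply: (measurableT_comp (f := fun t : R => t `^ (-1))); first exact: measurable_powR.
  by apply: measurable_funX; apply: measurable_funD => //; exact: measurable_normrow.
by rewrite ger0_norm ?decay_weight// ltW// decay_gt0.
Qed.

Lemma decay_shift (x y : Rn) : `|y| <= 1 -> decay (x + y) <= 2 ^+ (n * 2) * decay x.
Proof.
move=> y1; rewrite /decay ler_pdivlMr ?norm1X_gt0// mulrC ler_pdivrMr ?norm1X_gt0//.
rewrite -exprMn lerXn2r ?nnegrE ?mulr_ge0 ?(ltW (norm1_gt0 _))//.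
have : `|x| <= `|x + y| + `|y| by rewrite -[in leLHS](addrK y x) (le_trans (ler_normB _ _)).
have := normr_ge0 (x + y); lra.
Qed.

Lemma norm_delta_le1 (i : 'I_n) (t : R) : `|t| <= 1 -> `|t *: 'e_i : Rn| <= 1.
Proof.
move=> t1; rewrite row_norm_le//; apply/forallP => j; rewrite !mxE eqxx/=.
by case: eqP => _; rewrite ?mulr1// mulr0 normr0.
Qed.

Lemma measurable_dotp (xi : Rn) : measurable_fun setT (fun x : Rn => dotp x xi).
Proof.
apply: measurable_sum => i; apply: measurable_funM => //; exact: measurable_coord.
Qed.

Lemma dotpC (x y : Rn) : dotp x y = dotp y x.
Proof. by apply: eq_bigr => i _; rewrite mulrC. Qed.

Lemma dotpDl (x y z : Rn) : dotp (x + y) z = dotp x z + dotp y z.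
Proof. by rewrite /dotp -big_split; apply: eq_bigr => i _; rewrite mxE mulrDl. Qed.

Lemma dotpZl c (x z : Rn) : dotp (c *: x) z = c * dotp x z.
Proof. by rewrite /dotp mulr_sumr; apply: eq_bigr => i _; rewrite mxE mulrA. Qed.

Lemma dotp_deltal i (z : Rn) : dotp 'e_i z = z 0 i.
Proof.
rewrite /dotp (bigD1 i)//= mxE !eqxx mul1r big1 ?addr0// => j ji.
by rewrite mxE eqxx (negbTE ji) mul0r.
Qed.

Lemma dotp_norm (x z : Rn) : `|dotp x z| <= n%:R * (`|x| * `|z|).
Proof.
apply: (le_trans (ler_norm_sum _ _ _)).
have -> : n%:R * (`|x| * `|z|) = \sum_(i < n) (`|x| * `|z|).
  by rewrite sumr_const card_ord mulr_natl.
by apply: ler_sum => i _; rewrite normrM ler_pM// row_coord_le.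
Qed.

Lemma cos_lipschitz (s t : R) : `|cos s - cos t| <= `|s - t|.
Proof.
wlog st : s t / t <= s.
  by move=> h; have [/h//|/ltW/h] := leP t s; rewrite distrC [leRHS]distrC.
have [|c _ ->] := @MVT_segment R cos (-%R \o sin) t s st (fun x _ => is_derive_cos x).
  by apply: continuous_subspaceT => x; exact: continuous_cos.
by rewrite normrM -[leRHS]mul1r ler_wpM2r//= normrN ler_norml sin_geN1 sin_le1.
Qed.

Lemma sin_lipschitz (s t : R) : `|sin s - sin t| <= `|s - t|.
Proof.
wlog st : s t / t <= s.
  by move=> h; have [/h//|/ltW/h] := leP t s; rewrite distrC [leRHS]distrC.
have [|c _ ->] := @MVT_segment R sin cos t s st (fun x _ => is_derive_sin x).
  by apply: continuous_subspaceT => x; exact: continuous_sin.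
by rewrite normrM -[leRHS]mul1r ler_wpM2r//= ler_norml cos_geN1 cos_le1.
Qed.

(* [osc a b xi] is the integrand of the real part of the Fourier transform of
   [a + i b] and, with [(b, - a)] for [(a, b)], of the imaginary part. *)
Definition osc (a b : Rn -> R) (xi x : Rn) : R :=
  a x * cos (dotp x xi) + b x * sin (dotp x xi).

Definition osc_int (a b : Rn -> R) (xi : Rn) : R := \int[mu]_x osc a b xi x.

Lemma measurable_osc a b xi : measurable_fun setT a -> measurable_fun setT b ->
  measurable_fun setT (osc a b xi).
Proof.
move=> ma mb; apply: measurable_funD; apply: measurable_funM => //.
  apply: (measurableT_comp (f := cos)); last exact: measurable_dotp.
  apply: continuous_measurable_fun; exact: continuous_cos.
apply: (measurableT_comp (f := sin)); last exact: measurable_dotp.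
apply: continuous_measurable_fun; exact: continuous_sin.
Qed.

Lemma osc_le a b xi x : `|osc a b xi x| <= `|a x| + `|b x|.
Proof.
apply: (le_trans (ler_normD _ _)); apply: lerD; rewrite normrM -[leRHS]mulr1 ler_wpM2l//.
  by rewrite ler_norml cos_geN1 cos_le1.
by rewrite ler_norml sin_geN1 sin_le1.
Qed.

Definition decaying (B : R) (a : Rn -> R) :=
  measurable_fun setT a /\ forall x, `|a x| <= B * decay x.

Lemma integrable_osc B a b xi : decaying B a -> decaying B b ->
  mu.-integrable setT (EFin \o osc a b xi).
Proof.
move=> [ma Ba] [mb Bb].
apply: (@integrable_dom _ (fun x => (B + B) * decay x)); first exact: measurable_osc.
  rewrite (_ : EFin \o _ = fun x => ((B + B)%:E * (EFin \o decay) x)%E)//.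
  by apply: integrableZl => //; exact: integrable_decay.
by move=> x; rewrite (le_trans (osc_le _ _ _ _))// mulrDl lerD.
Qed.

Lemma osc_int_bound B a b xi : decaying B a -> decaying B b ->
  `|osc_int a b xi| <= (B + B) * \int[mu]_x decay x.
Proof.
move=> [ma Ba] [mb Bb].
rewrite -RintegralZl//; last exact: integrable_decay.
apply: Rintegral_dom; first exact: measurable_osc.
  rewrite (_ : EFin \o _ = fun x => ((B + B)%:E * (EFin \o decay) x)%E)//.
  by apply: integrableZl => //; exact: integrable_decay.
by move=> x; rewrite (le_trans (osc_le _ _ _ _))// mulrDl lerD.
Qed.

Lemma is_derive_cos_lin (c d t : R) :
  is_derive t 1 (fun s => cos (s * c + d)) (- (c * sin (t * c + d))).
Proof.
have h : is_derive t 1 (fun s => s * c + d) c.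
  by apply: is_derive_eq; rewrite /GRing.scale/= !(mulr0, add0r, addr0, mulr1).
have -> : - (c * sin (t * c + d)) = - sin (t * c + d) * c by ring.
exact: (@is_derive1_comp _ cos (fun s => s * c + d)).
Qed.

Lemma is_derive_sin_lin (c d t : R) :
  is_derive t 1 (fun s => sin (s * c + d)) (c * cos (t * c + d)).
Proof.
have h : is_derive t 1 (fun s => s * c + d) c.
  by apply: is_derive_eq; rewrite /GRing.scale/= !(mulr0, add0r, addr0, mulr1).
rewrite mulrC; exact: (@is_derive1_comp _ sin (fun s => s * c + d)).
Qed.

Lemma is_derive_osc_freq a b xi x i (t : R) :
  is_derive t 1 (fun s => osc a b (s *: 'e_i + xi) x)
    (osc (fun y => y 0 i * b y) (fun y => - (y 0 i * a y)) (t *: 'e_i + xi) x).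
Proof.
have E s : dotp x (s *: 'e_i + xi) = s * x 0 i + dotp x xi.
  by rewrite dotpC dotpDl dotpZl dotp_deltal [dotp xi _]dotpC.
rewrite /osc E; under eq_fun do rewrite E.
have dc := is_derive_cos_lin (x 0 i) (dotp x xi) t.
have ds := is_derive_sin_lin (x 0 i) (dotp x xi) t.
by apply: is_derive_eq; rewrite /GRing.scale/=; ring.
Qed.

(** Differentiation under the integral sign along [t *: 'e_i + xi] with [t] in []-1, 1[]. The
    differentiated integrand is again an [osc], with amplitudes multiplied by [x 0 i]; their decay
    provides the majorant. *)
Lemma osc_int_derive B a b xi i : decaying B a -> decaying B b ->
  decaying B (fun x => x 0 i * a x) -> decaying B (fun x => x 0 i * b x) ->
  is_derive xi 'e_i (osc_int a b)
    (osc_int (fun y => y 0 i * b y) (fun y => - (y 0 i * a y)) xi).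
Proof.
move=> da db dxa dxb; apply/is_derive_line0.
have I0 : `](-1), 1[%classic (0 : R) by rewrite /= in_itv/=; apply/andP; split; lra.
pose f (t : R) x := osc a b (t *: 'e_i + xi) x.
have d1 t x : partial1of2 f t x =
    osc (fun y => y 0 i * b y) (fun y => - (y 0 i * a y)) (t *: 'e_i + xi) x.
  by rewrite partial1of2E; have [_ ->] := is_derive_osc_freq a b xi x i t.
have intf t : `](-1), 1[%classic t -> mu.-integrable setT (EFin \o f t).
  by move=> _; exact: integrable_osc da db.
have derf t x : `](-1), 1[%classic t -> setT x -> derivable (f ^~ x) t 1.
  by move=> _ _; have [] := is_derive_osc_freq a b xi x i t.
pose G x := (`|B| + `|B|) * decay x.
have G0 x : 0 <= G x by rewrite mulr_ge0 ?addr_ge0// ltW// decay_gt0.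
have iG : mu.-integrable setT (EFin \o G).
  rewrite (_ : EFin \o _ = fun x => ((`|B| + `|B|)%:E * (EFin \o decay) x)%E)//.
  by apply: integrableZl => //; exact: integrable_decay.
have Gub t x : `](-1), 1[%classic t -> setT x -> `|partial1of2 f t x| <= G x.
  move=> _ _; rewrite d1 (le_trans (osc_le _ _ _ _))// normrN /G mulrDl lerD//.
    by apply: (le_trans (dxb.2 x)); rewrite ler_wpM2r ?ler_norm// ltW// decay_gt0.
  by apply: (le_trans (dxa.2 x)); rewrite ler_wpM2r ?ler_norm// ltW// decay_gt0.
constructor.
  exact: (derivable_under_integral measurableT I0 intf derf G0 iG Gub).
rewrite -derive1E (differentiation_under_integral measurableT I0 intf derf G0 iG Gub).
by apply: eq_Rintegral => x _; rewrite d1 scale0r add0r.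
Qed.

(** Directional derivatives do not give continuity in several variables, so a Lipschitz bound is
    proved: [cos] and [sin] are 1-Lipschitz, and [|x| * a x] and [|x| * b x] are dominated by
    [decay]. *)
Lemma osc_int_continuous B a b : decaying B a -> decaying B b ->
  decaying B (fun x => `|x| * a x) -> decaying B (fun x => `|x| * b x) ->
  continuous (osc_int a b).
Proof.
move=> da db dxa dxb xi.
pose M := n%:R * (`|B| + `|B|) * \int[mu]_x decay x.
have lip eta : `|osc_int a b xi - osc_int a b eta| <= M * `|xi - eta|.
  rewrite /osc_int -RintegralB//; try exact: integrable_osc da db.
  have -> : M * `|xi - eta| = \int[mu]_x ((n%:R * (`|B| + `|B|) * `|xi - eta|) * decay x).
    by rewrite RintegralZl//; [rewrite /M; ring|exact: integrable_decay].
  apply: Rintegral_dom.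
  - by apply: measurable_funB; apply: measurable_osc; [exact: da.1|exact: db.1|exact: da.1|exact: db.1].
  - rewrite (_ : EFin \o _ = fun x => ((n%:R * (`|B| + `|B|) * `|xi - eta|)%:E * (EFin \o decay) x)%E)//.
    by apply: integrableZl => //; exact: integrable_decay.
  move=> x.
  have dot : `|dotp x xi - dotp x eta| <= n%:R * (`|x| * `|xi - eta|).
    have -> : dotp x xi - dotp x eta = dotp x (xi - eta).
      by rewrite [dotp x xi]dotpC [dotp x eta]dotpC [RHS]dotpC dotpDl -(scaleN1r eta) dotpZl mulN1r.
    exact: dotp_norm.
  have -> : osc a b xi x - osc a b eta x =
    a x * (cos (dotp x xi) - cos (dotp x eta)) + b x * (sin (dotp x xi) - sin (dotp x eta)).
    by rewrite /osc; ring.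
  have h (c : Rn -> R) : decaying B (fun x => `|x| * c x) ->
     `|c x| * `|dotp x xi - dotp x eta| <= n%:R * `|B| * `|xi - eta| * decay x.
    move=> [_ /(_ x)]; rewrite normrM normr_id => hc.
    apply: (le_trans (ler_wpM2l (normr_ge0 _) dot)).
    have -> : `|c x| * (n%:R * (`|x| * `|xi - eta|)) = n%:R * `|xi - eta| * (`|x| * `|c x|) by ring.
    have -> : n%:R * `|B| * `|xi - eta| * decay x = n%:R * `|xi - eta| * (`|B| * decay x) by ring.
    rewrite ler_wpM2l ?mulr_ge0// (le_trans hc)// ler_wpM2r ?ler_norm// ltW// decay_gt0//.
  have -> : n%:R * (`|B| + `|B|) * `|xi - eta| * decay x = n%:R * `|B| * `|xi - eta| * decay x +
      n%:R * `|B| * `|xi - eta| * decay x by ring.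
  apply: (le_trans (ler_normD _ _)); rewrite !normrM lerD//.
    apply: le_trans (h _ dxa); rewrite ler_wpM2l// cos_lipschitz//.
  by apply: le_trans (h _ dxb); rewrite ler_wpM2l// sin_lipschitz.
have M0 : 0 <= M.
  by rewrite !mulr_ge0 ?addr_ge0// Rintegral_ge0// => x _; rewrite ltW// decay_gt0.
have FF : Filter (nbhs xi) by exact: nbhs_filter.
apply/(@cvgrPdist_le _ _ _ _ FF) => e e0; apply/nbhs_ballP.
exists (e / (M + 1)) => /=; first by rewrite divr_gt0// ltr_wpDl.
move=> eta; rewrite -ball_normE /ball_/= ltr_pdivlMr ?ltr_wpDl// => /ltW h.
apply: (le_trans (lip eta)); apply: le_trans h; rewrite mulrC ler_wpM2l// lerDl//.
Qed.

(** The integral of the translate [g (t *: 'e_i + x)] does not depend on [t]; differentiating this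
    constant at 0 under the integral sign gives the claim, with no boundary terms. *)
Lemma Rintegral_derive0 (g : Rn -> R) B i : measurable_fun setT g ->
  (forall x, derivable g x 'e_i) ->
  decaying B g -> decaying B (fun x => 'D_('e_i) g x) ->
  \int[mu]_x 'D_('e_i) g x = 0.
Proof.
move=> mg dg Bg BDg.
have I0 : `](-1), 1[%classic (0 : R) by rewrite /= in_itv/=; apply/andP; split; lra.
pose f (t : R) x := g (t *: 'e_i + x).
have fE t x : f t x = g (x + t *: 'e_i) by rewrite /f addrC.
have d1 t x : partial1of2 f t x = 'D_('e_i) g (t *: 'e_i + x).
  by rewrite partial1of2E; have [_ ->] := derivable_line (dg (t *: 'e_i + x)).
have iG (M : R) : mu.-integrable setT (EFin \o (fun x => M * decay x)).
  rewrite (_ : EFin \o _ = fun x => (M%:E * (EFin \o decay) x)%E)//.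
  by apply: integrableZl => //; exact: integrable_decay.
have ig : mu.-integrable setT (EFin \o g).
  by apply: (integrable_dom mg (iG B)); exact: Bg.2.
have intf t : `](-1), 1[%classic t -> mu.-integrable setT (EFin \o f t).
  move=> _; have [+ _] := row_translate (t *: 'e_i) ig.
  by under eq_fun do rewrite /= -fE.
have derf t x : `](-1), 1[%classic t -> setT x -> derivable (f ^~ x) t 1.
  by move=> _ _; have [] := derivable_line (dg (t *: 'e_i + x)).
pose G x := `|B| * 2 ^+ (n * 2) * decay x.
have G0 x : 0 <= G x by rewrite !mulr_ge0 ?exprn_ge0// ltW// decay_gt0.
have Gub t x : `](-1), 1[%classic t -> setT x -> `|partial1of2 f t x| <= G x.
  move=> /= + _; rewrite in_itv/= => /andP[t1 t2].
  rewrite d1 (le_trans (BDg.2 _))// /G -mulrA.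
  apply: (@le_trans _ _ (`|B| * decay (t *: 'e_i + x))).
    by rewrite ler_wpM2r ?ler_norm// ltW// decay_gt0.
  rewrite ler_wpM2l// addrC decay_shift// norm_delta_le1//.
  by rewrite ler_norml !ltW.
have := differentiation_under_integral measurableT I0 intf derf G0 (iG _) Gub.
have -> : (fun x' => \int[mu]_(y in setT) f x' y) = fun=> \int[mu]_x g x.
  apply/funext => t; have [_ <-] := row_translate (t *: 'e_i) ig.
  by apply: eq_Rintegral => x _; rewrite fE.
rewrite derive1_cst => ->.
by apply: eq_Rintegral => x _; rewrite d1 scale0r add0r.
Qed.

Lemma is_derive_osc_space a b xi x i : derivable a x 'e_i -> derivable b x 'e_i ->
  is_derive x 'e_i (osc a b xi)
    (osc (fun y => 'D_('e_i) a y) (fun y => 'D_('e_i) b y) xi x +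
     xi 0 i * osc b (fun y => - a y) xi x).
Proof.
move=> da db.
have E s : dotp (s *: 'e_i + x) xi = s * xi 0 i + dotp x xi.
  by rewrite dotpDl dotpZl dotp_deltal.
have dc : is_derive x 'e_i (fun y => cos (dotp y xi)) (- (xi 0 i * sin (dotp x xi))).
  apply/is_derive_line0; under eq_fun do rewrite E.
  by have := is_derive_cos_lin (xi 0 i) (dotp x xi) 0; rewrite mul0r add0r.
have ds : is_derive x 'e_i (fun y => sin (dotp y xi)) (xi 0 i * cos (dotp x xi)).
  apply/is_derive_line0; under eq_fun do rewrite E.
  by have := is_derive_sin_lin (xi 0 i) (dotp x xi) 0; rewrite mul0r add0r.
have {}da := derivableP da; have {}db := derivableP db.
apply: is_derive_eq.
by rewrite /osc /GRing.scale/=; ring.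
Qed.

(** Integration by parts: [Rintegral_derive0] applied to [osc a b xi], whose derivative is the sum
    of the two integrands compared here. *)
Lemma osc_int_parts B a b xi i : smooth a -> smooth b ->
  decaying B a -> decaying B b ->
  decaying B (fun x => 'D_('e_i) a x) -> decaying B (fun x => 'D_('e_i) b x) ->
  osc_int (fun y => 'D_('e_i) a y) (fun y => 'D_('e_i) b y) xi =
  - (xi 0 i * osc_int b (fun y => - a y) xi).
Proof.
move=> sa sb Ba Bb Da Db.
have BNa : decaying B (fun y => - a y).
  split; first by apply: measurable_funN; exact: Ba.1.
  by move=> x; rewrite normrN; exact: Ba.2.
have dosc x := is_derive_osc_space xi (@smooth_derivable _ _ _ i x sa) (@smooth_derivable _ _ _ i x sb).
have E : (fun x => 'D_('e_i) (osc a b xi) x) = fun x =>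
    (osc (fun y => 'D_('e_i) a y) (fun y => 'D_('e_i) b y) xi x +
     xi 0 i * osc b (fun y => - a y) xi x).
  by apply/funext => x; have [_ ->] := dosc x.
have h0 : \int[mu]_x 'D_('e_i) (osc a b xi) x = 0.
  apply: (@Rintegral_derive0 _ (2 * `|B| + `|xi 0 i| * (2 * `|B|))).
  - by apply: measurable_osc; [exact: Ba.1|exact: Bb.1].
  - by move=> x; have [] := dosc x.
  - split; first by apply: measurable_osc; [exact: Ba.1|exact: Bb.1].
    move=> x; apply: (le_trans (osc_le _ _ _ _)); rewrite mulrDl.
    apply: (@le_trans _ _ (2 * `|B| * decay x)); last first.
      by rewrite lerDl !mulr_ge0// ltW// decay_gt0.
    rewrite mulr_natl mulr2n mulrDl; apply: lerD.
      by apply: (le_trans (Ba.2 x)); rewrite ler_wpM2r ?ler_norm// ltW// decay_gt0.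
    by apply: (le_trans (Bb.2 x)); rewrite ler_wpM2r ?ler_norm// ltW// decay_gt0.
  - rewrite E; split.
      apply: measurable_funD; first by apply: measurable_osc; [exact: Da.1|exact: Db.1].
      by apply: measurable_funM => //; apply: measurable_osc; [exact: Bb.1|exact: BNa.1].
    have aux c d x : decaying B c -> decaying B d -> `|osc c d xi x| <= 2 * `|B| * decay x.
      move=> Bc Bd; apply: (le_trans (osc_le _ _ _ _)).
      rewrite mulr_natl mulr2n mulrDl; apply: lerD.
        by apply: (le_trans (Bc.2 x)); rewrite ler_wpM2r ?ler_norm// ltW// decay_gt0.
      by apply: (le_trans (Bd.2 x)); rewrite ler_wpM2r ?ler_norm// ltW// decay_gt0.
    move=> x; apply: (le_trans (ler_normD _ _)); rewrite mulrDl; apply: lerD; first exact: aux.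
    by rewrite normrM -mulrA ler_wpM2l// aux.
move: h0; rewrite E RintegralD//; last 2 first.
- exact: integrable_osc Da Db.
- rewrite (_ : EFin \o _ = fun x => ((xi 0 i)%:E * (EFin \o osc b (fun y => - a y)%R xi) x)%E)//.
  by apply: integrableZl => //; exact: integrable_osc Bb BNa.
rewrite RintegralZl//; last exact: integrable_osc Bb BNa.
by move=> /eqP; rewrite addr_eq0 => /eqP.
Qed.

End row_integration.

Arguments fourier : simpl never.
Arguments inv_fourier : simpl never.
Arguments cintegral : simpl never.

(** * Uniform families of Schwartz functions under multiplication and Fourier transform *)

Section schwartz_families.
Context (R : realType) (n : nat).
Local Notation Rn := 'rV[R]_n.
Local Notation C := R[i].
Local Notation mu := (lebesgue_row R n).

(** Every Schwartz seminorm of [f i] is [O(w i)], uniformly in [i]. A rate of convergence such as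
    [2 ^- M] is thereby carried through products and Fourier transforms; the index type [unit] gives
    back single functions. *)
Definition sfam (I : Type) (w : I -> R) (f : I -> Rn -> C) : Prop :=
  (forall i, csmooth (f i)) /\
  forall N l, exists2 B, 0 <= B & forall i x,
    (1 + `|x|) ^+ N * Normc.normc (cpartials l (f i) x) <= B * w i.

(** Multipliers of the Schwartz space, with uniform weights: [sfam_mul] pays for their polynomial
    growth with higher seminorms of the other factor. *)
Definition mfam (I : Type) (w : I -> R) (m : I -> Rn -> C) : Prop :=
  (forall i, csmooth (m i)) /\
  forall l, exists N, exists2 B, 0 <= B & forall i x,
    Normc.normc (cpartials l (m i) x) <= B * w i * (1 + `|x|) ^+ N.

Definition sch (f : Rn -> C) : Prop := sfam (fun _ : unit => 1) (fun _ => f).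

Lemma sch_smooth f : sch f -> csmooth f. Proof. by move=> [/(_ tt)]. Qed.

Lemma schE f : sch f <-> csmooth f /\ forall N l, exists B, forall x,
    (1 + `|x|) ^+ N * Normc.normc (cpartials l f x) <= B.
Proof.
split=> [[sf hf]|[sf hf]].
  split; first exact: sf tt.
  by move=> N l; have [B _ hB] := hf N l; exists B => x; have := hB tt x; rewrite mulr1.
split=> [_|N l]; first exact: sf.
have [B hB] := hf N l; exists `|B| => // -[] x.
by rewrite mulr1 (le_trans (hB x))// ler_norm.
Qed.

Lemma schwartzE (f : Rn -> C) : schwartz f <-> sch f.
Proof.
rewrite schE; split=> -[sf hf]; split=> // N l; have [B hB] := hf N l.
  exists B => x; apply: le_trans (hB x); rewrite ler_wpM2r ?normc_ge0//.
  by rewrite lerXn2r ?nnegrE ?addr_ge0 ?enorm_ge0// lerD2l norm_le_enorm.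
exists (n.+1%:R ^+ N * B) => x.
apply: (@le_trans _ _ (n.+1%:R ^+ N * ((1 + `|x|) ^+ N * Normc.normc (cpartials l f x)))).
  rewrite mulrA ler_wpM2r ?normc_ge0// -exprMn lerXn2r ?nnegrE ?mulr_ge0 ?addr_ge0 ?enorm_ge0//.
  have := enorm_le_norm x; rewrite -natr1 mulrDl mulrDr !mulr1 mul1r => h.
  have := normr_ge0 x; have := ler0n R n; lra.
by rewrite ler_wpM2l// exprn_ge0.
Qed.

Section fam.
Context (I : Type).
Implicit Types (w v : I -> R) (f g m : I -> Rn -> C).

Lemma sfam_sch w f i : sfam w f -> sch (f i).
Proof.
move=> [sf hf]; apply/schE; split; first exact: sf.
by move=> N l; have [B _ hB] := hf N l; exists (B * w i) => x; exact: hB.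
Qed.

Lemma sfam_decaying w f : sfam w f -> exists2 B, 0 <= B & forall i x,
  Normc.normc (f i x) <= B * w i * decay x.
Proof.
move=> [sf hf]; have [B B0 hB] := hf (n * 2)%N [::]; exists B => // i x.
by have := hB i x; rewrite cpartials_nil mulrC -ler_pdivlMr ?norm1X_gt0.
Qed.

Lemma sfam_cD w f j : sfam w f -> sfam w (fun i => cD j (f i)).
Proof.
move=> [sf hf]; split=> [i|N l]; first exact: (csmooth_cD j (sf i)).
by have [B B0 hB] := hf N (rcons l j); exists B => // i x; have := hB i x; rewrite cpartials_rcons.
Qed.

Lemma sfamD w f g : sfam w f -> sfam w g -> sfam w (fun i x => f i x + g i x).
Proof.
move=> [sf hf] [sg hg]; split=> [i|N l]; first exact: (csmoothD (sf i) (sg i)).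
have [B B0 hB] := hf N l; have [B' B0' hB'] := hg N l.
exists (B + B'); first exact: addr_ge0.
move=> i x; rewrite (cpartialsD l (sf i) (sg i)) mulrDl.
apply: (@le_trans _ _ ((1 + `|x|) ^+ N * (Normc.normc (cpartials l (f i) x) + Normc.normc (cpartials l (g i) x)))).
  by rewrite ler_wpM2l ?normcD// ltW// norm1X_gt0.
by rewrite mulrDr lerD.
Qed.

Lemma sfam_mul w v m f : (forall i, 0 <= w i) -> (forall i, 0 <= v i) ->
  mfam w m -> sfam v f -> sfam (fun i => w i * v i) (fun i x => m i x * f i x).
Proof.
move=> w0 v0 Mm Sf; split=> [i|N l]; first exact: (csmoothM (Mm.1 i) (Sf.1 i)).
elim/last_ind: l m f Mm Sf => [|l j IH] m f [sm hm] [sf hf].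
  have [N' [B B0 hB]] := hm [::]; have [B' B0' hB'] := hf (N + N')%N [::].
  exists (B * B'); first exact: mulr_ge0.
  move=> i x; rewrite cpartials_nil normcM.
  have := hB i x; have := hB' i x; rewrite !cpartials_nil => h1 h2.
  apply: (@le_trans _ _ ((1 + `|x|) ^+ N * (B * w i * (1 + `|x|) ^+ N' * Normc.normc (f i x)))).
    by rewrite ler_wpM2l ?(ltW (norm1X_gt0 _ _))// ler_wpM2r ?normc_ge0.
  rewrite (_ : _ * (_ * _) = (B * w i) * ((1 + `|x|) ^+ (N + N') * Normc.normc (f i x))); last first.
    by rewrite exprD; ring.
  by rewrite (_ : B * B' * _ = (B * w i) * (B' * v i)) ?ler_wpM2l ?mulr_ge0//; ring.
have Mm' : mfam w (fun i => cD j (m i)).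
  split=> [i|l']; first exact: (csmooth_cD j (sm i)).
  have [N' [B B0 hB]] := hm (rcons l' j); exists N', B => // i x.
  by have := hB i x; rewrite cpartials_rcons.
have [B B0 hB] := IH _ _ Mm' (conj sf hf).
have [B' B0' hB'] := IH _ _ (conj sm hm) (sfam_cD j (conj sf hf)).
exists (B + B'); first exact: addr_ge0.
move=> i x; rewrite cpartials_rcons (cDM j (sm i) (sf i)).
rewrite (cpartialsD l (csmoothM (csmooth_cD j (sm i)) (sf i)) (csmoothM (sm i) (csmooth_cD j (sf i)))).
rewrite mulrDl; apply: le_trans (lerD (hB i x) (hB' i x)).
by rewrite -mulrDr ler_wpM2l ?normcD// ltW// norm1X_gt0.
Qed.

Lemma mfam_cst c : mfam (fun _ : I => 1) (fun _ _ => c).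
Proof.
split=> [i|l]; first exact: csmooth_cst.
exists 0%N, (Normc.normc c); first exact: normc_ge0.
move=> i x; rewrite expr0 !mulr1; case/lastP: l => [|l j]; first by rewrite cpartials_nil.
rewrite cpartials_rcons cD_cst.
have -> : cpartials l (fun _ : Rn => 0 : C) = fun=> 0.
  elim/last_ind: l => [|l k IH]; first by rewrite cpartials_nil.
  by rewrite cpartials_rcons cD_cst.
by rewrite Normc.normc0 normc_ge0.
Qed.

Lemma mfam_coord j : mfam (fun _ : I => 1) (fun _ (x : Rn) => (x 0 j)%:C).
Proof.
split=> [i|l]; first exact: (csmooth_real (@smooth_coord R n j)).
case/lastP: l => [|l k].
  exists 1%N, 1 => // i x; rewrite cpartials_nil normcR !mul1r expr1.
  by rewrite (le_trans (row_coord_le x j))// lerDr.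
have [_ /(_ l)[N [B B0 hB]]] := mfam_cst (k == j)%:R%:C.
by exists N, B => // i x; rewrite cpartials_rcons cD_coord; exact: hB.
Qed.

Lemma sfamZ c w f : (forall i, 0 <= w i) -> sfam w f -> sfam w (fun i x => c * f i x).
Proof.
move=> w0 Sf; have := sfam_mul (fun=> ler01) w0 (mfam_cst c) Sf.
by under eq_fun do rewrite mul1r.
Qed.

Lemma sfam_coordM w f j : (forall i, 0 <= w i) -> sfam w f ->
  sfam w (fun i x => (x 0 j)%:C * f i x).
Proof.
move=> w0 Sf; have := sfam_mul (fun=> ler01) w0 (mfam_coord j) Sf.
by under eq_fun do rewrite mul1r.
Qed.

Lemma sfam_affine w f (c : R) (x0 : Rn) : c != 0 -> (forall i, 0 <= w i) -> sfam w f ->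
  sfam w (fun i x => f i (c *: x + x0)).
Proof.
move=> c0 w0 [sf hf]; split=> [i|N l]; first exact: (csmooth_affine c x0 (sf i)).
pose K := 1 + `|c|^-1 * (1 + `|x0|).
have cV0 : 0 <= `|c|^-1 by rewrite invr_ge0.
have K0 : 0 <= K by rewrite addr_ge0// mulr_ge0// addr_ge0.
have hK x : 1 + `|x| <= K * (1 + `|c *: x + x0|).
  have h : `|x| <= `|c|^-1 * (`|c *: x + x0| + `|x0|).
    rewrite mulrC ler_pdivlMr ?normr_gt0// mulrC -normrZ.
    by rewrite -{1}(addrK x0 (c *: x)) (le_trans (ler_normB _ _)).
  apply: (le_trans (lerD (lexx 1) h)); rewrite /K mulrDl mul1r -mulrA; apply: lerD.
    by rewrite lerDl.
  by rewrite ler_wpM2l//; have := normr_ge0 x0; have := normr_ge0 (c *: x + x0); nra.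
have [B B0 hB] := hf N l; exists (K ^+ N * `|c| ^+ size l * B).
  by rewrite !mulr_ge0// exprn_ge0.
move=> i x; rewrite (cpartials_affine l c x0 (sf i)) normcM.
have -> : Normc.normc (c%:C ^+ size l) = `|c| ^+ size l.
  elim: (size l) => [|k IH]; first by rewrite !expr0 Normc.normc1.
  by rewrite !exprS normcM IH normcR.
apply: (@le_trans _ _ ((K * (1 + `|c *: x + x0|)) ^+ N * (`|c| ^+ size l *
   Normc.normc (cpartials l (f i) (c *: x + x0))))).
  rewrite ler_wpM2r ?mulr_ge0 ?exprn_ge0 ?normc_ge0//.
  by rewrite lerXn2r ?nnegrE ?mulr_ge0 ?(ltW (norm1_gt0 _)).
rewrite exprMn (_ : _ * (_ * _) = K ^+ N * `|c| ^+ size l * ((1 + `|c *: x + x0|) ^+ N *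
   Normc.normc (cpartials l (f i) (c *: x + x0)))); last by ring.
rewrite -[leRHS]mulrA; apply: ler_wpM2l; last exact: hB.
by rewrite !mulr_ge0// exprn_ge0.
Qed.

Lemma sfam_conj w f : sfam w f -> sfam w (fun i x => (f i x)^*%C).
Proof.
move=> [sf hf]; split=> [i|N l]; first exact: (csmooth_conj (sf i)).
have [B B0 hB] := hf N l; exists B => // i x; rewrite (cpartials_conj l (sf i)).
by have := hB i x; case: (cpartials l (f i) x) => a b /=; rewrite sqrrN.
Qed.

Lemma sfam_eq w f g : (forall i x, f i x = g i x) -> sfam w f -> sfam w g.
Proof. by move=> fg; rewrite (_ : g = f)//; apply/funext => i; apply/funext => x. Qed.

End fam.

Lemma decaying_sch (f : Rn -> C) : sch f -> exists B,
  [/\ 0 <= B, decaying B (fun x => complex.Re (f x)), decaying B (fun x => complex.Im (f x)),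
   decaying B (fun x => - complex.Re (f x)) & decaying B (fun x => - complex.Im (f x))].
Proof.
move=> Sf; have [B B0 hB] := sfam_decaying Sf.
have [mr mi] := csmooth_measurable (sch_smooth Sf).
have h x : Normc.normc (f x) <= B * decay x by have := hB tt x; rewrite mulr1.
exists B; split=> //; split=> //; try exact: measurable_funN.
- by move=> x; exact: le_trans (Re_le_normc _) (h x).
- by move=> x; exact: le_trans (Im_le_normc _) (h x).
- by move=> x; rewrite normrN; exact: le_trans (Re_le_normc _) (h x).
- by move=> x; rewrite normrN; exact: le_trans (Im_le_normc _) (h x).
Qed.

Lemma decayingW B B' (a : Rn -> R) : B <= B' -> decaying B a -> decaying B' a.
Proof.
move=> BB [ma Ba]; split=> // x; rewrite (le_trans (Ba x))// ler_wpM2r// ltW// decay_gt0//.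
Qed.

Lemma Re_fourier (f : Rn -> C) xi : complex.Re (fourier f xi) =
  osc_int (fun x => complex.Re (f x)) (fun x => complex.Im (f x)) xi.
Proof.
apply: eq_Rintegral => x _.
by rewrite Re_mulc /cis /= cosN sinN mulrN opprK.
Qed.

Lemma Im_fourier (f : Rn -> C) xi : complex.Im (fourier f xi) =
  osc_int (fun x => complex.Im (f x)) (fun x => - complex.Re (f x)) xi.
Proof.
apply: eq_Rintegral => x _.
by rewrite Im_mulc /cis /= /osc cosN sinN mulrN mulNr addrC.
Qed.

Definition mulNix j (f : Rn -> C) : Rn -> C := fun x => - 'i * ((x 0 j)%:C * f x).

Lemma sch_mulNix j f : sch f -> sch (mulNix j f).
Proof. by move=> Sf; apply: (sfamZ _ (fun=> ler01)); exact: (sfam_coordM _ (fun=> ler01)). Qed.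

Lemma Re_mulNix j (f : Rn -> C) x : complex.Re (mulNix j f x) = x 0 j * complex.Im (f x).
Proof. by rewrite /mulNix !cE /=; ring. Qed.

Lemma Im_mulNix j (f : Rn -> C) x : complex.Im (mulNix j f x) = - (x 0 j * complex.Re (f x)).
Proof. by rewrite /mulNix !cE /=; ring. Qed.

Lemma fourier_Re_derive j (f : Rn -> C) xi : sch f ->
  is_derive xi 'e_j (fun xi => complex.Re (fourier f xi)) (complex.Re (fourier (mulNix j f) xi)).
Proof.
move=> Sf; have [B [B0 B1 B2 B3 B4]] := decaying_sch Sf.
have [B' [B0' B1' B2' B3' B4']] := decaying_sch (sfam_coordM j (fun=> ler01) Sf).
have l1 : B <= Num.max B B' by rewrite le_max lexx.
have l2 : B' <= Num.max B B' by rewrite le_max lexx orbT.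
have E1 : (fun x : Rn => complex.Re ((x 0 j)%:C * f x)) = (fun x => x 0 j * complex.Re (f x)).
  by apply/funext => x; rewrite cE /= mul0r subr0.
have E2 : (fun x : Rn => complex.Im ((x 0 j)%:C * f x)) = (fun x => x 0 j * complex.Im (f x)).
  by apply/funext => x; rewrite cE /= mul0r addr0.
under eq_fun do rewrite Re_fourier.
rewrite Re_fourier.
have -> : (fun x => complex.Re (mulNix j f x)) = (fun x => x 0 j * complex.Im (f x)).
  by apply/funext => x; exact: Re_mulNix.
have -> : (fun x => complex.Im (mulNix j f x)) = (fun x => - (x 0 j * complex.Re (f x))).
  by apply/funext => x; exact: Im_mulNix.
apply: (@osc_int_derive _ _ (Num.max B B')).
- exact: decayingW B1.
- exact: decayingW B2.
- by rewrite -E1; exact: decayingW B1'.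
- by rewrite -E2; exact: decayingW B2'.
Qed.

Lemma fourier_Im_derive j (f : Rn -> C) xi : sch f ->
  is_derive xi 'e_j (fun xi => complex.Im (fourier f xi)) (complex.Im (fourier (mulNix j f) xi)).
Proof.
move=> Sf.
have E (g : Rn -> C) y : complex.Im (fourier g y) = complex.Re (fourier (fun x => - 'i * g x) y).
  rewrite Im_fourier Re_fourier; congr (osc_int _ _ y); apply/funext => x; rewrite cE /=; ring.
under eq_fun do rewrite E.
rewrite E (_ : (fun x => - 'i * mulNix j f x) = mulNix j (fun x => - 'i * f x)); last first.
  by apply/funext => x; rewrite /mulNix; ring.
by apply: fourier_Re_derive; exact: (sfamZ _ (fun=> ler01)).
Qed.

Lemma fourier_Re_continuous (f : Rn -> C) : sch f ->
  continuous (fun xi => complex.Re (fourier f xi)).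
Proof.
move=> Sf; have [B [B0 B1 B2 B3 B4]] := decaying_sch Sf.
under eq_fun do rewrite Re_fourier.
(* One power more than in [decay], to pay for the factor [|x|]. *)
have [sf hf] := Sf; have [B' B0' hB] := hf (n * 2).+1%N [::].
have hx (c : C -> R) : measurable_fun setT (fun x => c (f x)) -> (forall z, `|c z| <= Normc.normc z) ->
    decaying B' (fun x => `|x| * c (f x)).
  move=> mc hc; split; first by apply: measurable_funM => //; exact: measurable_normrow.
  move=> x; have := hB tt x; rewrite cpartials_nil mulr1 exprS normrM normr_id => h.
  rewrite /decay ler_pdivlMr ?norm1X_gt0// mulrC; apply: le_trans h.
  rewrite [X in _ <= X * _]mulrC -mulrA ler_wpM2l ?(ltW (norm1X_gt0 _ _))// ler_pM//.
  by rewrite lerDr.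
have [mr mi] := csmooth_measurable (sch_smooth Sf).
apply: (@osc_int_continuous _ _ (Num.max B B')).
- by apply: decayingW B1; rewrite le_max lexx.
- by apply: decayingW B2; rewrite le_max lexx.
- by apply: decayingW (hx (@complex.Re R) mr (@Re_le_normc R)); rewrite le_max lexx orbT.
- by apply: decayingW (hx (@complex.Im R) mi (@Im_le_normc R)); rewrite le_max lexx orbT.
Qed.

(** Reduces imaginary parts of Fourier transforms to real parts, so that smoothness is proved for
    real parts only. *)
Lemma fourier_Ni (g : Rn -> C) y : complex.Im (fourier g y) = complex.Re (fourier (fun x => - 'i * g x) y).
Proof.
rewrite Im_fourier Re_fourier; congr (osc_int _ _ y); apply/funext => x; rewrite cE /=; ring.
Qed.

Lemma fourier_Re_smooth (f : Rn -> C) : sch f -> smooth (fun xi => complex.Re (fourier f xi)).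
Proof.
move=> Sf; apply: (@smooth_coind _ _ [set g | exists2 f, sch f & g = fun xi => complex.Re (fourier f xi)]); last by exists f.
move=> _ [h Sh ->]; split; first exact: fourier_Re_continuous.
move=> i; split=> [x|]; first by have [] := fourier_Re_derive i x Sh.
exists (mulNix i h); first exact: sch_mulNix.
by apply/funext => x; have [_ ->] := fourier_Re_derive i x Sh.
Qed.

Lemma csmooth_fourier (f : Rn -> C) : sch f -> csmooth (fourier f).
Proof.
move=> Sf; split; first exact: fourier_Re_smooth Sf.
under eq_fun do rewrite fourier_Ni; apply: fourier_Re_smooth.
exact: (sfamZ _ (fun=> ler01)).
Qed.

Lemma cD_fourier j (f : Rn -> C) : sch f -> cD j (fourier f) = fourier (mulNix j f).
Proof.
move=> Sf; apply/funext => xi; apply: cext; rewrite /cD /=.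
  by have [_ ->] := fourier_Re_derive j xi Sf.
by have [_ ->] := fourier_Im_derive j xi Sf.
Qed.

Lemma fourier_cD j (f : Rn -> C) xi : sch f -> fourier (cD j f) xi = 'i * ((xi 0 j)%:C * fourier f xi).
Proof.
move=> Sf; have [B [B0 B1 B2 B3 B4]] := decaying_sch Sf.
have [B' [B0' B1' B2' B3' B4']] := decaying_sch (sfam_cD j Sf).
have l1 : B <= Num.max B B' by rewrite le_max lexx.
have l2 : B' <= Num.max B B' by rewrite le_max lexx orbT.
have [sr si] := sch_smooth Sf.
apply: cext.
  rewrite Re_fourier [LHS](osc_int_parts xi sr si (decayingW l1 B1) (decayingW l1 B2) (decayingW l2 B1') (decayingW l2 B2')).
  by rewrite !cE Im_fourier Re_fourier /=; ring.
have E : (fun x => - complex.Re (cD j f x)) = (fun x => 'D_('e_j) (fun y => - complex.Re (f y)) x).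
  by apply/funext => x; rewrite [RHS]deriveN_row//; exact: (smooth_derivable sr).
move: B3'; rewrite E => B3'.
rewrite Im_fourier E [LHS](osc_int_parts xi si (smoothN sr) (decayingW l1 B2) (decayingW l1 B3) (decayingW l2 B2') (decayingW l2 B3')).
rewrite !cE Re_fourier Im_fourier /=.
rewrite (_ : osc_int _ _ xi = - osc_int (fun x => complex.Re (f x)) (fun x => complex.Im (f x)) xi); first by ring.
rewrite /osc_int -mulN1r -RintegralZl//; last exact: integrable_osc B1 B2.
by apply: eq_Rintegral => x _; rewrite /osc; ring.
Qed.

Lemma normc_sum_coord (xi : Rn) : 1 + `|xi| <= 1 + \sum_(i < n) `|xi 0 i|.
Proof. by rewrite lerD2l (le_trans (norm_le_enorm xi))// enorm_le_sum. Qed.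

(** Each factor [1 + |xi|] is at most 1 plus the sum of the [|xi 0 j|], and [fourier_cD] trades
    [xi 0 j] for the derivative [cD j] of the function. The base case bounds the transform by the
    integral of [decay]. *)
Lemma fourier_bound (I : Type) (w : I -> R) (N : nat) (f : I -> Rn -> C) :
  (forall i, 0 <= w i) -> sfam w f -> exists2 B, 0 <= B & forall i xi,
    (1 + `|xi|) ^+ N * Normc.normc (fourier (f i) xi) <= B * w i.
Proof.
move=> w0; elim: N f => [|N IH] f Sf.
  have [B B0 hB] := sfam_decaying Sf.
  have D0 : 0 <= \int[mu]_x decay x by apply: Rintegral_ge0 => x _; rewrite ltW// decay_gt0.
  exists (4 * B * \int[mu]_x decay x); first by rewrite !mulr_ge0.
  move=> i xi; rewrite expr0 mul1r; apply: (le_trans (normc_le _)).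
  rewrite Re_fourier Im_fourier.
  have [mr mi] := csmooth_measurable (Sf.1 i).
  have Br : decaying (B * w i) (fun x => complex.Re (f i x)).
    by split=> // x; exact: le_trans (Re_le_normc _) (hB i x).
  have Bi : decaying (B * w i) (fun x => complex.Im (f i x)).
    by split=> // x; exact: le_trans (Im_le_normc _) (hB i x).
  have Bn : decaying (B * w i) (fun x => - complex.Re (f i x)).
    by split=> [|x]; [exact: measurable_funN|rewrite normrN; exact: le_trans (Re_le_normc _) (hB i x)].
  have := osc_int_bound xi Br Bi; have := osc_int_bound xi Bi Bn; lra.
have [B B0 hB] := IH f Sf.
have /choice[Bj hBj] : forall j : 'I_n, exists B, 0 <= B /\ forall i xi,
    (1 + `|xi|) ^+ N * Normc.normc (fourier (cD j (f i)) xi) <= B * w i.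
  by move=> j; have [B' B0' h] := IH _ (sfam_cD j Sf); exists B'.
exists (B + \sum_(j < n) Bj j).
  by rewrite addr_ge0// sumr_ge0// => j _; have [] := hBj j.
move=> i xi; rewrite exprSr -mulrA.
apply: (@le_trans _ _ ((1 + `|xi|) ^+ N * ((1 + \sum_(i < n) `|xi 0 i|) * Normc.normc (fourier (f i) xi)))).
  by rewrite ler_wpM2l ?(ltW (norm1X_gt0 _ _))// ler_wpM2r ?normc_ge0// normc_sum_coord.
rewrite mulrDl mul1r mulrDr mulrDl; apply: lerD; first exact: hB.
rewrite mulr_suml mulr_sumr mulr_suml; apply: ler_sum => j _.
have [_ /(_ i xi)] := hBj j; rewrite (fourier_cD j xi (sfam_sch i Sf)) !normcM normcR.
by rewrite (_ : Normc.normc 'i = 1) ?mul1r//= expr0n/= add0r expr1n sqrtr1.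
Qed.

Lemma sfam_fourier (I : Type) (w : I -> R) (f : I -> Rn -> C) :
  (forall i, 0 <= w i) -> sfam w f -> sfam w (fun i => fourier (f i)).
Proof.
move=> w0 Sf; split=> [i|N l]; first by apply: csmooth_fourier; exact: sfam_sch Sf.
elim/last_ind: l f Sf => [|l j IH] f Sf.
  by have [B B0 hB] := fourier_bound N w0 Sf; exists B => // i x; rewrite cpartials_nil.
have [B B0 hB] := IH _ (sfamZ (- 'i) w0 (sfam_coordM j w0 Sf)).
by exists B => // i x; rewrite cpartials_rcons (cD_fourier j (sfam_sch i Sf)); exact: hB.
Qed.

Lemma inv_fourierE (f : Rn -> C) x :
  inv_fourier f x = ((2 * pi) ^- n)%:C * fourier f (-1 *: x + 0).
Proof.
rewrite /inv_fourier /fourier; congr (_ * cintegral _ _); apply/funext => y.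
by rewrite addr0 [dotp y _]dotpC dotpZl mulN1r opprK.
Qed.

Lemma sfam_inv_fourier (I : Type) (w : I -> R) (f : I -> Rn -> C) :
  (forall i, 0 <= w i) -> sfam w f -> sfam w (fun i => inv_fourier (f i)).
Proof.
move=> w0 Sf.
have := sfamZ (((2 * pi) ^- n)%:C) w0 (sfam_affine (c := -1) 0 _ w0 (sfam_fourier w0 Sf)).
rewrite oppr_eq0 oner_eq0 => /(_ isT); apply: sfam_eq => i x.
by rewrite inv_fourierE.
Qed.

Lemma sch_fourier f : sch f -> sch (fourier f).
Proof. exact: (sfam_fourier (fun=> ler01)). Qed.

Lemma sch_inv_fourier f : sch f -> sch (inv_fourier f).
Proof. exact: (sfam_inv_fourier (fun=> ler01)). Qed.

(** Only finitely many words have length at most [N]; monotonicity of [P] in the bound allows their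
    bounds to be added up. *)
Lemma words_bound (P : seq 'I_n -> R -> Prop) N :
  (forall l B B', B <= B' -> P l B -> P l B') -> (forall l, exists2 B, 0 <= B & P l B) ->
  exists2 B, 0 <= B & forall l, (size l <= N)%N -> P l B.
Proof.
move=> mP hP; elim: N P mP hP => [|N IH] P mP hP.
  by have [B B0 h] := hP [::]; exists B => // l; rewrite leqn0 size_eq0 => /eqP ->.
have [B B0 hB] := hP [::].
have /choice[Bj hBj] : forall j : 'I_n, exists B, 0 <= B /\ forall l, (size l <= N)%N -> P (j :: l) B.
  move=> j; have [|l|B' B0' h] := IH (fun l => P (j :: l)); [by move=> l; exact: mP|exact: hP|].
  by exists B'.
exists (B + \sum_(j < n) Bj j).
  by rewrite addr_ge0// sumr_ge0// => j _; have [] := hBj j.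
move=> [_|j l].
  by apply: mP hB; rewrite lerDl sumr_ge0// => j _; have [] := hBj j.
move=> /= sl; have [_ h] := hBj j; apply: mP (h _ sl).
rewrite (bigD1 j)//= addrCA lerDl addr_ge0// sumr_ge0// => k _; have [] := hBj k => //.
Qed.

(** Continuity of [u] in a quantitative form: a rate of decay of the seminorms becomes a rate for
    the values. *)
Lemma tempered_sfam (u : (Rn -> C) -> C) (I : Type) (w : I -> R) (f : I -> Rn -> C) :
  tempered u -> (forall i, 0 <= w i) -> sfam w f -> exists B, forall i,
    Normc.normc (u (f i)) <= B * w i.
Proof.
move=> [_ [N [M hM]]] w0 [sf hf].
have [||B B0 hB] := @words_bound (fun l B => forall i x,
    (1 + `|x|) ^+ N * Normc.normc (cpartials l (f i) x) <= B * w i) N.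
- by move=> l B B' BB h i x; apply: (le_trans (h i x)); rewrite ler_wpM2r.
- by move=> l; exact: hf.
(* The powers of [n.+1] convert the Euclidean norm of [tempered] into the sup norm of [sfam]. *)
exists (M * (n.+1%:R ^+ N * B)) => i; rewrite -mulrA; apply: hM.
  by apply/schwartzE; exact: (sfam_sch i (conj sf hf)).
move=> l x sl; rewrite -mulrA; apply: le_trans (ler_wpM2l _ (hB l sl i x)); last exact: exprn_ge0.
rewrite mulrA ler_wpM2r ?normc_ge0// -exprMn lerXn2r ?nnegrE ?mulr_ge0 ?addr_ge0 ?enorm_ge0//.
have := enorm_le_norm x; rewrite -natr1 mulrDl mulrDr !mulr1 mul1r => h.
have := normr_ge0 x; have := ler0n R n; lra.
Qed.

End schwartz_families.

(** * Fourier inversion *)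

Section complex_integration.
Context (R : realType) (n : nat).
Local Notation Rn := 'rV[R]_n.
Local Notation C := R[i].
Local Notation mu := (lebesgue_row R n).

Lemma integrableZR (f : Rn -> R) a : mu.-integrable setT (EFin \o f) ->
  mu.-integrable setT (EFin \o (fun x => a * f x)).
Proof.
move=> If; rewrite (_ : EFin \o _ = fun x => (a%:E * (EFin \o f) x)%E)//.
exact: integrableZl.
Qed.

Lemma integrableDR (f g : Rn -> R) : mu.-integrable setT (EFin \o f) ->
  mu.-integrable setT (EFin \o g) -> mu.-integrable setT (EFin \o (fun x => f x + g x)).
Proof. by move=> If Ig; exact: (integrableD measurableT If Ig). Qed.

Lemma integrableBR (f g : Rn -> R) : mu.-integrable setT (EFin \o f) ->
  mu.-integrable setT (EFin \o g) -> mu.-integrable setT (EFin \o (fun x => f x - g x)).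
Proof. by move=> If Ig; exact: (integrableB measurableT If Ig). Qed.

Definition cintegrable (f : Rn -> C) : Prop :=
  mu.-integrable setT (EFin \o (fun x => complex.Re (f x))) /\
  mu.-integrable setT (EFin \o (fun x => complex.Im (f x))).

Lemma cintegrable_dom (f : Rn -> C) (G : Rn -> R) : cmeasurable setT f ->
  mu.-integrable setT (EFin \o G) -> (forall x, Normc.normc (f x) <= G x) -> cintegrable f.
Proof.
move=> [mr mi] iG fG; split; apply: (integrable_dom _ iG) => // x; apply: le_trans (fG x).
  exact: Re_le_normc.
exact: Im_le_normc.
Qed.

Lemma cintegral_dom (f : Rn -> C) (G : Rn -> R) : cmeasurable setT f ->
  mu.-integrable setT (EFin \o G) -> (forall x, Normc.normc (f x) <= G x) ->
  Normc.normc (cintegral setT f) <= 2 * \int[mu]_x G x.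
Proof.
move=> [mr mi] iG fG; apply: (le_trans (normc_le _)); rewrite mulr_natl mulr2n.
apply: lerD; apply: Rintegral_dom => // x; apply: le_trans (fG x).
  exact: Re_le_normc.
exact: Im_le_normc.
Qed.

Lemma cintegralZ a (f : Rn -> C) : cintegrable f ->
  cintegral setT (fun x => a * f x) = a * cintegral setT f.
Proof.
move=> [Ir Ii]; apply: cext; rewrite !cE /cintegral /=; under eq_Rintegral do rewrite !cE.
  by rewrite RintegralB ?RintegralZl//; exact: integrableZR.
by rewrite RintegralD ?RintegralZl//; exact: integrableZR.
Qed.

Lemma cintegralD (f g : Rn -> C) : cintegrable f -> cintegrable g ->
  cintegral setT (fun x => f x + g x) = cintegral setT f + cintegral setT g.
Proof.
move=> [fr fi] [gr gi]; apply: cext; rewrite !cE /cintegral /=; under eq_Rintegral do rewrite !cE.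
  by rewrite RintegralD.
by rewrite RintegralD.
Qed.

Lemma cintegrableZ a (f : Rn -> C) : cintegrable f -> cintegrable (fun x => a * f x).
Proof.
move=> [Ir Ii]; split.
  rewrite (_ : (fun x => _) = fun x => complex.Re a * complex.Re (f x) - complex.Im a * complex.Im (f x)).
    by apply: integrableBR; exact: integrableZR.
  by apply/funext => x; rewrite cE.
rewrite (_ : (fun x => _) = fun x => complex.Re a * complex.Im (f x) + complex.Im a * complex.Re (f x)).
  by apply: integrableDR; exact: integrableZR.
by apply/funext => x; rewrite cE.
Qed.

Lemma cintegrableD (f g : Rn -> C) : cintegrable f -> cintegrable g ->
  cintegrable (fun x => f x + g x).
Proof.
move=> [fr fi] [gr gi]; split.
  rewrite (_ : (fun x => _) = fun x => complex.Re (f x) + complex.Re (g x)); first exact: integrableDR.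
  by apply/funext => x; rewrite cE.
rewrite (_ : (fun x => _) = fun x => complex.Im (f x) + complex.Im (g x)); first exact: integrableDR.
by apply/funext => x; rewrite cE.
Qed.

Lemma cintegral_affine (c : R) (x0 : Rn) (f : Rn -> C) : c != 0 -> cintegrable f ->
  (`|c| ^+ n)%:C * cintegral setT (fun x => f (c *: x + x0)) = cintegral setT f.
Proof.
move=> c0 [Ir Ii]; apply: cext; rewrite !cE /cintegral /= mul0r ?subr0 ?addr0.
  by rewrite (Rintegral_row_affine x0 c0 Ir).
by rewrite (Rintegral_row_affine x0 c0 Ii).
Qed.

Lemma sch_cintegrable (f : Rn -> C) : sch f -> cintegrable f.
Proof.
move=> Sf; have [B B0 hB] := sfam_decaying Sf.
apply: (@cintegrable_dom _ (fun x => B * decay x)).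
- exact: csmooth_measurable (sch_smooth Sf).
- by apply: integrableZR; exact: integrable_decay.
- by move=> x; have := hB tt x; rewrite mulr1.
Qed.

Lemma cmeasurableM (f g : Rn -> C) : cmeasurable setT f -> cmeasurable setT g ->
  cmeasurable setT (fun x => f x * g x).
Proof.
move=> [fr fi] [gr gi]; split; under eq_fun do rewrite cE.
  by apply: measurable_funB; exact: measurable_funM.
by apply: measurable_funD; exact: measurable_funM.
Qed.

Lemma cmeasurable_cis (xi : Rn) : cmeasurable setT (fun x : Rn => cis (dotp x xi) : C).
Proof.
split=> /=.
  apply: (measurableT_comp (f := cos)); last exact: measurable_dotp.
  apply: continuous_measurable_fun; exact: continuous_cos.
apply: (measurableT_comp (f := sin)); last exact: measurable_dotp.
apply: continuous_measurable_fun; exact: continuous_sin.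
Qed.

Lemma cintegrableM_bounded (f g : Rn -> C) : sch f -> cmeasurable setT g ->
  (exists M, forall x, Normc.normc (g x) <= M) -> cintegrable (fun x => f x * g x).
Proof.
move=> Sf mg [M hM]; have [B B0 hB] := sfam_decaying Sf.
apply: (@cintegrable_dom _ (fun x => B * `|M| * decay x)).
- by apply: cmeasurableM => //; exact: csmooth_measurable (sch_smooth Sf).
- by apply: integrableZR; exact: integrable_decay.
- move=> x; rewrite normcM mulrAC; apply: ler_pM; rewrite ?normc_ge0//.
    by have := hB tt x; rewrite mulr1.
  by rewrite (le_trans (hM x))// ler_norm.
Qed.

Lemma Fubini_row (f : Rn -> Rn -> R) :
  measurable_fun setT (fun z : Rn * Rn => f z.1 z.2) ->
  (forall x, mu.-integrable setT (EFin \o f x)) ->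
  (forall y, mu.-integrable setT (EFin \o f ^~ y)) ->
  (\int[mu]_x \int[mu]_y (`|f x y|)%:E < +oo)%E ->
  mu.-integrable setT (EFin \o (fun x => \int[mu]_y f x y)) /\
  \int[mu]_x \int[mu]_y f x y = \int[mu]_y \int[mu]_x f x y.
Proof.
move=> mf hx hy fin.
have mf' : measurable_fun setT (fun z : Rn * Rn => (f z.1 z.2)%:E) by exact/measurable_EFinP.
have If : (mu \x mu)%E.-integrable setT (fun z : Rn * Rn => (f z.1 z.2)%:E).
  by apply/(integrable12ltyP _ _ mf').
have Ex x : ((\int[mu]_y f x y)%:E = \int[mu]_y (f x y)%:E)%E.
  by rewrite /Rintegral fineK//; exact: integrable_fin_num (hx x).
have Ey y : ((\int[mu]_x f x y)%:E = \int[mu]_x (f x y)%:E)%E.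
  by rewrite /Rintegral fineK//; exact: integrable_fin_num (hy y).
split.
  rewrite (_ : EFin \o _ = fun x => \int[mu]_y (f x y)%:E)%E; last by apply/funext.
  exact: (integrable_fubini_F If).
congr fine; under eq_integral do rewrite Ex; under [RHS]eq_integral do rewrite Ey.
exact: (Fubini If).
Qed.

Lemma Fubini_dom (f : Rn -> Rn -> R) (A B : Rn -> R) :
  measurable_fun setT (fun z : Rn * Rn => f z.1 z.2) ->
  (forall x, 0 <= A x) -> (forall x, 0 <= B x) ->
  mu.-integrable setT (EFin \o A) -> mu.-integrable setT (EFin \o B) ->
  (forall x y, `|f x y| <= A x * B y) ->
  mu.-integrable setT (EFin \o (fun x => \int[mu]_y f x y)) /\
  \int[mu]_x \int[mu]_y f x y = \int[mu]_y \int[mu]_x f x y.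
Proof.
move=> mf A0 B0 IA IB FAB; apply: (Fubini_row mf).
- move=> x; apply: (integrable_dom _ (integrableZR (A x) IB)).
    exact: (measurable_fun_pair2 (f := fun z : Rn * Rn => f z.1 z.2)).
  by move=> y; exact: FAB.
- move=> y; apply: (integrable_dom _ (integrableZR (B y) IA)).
    exact: (measurable_fun_pair1 (f := fun z : Rn * Rn => f z.1 z.2)).
  by move=> x; rewrite mulrC; exact: FAB.
- apply: (@le_lt_trans _ _ (\int[mu]_x ((A x)%:E * \int[mu]_y (B y)%:E))%E).
    apply: ge0_le_integral => //.
    + by move=> x _; apply: integral_ge0 => y _; rewrite lee_fin.
    + apply: (@measurable_fun_fubini_tonelli_F _ _ _ _ _ _ (fun z => (`|f z.1 z.2|)%:E)) => //.
      by apply/measurable_EFinP; exact: measurableT_comp mf.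
    + apply: emeasurable_funM; last exact: measurable_cst.
      exact: measurable_int IA.
    move=> x _; rewrite -ge0_integralZl//.
    + apply: ge0_le_integral => //.
      * apply/measurable_EFinP; apply: measurableT_comp => //.
        exact: (measurable_fun_pair2 (f := fun z : Rn * Rn => f z.1 z.2)).
      * apply: emeasurable_funM; first exact: measurable_cst.
        exact: measurable_int IB.
      * by move=> y _; rewrite -EFinM lee_fin; exact: FAB.
    + exact: measurable_int IB.
    + by move=> y _; rewrite lee_fin.
    + by rewrite lee_fin.
  have IBf : (\int[mu]_y (B y)%:E)%E \is a fin_num by exact: integrable_fin_num IB.
  have IAf : (\int[mu]_y (A y)%:E)%E \is a fin_num by exact: integrable_fin_num IA.
  rewrite ge0_integralZr//.
  + by rewrite -(fineK IBf) -(fineK IAf) -EFinM ltry.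
  + exact: measurable_int IA.
  + by move=> x _; rewrite lee_fin.
  + by rewrite integral_ge0// => y _; rewrite lee_fin.
Qed.

Lemma cFubini (F : Rn -> Rn -> C) (A B : Rn -> R) :
  measurable_fun setT (fun z : Rn * Rn => complex.Re (F z.1 z.2)) ->
  measurable_fun setT (fun z : Rn * Rn => complex.Im (F z.1 z.2)) ->
  (forall x, 0 <= A x) -> (forall x, 0 <= B x) ->
  mu.-integrable setT (EFin \o A) -> mu.-integrable setT (EFin \o B) ->
  (forall x y, Normc.normc (F x y) <= A x * B y) ->
  cintegrable (fun x => cintegral setT (F x)) /\
  cintegral setT (fun x => cintegral setT (F x)) =
  cintegral setT (fun y => cintegral setT (fun x => F x y)).
Proof.
move=> mr mi A0 B0 IA IB FAB.
have [ir er] := Fubini_dom mr A0 B0 IA IB (fun x y => le_trans (Re_le_normc _) (FAB x y)).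
have [ii ei] := Fubini_dom mi A0 B0 IA IB (fun x y => le_trans (Im_le_normc _) (FAB x y)).
by split; [split|apply: cext].
Qed.

Lemma Rintegral_gt0 (h : Rn -> R) x0 : continuous h -> (forall x, 0 <= h x) ->
  mu.-integrable setT (EFin \o h) -> 0 < h x0 -> 0 < \int[mu]_x h x.
Proof.
move=> ch h0 Ih hx0.
have [r r0 hr] : exists2 r, 0 < r & forall y, ball x0 r y -> h x0 / 2 <= h y.
  have : nbhs x0 (h @^-1` [set t | h x0 / 2 < t]).
    by apply: ch; apply: open_nbhs_nbhs; split; [exact: open_gt|rewrite /=; lra].
  by move=> /nbhs_ballP[r /= r0 hr]; exists r => // y /hr /= /ltW.
have mb : measurable (ball x0 r) by apply: open_measurable_row; exact: ball_open.
have If : (\int[mu]_x (h x)%:E)%E \is a fin_num by exact: integrable_fin_num Ih.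
rewrite -lte_fin fineK//.
apply: (@lt_le_trans _ _ (\int[mu]_(x in ball x0 r) (h x0 / 2)%:E)%E).
  rewrite integral_cst// [X in (_ * X)%E](row_ball_measure x0 r0) -EFinM lte_fin.
  by rewrite mulr_gt0 ?divr_gt0 ?exprn_gt0 ?mulr_gt0.
apply: (@le_trans _ _ (\int[mu]_(x in ball x0 r) (h x)%:E)%E).
  apply: ge0_le_integral => //.
  - by move=> x _; rewrite lee_fin divr_ge0.
  - apply: measurable_funTS; exact: measurable_int Ih.
apply: ge0_subset_integral => //; first exact: measurable_int Ih.
by move=> x _; rewrite lee_fin.
Qed.

End complex_integration.

Section inversion.
Context (R : realType) (n : nat).
Local Notation Rn := 'rV[R]_n.
Local Notation C := R[i].
Local Notation mu := (lebesgue_row R n).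

Lemma measurable_dotp2 (T : measurableType row_display) : measurable_fun setT (fun z : Rn * Rn => dotp z.1 z.2).
Proof.
apply: measurable_sum => i; apply: measurable_funM; apply: measurable_row_comp.
  exact: measurable_fst.
exact: measurable_snd.
Qed.

Lemma cmeasurable_prod (f g : Rn -> C) (h : Rn * Rn -> R) :
  cmeasurable setT f -> cmeasurable setT g -> measurable_fun setT h ->
  measurable_fun setT (fun z : Rn * Rn => complex.Re (f z.1 * g z.2 * cis (h z))) /\
  measurable_fun setT (fun z : Rn * Rn => complex.Im (f z.1 * g z.2 * cis (h z))).
Proof.
move=> [fr fi] [gr gi] mh.
have f1 := measurableT_comp fr (@measurable_fst _ _ Rn Rn).
have f2 := measurableT_comp fi (@measurable_fst _ _ Rn Rn).
have g1 := measurableT_comp gr (@measurable_snd _ _ Rn Rn).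
have g2 := measurableT_comp gi (@measurable_snd _ _ Rn Rn).
have mc : measurable_fun setT (fun z : Rn * Rn => cos (h z)).
  apply: (measurableT_comp (f := cos)) mh.
  apply: continuous_measurable_fun; exact: continuous_cos.
have ms : measurable_fun setT (fun z : Rn * Rn => sin (h z)).
  apply: (measurableT_comp (f := sin)) mh.
  apply: continuous_measurable_fun; exact: continuous_sin.
split; under eq_fun do rewrite !cE /=.
  apply: measurable_funB; apply: measurable_funM => //.
    by apply: measurable_funB; exact: measurable_funM.
  by apply: measurable_funD; exact: measurable_funM.
apply: measurable_funD; apply: measurable_funM => //.
  by apply: measurable_funB; exact: measurable_funM.
by apply: measurable_funD; exact: measurable_funM.
Qed.

Lemma cFubini_sch (f g : Rn -> C) (h : Rn * Rn -> R) : sch f -> sch g -> measurable_fun setT h ->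
  cintegral setT (fun x => cintegral setT (fun y => f x * g y * cis (h (x, y)))) =
  cintegral setT (fun y => cintegral setT (fun x => f x * g y * cis (h (x, y)))).
Proof.
move=> Sf Sg mh.
have [B B0 hB] := sfam_decaying Sf; have [B' B0' hB'] := sfam_decaying Sg.
have [m1 m2] := cmeasurable_prod (csmooth_measurable (sch_smooth Sf)) (csmooth_measurable (sch_smooth Sg)) mh.
apply: (proj2 (@cFubini _ _ (fun x y => f x * g y * cis (h (x, y))) (fun x => B * decay x) (fun x => B' * decay x) _ _ _ _ _ _ _)).
- by move: m1; congr measurable_fun; apply/funext => -[].
- by move: m2; congr measurable_fun; apply/funext => -[].
- by move=> x; rewrite mulr_ge0// ltW// decay_gt0.
- by move=> x; rewrite mulr_ge0// ltW// decay_gt0.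
- by apply: integrableZR; exact: integrable_decay.
- by apply: integrableZR; exact: integrable_decay.
- move=> x y; rewrite !normcM normc_cis mulr1.
  apply: ler_pM; rewrite ?normc_ge0//.
    by have := hB tt x; rewrite mulr1.
  by have := hB' tt y; rewrite mulr1.
Qed.

Lemma fourier_mult_formula (f g : Rn -> C) : sch f -> sch g ->
  cintegral setT (fun x => fourier f x * g x) = cintegral setT (fun x => f x * fourier g x).
Proof.
move=> Sf Sg.
have mh : measurable_fun setT (fun z : Rn * Rn => - dotp z.1 z.2).
  by apply: measurable_funN; exact: (@measurable_dotp2 Rn).
have cisN (x : Rn) : cmeasurable setT (fun y : Rn => cis (- dotp y x) : C).
  rewrite (_ : (fun y => _) = fun y => cis (dotp y (- x)) : C); first exact: cmeasurable_cis.
  by apply/funext => y; rewrite [dotp y (- x)]dotpC -(scaleN1r x) dotpZl mulN1r dotpC.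
have bcis (x : Rn) : exists M : R, forall y : Rn, Normc.normc (cis (- dotp y x) : C) <= M.
  by exists 1 => y; rewrite normc_cis.
transitivity (cintegral setT (fun y => cintegral setT (fun x => f x * g y * cis (- dotp x y)))).
  congr cintegral; apply/funext => x; rewrite /fourier mulrC -cintegralZ; last first.
    by apply: cintegrableM_bounded.
  by congr cintegral; apply/funext => y; ring.
rewrite -(cFubini_sch Sf Sg mh) /=.
congr cintegral; apply/funext => x; rewrite /fourier -cintegralZ; last exact: cintegrableM_bounded.
congr cintegral; apply/funext => y; rewrite [dotp y x]dotpC; ring.
Qed.

Definition conv (eta kap : Rn -> C) (x : Rn) : C :=
  cintegral setT (fun y => eta y * kap (x - y)).

Definition fourier_cst : C := ((2 * pi) ^- n)%:C.

(** Unfolding [inv_fourier] and exchanging the integrals turns the frequency multiplier [b] into a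
    convolution. No inversion theorem enters, so the formula can serve both to prove inversion and
    to represent the dyadic blocks. *)
Lemma fourier_mul_inv (b eta : Rn -> C) x : sch b -> sch eta ->
  fourier (fun xi => b xi * inv_fourier eta xi) x =
  conv eta (fun z => fourier_cst * fourier b z) x.
Proof.
move=> Sb Se.
have mh : measurable_fun setT (fun z : Rn * Rn => dotp z.2 z.1 - dotp z.1 x).
  apply: measurable_funB.
    by under eq_fun do rewrite dotpC; exact: (@measurable_dotp2 Rn).
  by apply: (measurableT_comp (measurable_dotp x)); exact: measurable_fst.
have cisb (y : Rn) : exists M : R, forall z : Rn, Normc.normc (cis (dotp z y) : C) <= M.
  by exists 1 => z; rewrite normc_cis.
have cmM (y : Rn) (c : Rn -> R) : (forall z, c z = dotp z y) ->
    cintegrable (fun z => b z * cis (c z)).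
  move=> hc; rewrite (_ : (fun z => _) = fun z => b z * cis (dotp z y)).
    by apply: cintegrableM_bounded => //; exact: cmeasurable_cis.
  by apply/funext => z; rewrite hc.
transitivity (cintegral setT (fun xi => cintegral setT (fun y =>
    (fourier_cst * b xi) * eta y * cis (dotp y xi - dotp xi x)))).
  congr cintegral; apply/funext => xi.
  change (b xi * (fourier_cst * cintegral setT (fun y => eta y * cis (dotp xi y))) * cis (- dotp xi x) = 
    cintegral setT (fun y => fourier_cst * b xi * eta y * cis (dotp y xi - dotp xi x))).
  set I := cintegral setT (fun y => eta y * _).
  have -> : b xi * (fourier_cst * I) * cis (- dotp xi x) = (b xi * fourier_cst * cis (- dotp xi x)) * I by ring.
  have -> : I = cintegral setT (fun y => eta y * cis (dotp y xi)).
    by congr cintegral; apply/funext => y; rewrite dotpC.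
  rewrite -cintegralZ; last by apply: cintegrableM_bounded => //; exact: cmeasurable_cis.
  by congr cintegral; apply/funext => y; rewrite cisD; ring.
have Sb' : sch (fun xi => fourier_cst * b xi) by exact: (sfamZ _ (fun=> ler01)).
rewrite (cFubini_sch Sb' Se mh) /=.
congr cintegral; apply/funext => y; rewrite /fourier.
have E z : - dotp z (x - y) = dotp z (y - x).
  by rewrite -[y - x]opprB [RHS]dotpC -(scaleN1r (x - y)) dotpZl mulN1r dotpC.
rewrite mulrA -cintegralZ; last by apply: (cmM (y - x)); exact: E.
congr cintegral; apply/funext => xi; rewrite E dotpC.
rewrite (_ : dotp xi (y - x) = dotp xi y - dotp xi x); first by ring.
by rewrite dotpC dotpDl -(scaleN1r x) dotpZl mulN1r [dotp y xi]dotpC [dotp x xi]dotpC.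
Qed.

Lemma fourier_scale (c : R) (b : Rn -> C) x : c != 0 -> sch b ->
  (`|c| ^+ n)%:C * fourier (fun xi => b (c *: xi + 0)) x = fourier b (c^-1 *: x).
Proof.
move=> c0 Sb; rewrite /fourier -[RHS](cintegral_affine (c := c) 0 c0).
  congr (_ * _); congr cintegral; apply/funext => xi.
  by rewrite addr0 dotpZl [dotp xi (_ *: _)]dotpC dotpZl mulrA divff// mul1r dotpC.
rewrite (_ : (fun x0 => _) = fun y => b y * cis (dotp y (- (c^-1 *: x)))).
  apply: cintegrableM_bounded => //; first exact: cmeasurable_cis.
  by exists 1 => z; rewrite normc_cis.
by apply/funext => y; rewrite [dotp y (- _)]dotpC -(scaleN1r (c^-1 *: x)) dotpZl mulN1r dotpC.
Qed.

Variable (b : Rn -> C).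
Hypothesis (Sb : sch b) (b0 : b 0 = 1).

Definition kernel_of (b : Rn -> C) (z : Rn) : C := fourier_cst * fourier b z.

(* The constant of Fourier inversion. It equals 1, but only [inv_cst != 0] is
   needed, so that the value of the Gaussian integral can be avoided. *)
Definition inv_cst : C := cintegral setT (kernel_of b).

Lemma sch_kernel (a : Rn -> C) : sch a -> sch (kernel_of a).
Proof. by move=> Sa; apply: (sfamZ _ (fun=> ler01)); exact: sch_fourier. Qed.

Lemma sch_scale (c : R) (f : Rn -> C) (x0 : Rn) : c != 0 -> sch f -> sch (fun x => f (c *: x + x0)).
Proof. by move=> c0 Sf; exact: (sfam_affine x0 c0 (fun=> ler01) Sf). Qed.

Lemma fourierZ a (f : Rn -> C) x : sch f -> fourier (fun y => a * f y) x = a * fourier f x.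
Proof.
move=> Sf; rewrite /fourier -cintegralZ; first by congr cintegral; apply/funext => y; ring.
rewrite (_ : (fun y => _) = fun y => f y * cis (dotp y (- x))).
  apply: cintegrableM_bounded => //; first exact: cmeasurable_cis.
  by exists 1 => z; rewrite normc_cis.
by apply/funext => y; rewrite [dotp y (- _)]dotpC -(scaleN1r x) dotpZl mulN1r dotpC.
Qed.

Lemma kernel_scale (c : R) z : 0 < c ->
  kernel_of (fun xi => b (c^-1 *: xi + 0)) z = (c ^+ n)%:C * kernel_of b (c *: z).
Proof.
move=> c0; have cV0 : c^-1 != 0 by rewrite invr_eq0 gt_eqF.
rewrite /kernel_of mulrCA; congr (_ * _).
have := fourier_scale z cV0 Sb; rewrite invrK => <-.
rewrite mulrA -rmorphM /= ger0_norm ?invr_ge0 ?ltW// -exprMn divff ?gt_eqF// expr1n.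
by rewrite mul1r.
Qed.

(** The substitution [z = c *: (x - y)] moves the dilation from the kernel to [psi], where the limit
    in [c] can be taken. *)
Lemma conv_scale (c : R) (psi : Rn -> C) x : 0 < c -> sch psi ->
  conv psi (kernel_of (fun xi => b (c^-1 *: xi + 0))) x =
  cintegral setT (fun z => kernel_of b z * psi (x - c^-1 *: z)).
Proof.
move=> c0 Sp; have cV0 : - c^-1 != 0 by rewrite oppr_eq0 invr_eq0 gt_eqF.
have cc : c^-1 != 0 by rewrite invr_eq0 gt_eqF.
rewrite /conv -(cintegral_affine (c := - c^-1) x cV0); last first.
  have [B B0 hB] := sfam_decaying (sch_kernel (sch_scale 0 cc Sb)).
  apply: cintegrableM_bounded => //.
    apply: (csmooth_measurable (sch_smooth (f := fun y => kernel_of (fun xi => b (c^-1 *: xi + 0)) (x - y)) _)).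
    have N10 : -1 != 0 :> R by rewrite oppr_eq0 oner_eq0.
    have := sch_scale x N10 (sch_kernel (sch_scale 0 cc Sb)).
    by under eq_fun do rewrite scaleN1r addrC.
  exists B => y; have := hB tt (x - y); rewrite mulr1 => /le_trans; apply.
  rewrite -[leRHS]mulr1 ler_wpM2l// /decay invf_le1 ?norm1X_gt0//.
  by rewrite exprn_ege1// norm1_ge1.
have iK : cintegrable (fun z => kernel_of b z * psi (x - c^-1 *: z)).
  have [B B0 hB] := sfam_decaying Sp.
  apply: cintegrableM_bounded; first exact: sch_kernel.
    have := csmooth_measurable (sch_smooth (sch_scale x cV0 Sp)).
    by under eq_fun do rewrite scaleNr addrC.
  exists B => y; have := hB tt (x - c^-1 *: y); rewrite mulr1 => /le_trans; apply.
  rewrite -[leRHS]mulr1 ler_wpM2l// /decay invf_le1 ?norm1X_gt0//.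
  by rewrite exprn_ege1// norm1_ge1.
have -> : (fun y => psi (- c^-1 *: y + x) * kernel_of (fun xi => b (c^-1 *: xi + 0)) (x - (- c^-1 *: y + x))) =
    (fun z => (c ^+ n)%:C * (kernel_of b z * psi (x - c^-1 *: z))).
  apply/funext => y; rewrite kernel_scale// opprD addrCA subrr addr0 -scaleNr opprK scalerA.
  by rewrite divff ?gt_eqF// scale1r scaleNr addrC; ring.
rewrite cintegralZ// mulrA -rmorphM /= normrN ger0_norm ?invr_ge0 ?ltW//.
by rewrite -exprMn mulVf ?gt_eqF// expr1n mul1r.
Qed.

Lemma two_pow_cvg0 : (2 ^- m : R) @[m --> \oo] --> 0.
Proof.
under eq_fun do rewrite -exprVn.
by apply: cvg_expr; rewrite ger0_norm ?invr_ge0// invf_lt1//; lra.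
Qed.

Lemma cvg_along (F : Rn -> R) (y z : Rn) : continuous F ->
  F (y + 2 ^- m *: z) @[m --> \oo] --> F y.
Proof.
move=> cF; apply: (cvg_comp (fun m => y + 2 ^- m *: z) F); last exact: cF.
suff : (fun m => y + 2 ^- m *: z) @ \oo --> y by [].
rewrite -[X in _ --> X]addr0; apply: cvgD; first exact: cvg_cst.
by rewrite -(scale0r z); apply: cvgZr_tmp; exact: two_pow_cvg0.
Qed.

Definition ccvg (z : nat -> C) (l : C) : Prop :=
  (complex.Re (z m) @[m --> \oo] --> complex.Re l) /\
  (complex.Im (z m) @[m --> \oo] --> complex.Im l).

Lemma ccvgMr (w : C) (z : nat -> C) (l : C) : ccvg z l -> ccvg (fun m => z m * w) (l * w).
Proof.
move=> [hr hi]; split; rewrite cE; under eq_fun do rewrite cE.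
  by apply: cvgB; apply: cvgMr_tmp.
by apply: cvgD; apply: cvgMr_tmp.
Qed.

Lemma csmooth_cvg_along (f : Rn -> C) (y z : Rn) : csmooth f ->
  ccvg (fun m => f (y + 2 ^- m *: z)) (f y).
Proof.
move=> [fr fi]; split.
  exact: (@cvg_along (fun x => complex.Re (f x)) y z (smooth_continuous fr)).
exact: (@cvg_along (fun x => complex.Im (f x)) y z (smooth_continuous fi)).
Qed.

Lemma sch_bounded (f : Rn -> C) : sch f -> exists2 B, 0 <= B & forall x, Normc.normc (f x) <= B.
Proof.
move=> Sf; have [B B0 hB] := sfam_decaying Sf; exists B => // x.
have := hB tt x; rewrite mulr1 => /le_trans; apply.
rewrite -[leRHS]mulr1 ler_wpM2l// /decay invf_le1 ?norm1X_gt0//.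
by rewrite exprn_ege1// norm1_ge1.
Qed.

(* Abel summation with [b(2^-m .)]: both sides of [fourier_mul_inv] converge. *)
Lemma fourier_inversion (psi : Rn -> C) x : sch psi ->
  fourier (inv_fourier psi) x = inv_cst * psi x.
Proof.
move=> Sp.
have p2 m : (0 : R) < 2 ^+ m by rewrite exprn_gt0.
have p2n m : (2 ^+ m)^-1 != 0 :> R by rewrite invr_eq0 gt_eqF.
pose bm m := fun xi => b ((2 ^+ m)^-1 *: xi + 0).
have Sbm m : sch (bm m) by exact: sch_scale.
pose L m := conv psi (kernel_of (bm m)) x.
have LE m : L m = cintegral setT (fun z => kernel_of b z * psi (x - (2 ^+ m)^-1 *: z)).
  exact: conv_scale.
have LF m : L m = fourier (fun xi => bm m xi * inv_fourier psi xi) x.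
  by rewrite fourier_mul_inv.
have [Br hBr] : exists B, forall z, Normc.normc (psi z) <= B by have [B _] := sch_bounded Sp; exists B.
(* Dominated convergence for real and imaginary parts together; it is used for two different
   integral expressions of the same sequence [L m], whose limits must then agree. *)
have cvg_re (F : nat -> Rn -> C) (f : Rn -> C) (G : Rn -> R) :
    (forall m, cmeasurable setT (F m)) -> mu.-integrable setT (EFin \o G) ->
    (forall m y, Normc.normc (F m y) <= G y) ->
    (forall y, complex.Re (F m y) @[m --> \oo] --> complex.Re (f y)) ->
    (forall y, complex.Im (F m y) @[m --> \oo] --> complex.Im (f y)) ->
    (forall m, cintegral setT (F m) = L m) ->
    complex.Re (L m) @[m --> \oo] --> complex.Re (cintegral setT f) /\
    complex.Im (L m) @[m --> \oo] --> complex.Im (cintegral setT f).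
  move=> mF IG FG cr ci FL; split.
    have := Rintegral_dct (fun m => (mF m).1) IG (fun m x => le_trans (Re_le_normc _) (FG m x)) cr.
    by rewrite (_ : (fun m => _) = fun m => complex.Re (L m))//; apply/funext => m; rewrite -(FL m).
  have := Rintegral_dct (fun m => (mF m).2) IG (fun m x => le_trans (Im_le_normc _) (FG m x)) ci.
  by rewrite (_ : (fun m => _) = fun m => complex.Im (L m))//; apply/funext => m; rewrite -(FL m).
have [r1 i1] : complex.Re (L m) @[m --> \oo] --> complex.Re (fourier (inv_fourier psi) x) /\
    complex.Im (L m) @[m --> \oo] --> complex.Im (fourier (inv_fourier psi) x).
  have Si := sch_inv_fourier Sp.
  have [B B0 hB] := sfam_decaying Si; have [B' B0' hB'] := sch_bounded Sb.
  have cc : cmeasurable setT (fun xi => cis (- dotp xi x) : C).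
    rewrite (_ : (fun y => _) = fun y => cis (dotp y (- x)) : C); first exact: cmeasurable_cis.
    by apply/funext => y; rewrite [dotp y (- x)]dotpC -(scaleN1r x) dotpZl mulN1r dotpC.
  apply: (@cvg_re (fun m xi => bm m xi * inv_fourier psi xi * cis (- dotp xi x))
     (fun xi => inv_fourier psi xi * cis (- dotp xi x)) (fun xi => B' * B * decay xi)).
  - move=> m; apply: cmeasurableM => //; apply: cmeasurableM.
      exact: csmooth_measurable (sch_smooth (Sbm m)).
    exact: csmooth_measurable (sch_smooth Si).
  - by apply: integrableZR; exact: integrable_decay.
  - move=> m y; rewrite (normcM _ (cis _)) (normcM (bm m y)) normc_cis mulr1 -mulrA ler_pM ?normc_ge0 ?hB'//.
    by have := hB tt y; rewrite mulr1.
  - move=> y; have [h _] := ccvgMr (inv_fourier psi y * cis (- dotp y x)) (csmooth_cvg_along 0 y (sch_smooth Sb)).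
    by move: h; rewrite b0 mul1r; under eq_fun do rewrite mulrA addrC.
  - move=> y; have [_ h] := ccvgMr (inv_fourier psi y * cis (- dotp y x)) (csmooth_cvg_along 0 y (sch_smooth Sb)).
    by move: h; rewrite b0 mul1r; under eq_fun do rewrite mulrA addrC.
  - by move=> m; rewrite LF.
have [r2 i2] : complex.Re (L m) @[m --> \oo] --> complex.Re (inv_cst * psi x) /\
    complex.Im (L m) @[m --> \oo] --> complex.Im (inv_cst * psi x).
  have Sk := sch_kernel Sb.
  have [B B0 hB] := sfam_decaying Sk.
  have -> : inv_cst * psi x = cintegral setT (fun z => kernel_of b z * psi x).
    rewrite mulrC -cintegralZ; last exact: sch_cintegrable.
    by congr cintegral; apply/funext => z; rewrite mulrC.
  apply: (@cvg_re (fun m z => kernel_of b z * psi (x - (2 ^+ m)^-1 *: z))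
     (fun z => kernel_of b z * psi x) (fun xi => B * Br * decay xi)).
  - move=> m; apply: cmeasurableM; first exact: csmooth_measurable (sch_smooth Sk).
    have cV0 : - (2 ^+ m)^-1 != 0 :> R by rewrite oppr_eq0.
    have := csmooth_measurable (sch_smooth (sch_scale x cV0 Sp)).
    by under eq_fun do rewrite scaleNr addrC.
  - by apply: integrableZR; exact: integrable_decay.
  - move=> m y; rewrite normcM mulrAC ler_pM ?normc_ge0//.
    by have := hB tt y; rewrite mulr1.
  - move=> y; have [h _] := ccvgMr (kernel_of b y) (csmooth_cvg_along x (- y) (sch_smooth Sp)).
    by move: h; rewrite mulrC; under eq_fun do rewrite mulrC scalerN.
  - move=> y; have [_ h] := ccvgMr (kernel_of b y) (csmooth_cvg_along x (- y) (sch_smooth Sp)).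
    by move: h; rewrite mulrC; under eq_fun do rewrite mulrC scalerN.
  - by move=> m; rewrite LE.
apply: cext.
  by have := cvg_lim (@Rhausdorff R) r1; have := cvg_lim (@Rhausdorff R) r2 => -> ->.
by have := cvg_lim (@Rhausdorff R) i1; have := cvg_lim (@Rhausdorff R) i2 => -> ->.
Qed.

Lemma fourier_reflect (f : Rn -> C) x : sch f ->
  fourier (fun y => f (-1 *: y + 0)) x = fourier f (-1 *: x).
Proof.
move=> Sf; have N10 : -1 != 0 :> R by rewrite oppr_eq0 oner_eq0.
by have := fourier_scale x N10 Sf; rewrite normrN1 expr1n mul1r invrN1.
Qed.

Lemma inv_fourier_inversion (psi : Rn -> C) x : sch psi ->
  inv_fourier (fourier psi) x = inv_cst * psi x.
Proof.
move=> Sp; rewrite -(fourier_inversion x Sp) inv_fourierE addr0.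
have N10 : -1 != 0 :> R by rewrite oppr_eq0 oner_eq0.
have Sf := sch_fourier Sp.
rewrite (_ : inv_fourier psi = fun y => fourier_cst * fourier psi (-1 *: y + 0)); last first.
  by apply/funext => y; rewrite inv_fourierE.
by rewrite (fourierZ _ _ (sch_scale 0 N10 Sf)) (fourier_reflect _ Sf).
Qed.

Lemma Re_conjc (z : C) : complex.Re z^*%C = complex.Re z. Proof. by case: z. Qed.

Lemma Im_conjc (z : C) : complex.Im z^*%C = - complex.Im z. Proof. by case: z. Qed.

(** If the constant were 0, then [psi = |b| ^ 2] would satisfy [\int |fourier psi| ^ 2 = 0]: the
    multiplication formula moves one Fourier transform onto the conjugate of [fourier psi], a
    multiple of an inverse Fourier transform, and inversion produces the factor [inv_cst]. But
    [fourier psi 0 = \int |b| ^ 2] is positive because [b 0 = 1]. *)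
Lemma inv_cst_neq0 : inv_cst != 0.
Proof.
apply/eqP => K0.
pose psi (x : Rn) := b x * (b x)^*%C.
have normsq (z : C) : z * z^*%C = (complex.Re z ^+ 2 + complex.Im z ^+ 2)%:C.
  by case: z => u v; apply: cext; rewrite /= ; ring.
have conj_mfam (f : Rn -> C) : sch f -> sch (fun x => (f x)^*%C) by move=> Sf; exact: (sfam_conj Sf).
have schM (f g : Rn -> C) : sch f -> sch g -> sch (fun x => f x * g x).
  move=> Sf Sg; have Mf : mfam (fun _ : unit => 1) (fun _ => f).
    split=> [_|l]; first exact: sch_smooth.
    have [_ /(_ 0%N l)[B B0 hB]] := Sf; exists 0%N, B => // i x.
    by have := hB i x; rewrite !expr0 mul1r !mulr1.
  have := sfam_mul (fun=> ler01) (fun=> ler01) Mf Sg.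
  by under eq_fun do rewrite mulr1.
have Sp : sch psi by apply: schM => //; exact: conj_mfam.
have Scp : sch (fun x => (psi x)^*%C) by exact: conj_mfam.
have conjF xi : (fourier psi xi)^*%C = (2 * pi) %:C ^+ n * inv_fourier (fun x => (psi x)^*%C) xi.
  rewrite inv_fourierE mulrA -rmorphXn -rmorphM /= divff ?expf_eq0 ?mul1r; last first.
    by rewrite negb_and mulf_eq0 negb_or pnatr_eq0/= gt_eqF ?pi_gt0// orbT.
  rewrite addr0; apply: (@cext _ (fourier psi xi)^*%C).
    rewrite Re_conjc !Re_fourier; apply: eq_Rintegral => x _.
    by rewrite /osc [dotp x (_ *: _)]dotpC dotpZl (mulN1r (dotp xi x)) cosN sinN [dotp xi x]dotpC; case: (psi x) => u v /=; ring.
  rewrite Im_conjc.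
  have [B [_ B1 B2 B3 B4]] := decaying_sch Sp.
  rewrite !Im_fourier /osc_int -[LHS]mulN1r -RintegralZl//; last exact: integrable_osc B2 B3.
  apply: eq_Rintegral => x _.
  by rewrite /osc [dotp x (_ *: _)]dotpC dotpZl (mulN1r (dotp xi x)) cosN sinN [dotp xi x]dotpC; case: (psi x) => u v /=; ring.
have key : cintegral setT (fun xi => fourier psi xi * (fourier psi xi)^*%C) = 0.
  rewrite (fourier_mult_formula Sp); last by apply: conj_mfam; exact: sch_fourier.
  rewrite (_ : (fun x => _) = fun=> 0).
    by rewrite /cintegral /= /Rintegral integral0.
  apply/funext => x; under [X in fourier X x]eq_fun do rewrite conjF.
  by rewrite fourierZ ?fourier_inversion// ?K0 ?mul0r ?mulr0//; exact: sch_inv_fourier.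
have pos (f : Rn -> C) x0 : sch f -> 0 < complex.Re (f x0) ^+ 2 + complex.Im (f x0) ^+ 2 ->
    0 < complex.Re (cintegral setT (fun x => f x * (f x)^*%C)).
  move=> Sf h0; have [Ir _] := sch_cintegrable (schM _ _ Sf (conj_mfam _ Sf)).
  have [[cr ci] _] := (sch_smooth Sf, 0%N).
  apply: (@Rintegral_gt0 _ _ _ x0) => //.
  - under eq_fun do rewrite normsq /=.
    apply: row_continuousD; under eq_fun do rewrite expr2; apply: row_continuousM; exact: smooth_continuous.
  - by move=> x; rewrite normsq /= addr_ge0// sqr_ge0.
  - by rewrite normsq.
have F0 : fourier psi 0 = cintegral setT psi.
  rewrite /fourier; congr cintegral; apply/funext => x.
  have -> : dotp x 0 = 0 by rewrite dotpC -(scale0r x) dotpZl mul0r.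
  by rewrite oppr0 /cis cos0 sin0 mulr1.
have Fp : 0 < complex.Re (fourier psi 0).
  by rewrite F0; apply: (pos b 0 Sb); rewrite b0 /= expr1n expr0n addr0.
have := pos (fourier psi) 0 (sch_fourier Sp).
rewrite key /= ltxx => h1; suff : false by [].
by apply: h1; rewrite ltr_pwDl ?sqr_ge0// exprn_gt0.
Qed.

End inversion.

(** * The fundamental lemma of the calculus of variations *)

Section logistic.
Context (R : realType).

Definition logistic (t : R) : R := (1 + expR (- t))^-1.

Lemma logistic_den_gt0 (t : R) : 0 < 1 + expR (- t).
Proof. by rewrite addr_gt0// expR_gt0. Qed.

Lemma logistic_ge0 t : 0 <= logistic t.
Proof. by rewrite invr_ge0 ltW// logistic_den_gt0. Qed.

Lemma logistic_le1 t : logistic t <= 1.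
Proof. by rewrite invf_le1 ?logistic_den_gt0// lerDl expR_ge0. Qed.

Lemma is_derive_inv (F : R -> R) (t d : R) : F t != 0 -> is_derive t 1 F d ->
  is_derive t 1 (fun s => (F s)^-1) (- (F t) ^- 2 * d).
Proof.
move=> Ft [dF <-]; constructor; first exact: (derivableV Ft dF).
exact: (deriveV Ft dF).
Qed.

(** The derivative is a polynomial in the function itself, which turns [smooth_logistic] into a
    coinduction over polynomials. *)
Lemma is_derive_logistic (t : R) : is_derive t 1 logistic (logistic t * (1 - logistic t)).
Proof.
have d0 := logistic_den_gt0 t.
have h1 : is_derive t 1 (fun s : R => expR (- s)) (- expR (- t)).
  rewrite -mulrN1; apply: (@is_derive1_comp _ expR (-%R)).
have h2 : is_derive t 1 (fun s : R => 1 + expR (- s)) (- expR (- t)).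
  have [dh1 vh1] := h1; constructor; first exact: (derivableD (derivable_cst (1 : R) t 1) dh1).
  by rewrite [LHS](deriveD (derivable_cst (1 : R) t 1) dh1) derive_cst vh1 add0r.
have n0 : (fun s : R => 1 + expR (- s)) t != 0 by rewrite gt_eqF.
rewrite [X in is_derive _ _ _ X](_ : _ = - (1 + expR (- t)) ^- 2 * - expR (- t)).
  rewrite (_ : logistic = fun s : R => (1 + expR (- s))^-1)//.
  exact: (@is_derive_inv (fun s : R => 1 + expR (- s)) t (- expR (- t)) n0 h2).
by rewrite /logistic; field; rewrite gt_eqF.
Qed.

(** The shift by 1 settles [t = 0]: the argument is then [- m] and the limit 0, as for negative [t].
    Both limits follow from [expR x >= 1 + x], by comparison with [1 / (m + 1)]. *)
Lemma logistic_step (t : R) :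
  logistic (m%:R * (m%:R * t - 1)) @[m --> \oo] --> ((0 < t)%R%:R : R).
Proof.
have [t0|t0] := ltP 0 t.
- have h : 1 + expR (- (m%:R * (m%:R * t - 1))) @[m --> \oo] --> (1 + 0 : R).
    apply: cvgD; first exact: cvg_cst.
    apply: (@squeeze_cvgr _ _ _ _ (fun=> 0) (fun m => (m.+1%:R)^-1)); last 2 first.
    - exact: cvg_cst.
    - exact: (@cvg_harmonic R).
    near=> m; apply/andP; split; first exact: expR_ge0.
    rewrite expRN lef_pV2 ?posrE ?expR_gt0 ?ltr0n//.
    apply: le_trans (expR_ge1Dx _); rewrite -natr1 addrC lerD2l -[leLHS]mulr1 ler_wpM2l//.
    rewrite lerBrDr -ler_pdivrMr//.
    by near: m; exact: nbhs_infty_ger.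
  rewrite -[X in _ --> X]invr1 -[X in X^-1]addr0; apply: cvgV => //.
- apply: (@squeeze_cvgr _ _ _ _ (fun=> 0) (fun m => (m.+1%:R)^-1)); last 2 first.
  - exact: cvg_cst.
  - exact: (@cvg_harmonic R).
  near=> m; rewrite logistic_ge0/= /logistic lef_pV2 ?posrE ?logistic_den_gt0 ?ltr0n//.
  rewrite -natr1 addrC lerD2l; apply: le_trans (expR_ge1Dx _).
  have : m%:R * t <= 0 :> R by rewrite mulr_ge0_le0.
  have := ler0n R m; nra.
Unshelve. all: by end_near. Qed.

End logistic.

Section fundamental_lemma.
Context (R : realType) (n : nat).
Local Notation Rn := 'rV[R]_n.
Local Notation mu := (lebesgue_row R n).

Lemma smooth_logistic (c d : R) (i : 'I_n) :
  smooth (fun x : Rn => logistic (c * x 0 i + d)).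
Proof.
pose s (x : Rn) := logistic (c * x 0 i + d).
apply: (@smooth_coind _ _ [set f | exists p : {poly R}, f = fun x => p.[s x]]); last first.
  by exists 'X; apply/funext => x; rewrite hornerX.
have ds j x : is_derive x 'e_j s (c * (j == i)%:R * (s x * (1 - s x))).
  apply/is_derive_line0; rewrite /s.
  under eq_fun do rewrite !mxE eqxx/=.
  set e := (i == j)%:R.
  have h : is_derive (0 : R) 1 (fun t => c * (t * e + x 0 i) + d) (c * e).
    by apply: is_derive_eq; rewrite /GRing.scale/=; ring.
  rewrite [X in is_derive _ _ _ X](_ : _ = (s x * (1 - s x)) * (c * e)); last first.
    have -> : (j == i)%:R = e by rewrite /e eq_sym.
    by rewrite mulrC.
  have E : s x = logistic (c * (0 * e + x 0 i) + d) by rewrite mul0r add0r.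
  rewrite E; exact: (@is_derive1_comp _ (@logistic R) (fun t => c * (t * e + x 0 i) + d) _ _ _ (is_derive_logistic _)).
have cs : continuous s.
  move=> x; apply: (@continuous_comp _ _ _ (fun x : Rn => c * x 0 i + d) (@logistic R)).
    apply: row_continuousD; last exact: row_continuous_cst.
    by apply: row_continuousM; [exact: row_continuous_cst|exact: coord_continuous].
  apply: differentiable_continuous; apply/derivable1_diffP.
  by have [] := is_derive_logistic (c * x 0 i + d).
move=> _ [p ->]; split.
  move=> x; apply: (@continuous_comp _ _ _ s (horner p)); first exact: cs.
  exact: continuous_horner.
have dp j x : is_derive x 'e_j (fun x => p.[s x]) (p^`().[s x] * (c * (j == i)%:R * (s x * (1 - s x)))).
  apply/is_derive_line0; have /is_derive_line0 h := ds j x.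
  have := @is_derive1_comp _ (horner p) (fun t => s (t *: 'e_j + x)) 0 _ _ (is_derive_poly p _) h.
  by rewrite scale0r add0r.
move=> j; split=> [x|]; first by have [] := dp j x.
exists (p^`() * ((c * (j == i)%:R)%:P * ('X * (1 - 'X)))).
apply/funext => x; have [_ ->] := dp j x.
by rewrite !(hornerM, hornerD, hornerN, hornerC, hornerX).
Qed.

Lemma smooth_prod (I : Type) (r : seq I) (F : I -> Rn -> R) :
  (forall i, smooth (F i)) -> smooth (fun x => \prod_(i <- r) F i x).
Proof.
move=> sF; elim: r => [|i r IH].
  by under eq_fun do rewrite big_nil; exact: smooth_cst.
by under eq_fun do rewrite big_cons; exact: (smoothM (sF i) IH).
Qed.

Definition orthant (a : 'I_n -> R) : set Rn := [set x | forall i, a i < x 0 i].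

Lemma measurable_orthant a : measurable (orthant a).
Proof.
rewrite (_ : orthant a = [set x | forall i, `]a i, +oo[%classic (x 0 i)]).
  by apply: (@measurable_row_rect R n (fun i => `]a i, +oo[%classic)) => i.
by apply/seteqP; split => x h i; have := h i; rewrite /= in_itv/= andbT.
Qed.

Lemma measurable_orthants :
  (@measurable _ Rn) `<=` <<s [set A | exists a, A = orthant a] >>.
Proof.
set G := [set A | _].
apply: smallest_sub; first exact: smallest_sigma_algebra.
rewrite -bigcup_seq; apply: bigcup_sub => i _ A [B mB <-].
have : measurable_fun [set: g_sigma_algebraType G] (fun x : g_sigma_algebraType G => (x : Rn) 0 i).
  apply: (measurability _ (RGenOInfty.measurableE R)).
  move=> _ [_ [t ->] <-]; rewrite setTI.
  (* An open half-space is an increasing union of orthants whose other bounds tend to minus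
     infinity. *)
  rewrite (_ : _ @^-1` _ = \bigcup_(m : nat) orthant (fun j => if j == i then t else - m%:R)).
    by apply: bigcupT_measurable => m; apply: sub_sigma_algebra; eexists.
  apply/seteqP; split => x /=; rewrite ?in_itv/= ?andbT.
    move=> tx; have [m hm] : exists m : nat, `|x| < m%:R.
      by exists (Num.truncn `|x|).+1; rewrite truncnS_gt.
    exists m => // j; case: eqP => [->//|_].
    by rewrite ltrNl (le_lt_trans _ hm)// (le_trans _ (row_coord_le x j))// -normrN ler_norm.
  by move=> [m _ /(_ i)]; rewrite eqxx.
by move=> /(_ measurableT B mB); rewrite setTI.
Qed.

(** Products of logistic functions converge boundedly to the indicators of orthants, so [k] has
    integral 0 over each orthant. Orthants generate the Borel sets and are stable under
    intersection, and the sets over which the integral vanishes form a lambda-system. The test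
    functions are bounded rather than compactly supported, which integrability of [k] allows. *)
Lemma ae_eq0_smooth (k : Rn -> R) : mu.-integrable setT (EFin \o k) ->
  (forall chi : Rn -> R, smooth chi -> (forall x, 0 <= chi x <= 1) ->
     \int[mu]_x (k x * chi x) = 0) ->
  {ae mu, forall x, k x = 0}.
Proof.
move=> Ik hk; have mk : measurable_fun setT k by apply/measurable_EFinP; exact: measurable_int Ik.
have Inorm : mu.-integrable setT (EFin \o (fun x => `|k x|)) by exact: integrable_norm Ik.
have Ind A : measurable A -> mu.-integrable setT (EFin \o (fun x => k x * \1_A x)).
  move=> mA; apply: (integrable_dom _ Inorm).
    by apply: measurable_funM => //; exact: measurable_indic.
  move=> x; rewrite normrM -[leRHS]mulr1 ler_wpM2l// indicE.
  by case: (x \in A); rewrite ?normr1 ?normr0.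
pose H := [set A : set Rn | measurable A /\ \int[mu]_x (k x * \1_A x) = 0].
have HG : [set A | exists a, A = orthant a] `<=` H.
  move=> _ [a ->]; split; first exact: measurable_orthant.
  pose chi m (x : Rn) := \prod_(i < n) logistic (m%:R * (m%:R * (x 0 i - a i) - 1)).
  have chi01 m x : 0 <= chi m x <= 1.
    apply/andP; split; first by apply: prodr_ge0 => i _; exact: logistic_ge0.
    by apply: prodr_ile1 => i _; rewrite logistic_ge0 logistic_le1.
  have schi m : smooth (chi m).
    apply: smooth_prod => i.
    have := @smooth_logistic (m%:R * m%:R) (- (m%:R * (m%:R * a i + 1))) i.
    by rewrite (_ : (fun x => _) = fun x : Rn => logistic (m%:R * (m%:R * (x 0 i - a i) - 1)))//;
      apply/funext => x; congr logistic; ring.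
  have cchi x : chi m x @[m --> \oo] --> (\1_(orthant a) x : R).
    have -> : \1_(orthant a) x = \prod_(i < n) (0 < x 0 i - a i)%R%:R :> R.
      rewrite indicE; case: (boolP (x \in orthant a)) => [|].
        by rewrite inE => h; rewrite big1// => i _; rewrite subr_gt0 h.
      rewrite notin_setE /orthant /= => nO.
      have [i hi] : exists i, ~ (a i < x 0 i).
        by apply: contrapT => h; apply: nO => i; apply: contrapT => hi; apply: h; exists i.
      move: hi; rewrite -subr_gt0 => hi.
      by rewrite (bigD1 i)//= (negbTE (introN idP hi)) mul0r.
    rewrite /chi; elim: (index_enum _) => [|i r IH].
      by under eq_fun do rewrite big_nil; rewrite big_nil; exact: cvg_cst.
    under eq_fun do rewrite big_cons.
    by rewrite big_cons; apply: cvgM => //; exact: logistic_step.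
  have := @Rintegral_dct R n (fun m x => k x * chi m x) (fun x => k x * \1_(orthant a) x) (fun x => `|k x|).
  move=> /(_ _ Inorm _ _).
  rewrite (_ : (fun m => _) = fun=> 0); last by apply/funext => m; exact: hk.
  move=> h; have := h _ _ _; move=> {}h.
  have {}h : 0 @[m --> \oo] --> \int[mu]_x (k x * \1_(orthant a) x).
    apply: h.
    - move=> m; apply: measurable_funM => //.
      by apply: continuous_measurable_row; exact: smooth_continuous (schi m).
    - move=> m x; rewrite normrM -[leRHS]mulr1 ler_wpM2l//.
      by have /andP[c0 c1] := chi01 m x; rewrite ger0_norm.
    - by move=> x; apply: cvgMl_tmp.
  by have := cvg_lim (@Rhausdorff R) h; rewrite lim_cst// => <-.
have lamH : lambda_system setT H.
  split=> //.
  - split=> //; have := hk (fun=> 1) (@smooth_cst R n 1).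
    move=> <-; last by move=> x; rewrite ler01 lexx.
    by apply: eq_Rintegral => x _; rewrite indicT.
  - move=> A B BA [mA A0] [mB B0]; split; first exact: measurableD.
    transitivity (\int[mu]_x (k x * \1_A x - k x * \1_B x)).
      apply: eq_Rintegral => x _; rewrite -mulrBr; congr (_ * _).
      rewrite !indicE in_setD; have [xB|xB] := boolP (x \in B); last by rewrite andbT subr0.
      by rewrite andbF mem_set ?subrr//; apply: BA; rewrite -inE.
    by rewrite RintegralB ?A0 ?B0 ?subrr//; exact: Ind.
  - move=> F ndF HF; have mF i : measurable (F i) by have [] := HF i.
    split; first exact: bigcupT_measurable.
    have h : \int[mu]_x (k x * \1_(F m) x) @[m --> \oo] --> \int[mu]_x (k x * \1_(\bigcup_i F i) x).
      apply: (@Rintegral_dct _ _ _ _ (fun x => `|k x|)) => //.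
      - by move=> m; apply: measurable_funM => //; exact: measurable_indic.
      - move=> m x; rewrite normrM -[leRHS]mulr1 ler_wpM2l// indicE.
        by case: (x \in F m); rewrite ?normr1 ?normr0.
      - move=> x; apply: cvgMl_tmp; rewrite !indicE.
        have [|xU] := boolP (x \in \bigcup_i F i).
          rewrite inE => -[i _ Fi]; apply: cvg_near_cst; near=> m.
          rewrite indicE mem_set//; suff : F i `<=` F m by exact.
          by apply/subsetPset/ndF; near: m; exact: nbhs_infty_ge.
        apply: cvg_near_cst; near=> m; rewrite indicE memNset//.
        by move: xU; rewrite notin_setE => xU Fm; apply: xU; exists m.
    have := cvg_lim (@Rhausdorff R) h => <-.
    rewrite (_ : (fun m => _) = fun=> 0); first by rewrite lim_cst.
    by apply/funext => m; have [] := HF m.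
have setIG : setI_closed [set A | exists a, A = orthant a].
  move=> _ _ [a ->] [a' ->]; exists (fun i => Num.max (a i) (a' i)).
  apply/seteqP; split => x /=; first by move=> [h h'] i; rewrite gt_max h h'.
  by move=> h; split=> i; have := h i; rewrite gt_max => /andP[].
have HM (A : set Rn) : measurable A -> \int[mu]_x (k x * \1_A x) = 0.
  move=> mA; suff : H A by case.
  apply: (lambda_system_subset setIG lamH HG) => //.
  exact: measurable_orthants.
have h0 : ae_eq mu setT (EFin \o k) (cst 0%E).
  apply: (integral_ae_eq measurableT Ik) => // E _ mE.
  rewrite integral0.
  have Ef : (\int[mu]_(x in E) (k x)%:E)%E \is a fin_num.
    by apply: integrable_fin_num => //; apply: integrableS Ik.
  rewrite -(fineK Ef); congr EFin; rewrite -(HM E mE).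
  rewrite -[LHS]/(Rintegral mu E k) Rintegral_mkcond; apply: eq_Rintegral => x _.
  by rewrite /patch indicE; case: (x \in E); rewrite ?mulr1 ?mulr0.
by apply: filterS h0 => x /(_ I) [].
Unshelve. all: by end_near. Qed.

End fundamental_lemma.

(** * Dyadic blocks of tempered distributions *)

Section dyadic.
Context (R : realType) (n : nat).
Local Notation Rn := 'rV[R]_n.
Local Notation C := R[i].
Local Notation mu := (lebesgue_row R n).
Variables (phi : nat -> Rn -> C) (hphi : dyadic_partition phi).

Lemma sch_phi j : sch (phi j).
Proof. by apply/schwartzE; case: hphi. Qed.

Lemma phi0_eq0 x : 2 <= enorm x -> phi 0%N x = 0.
Proof.
move=> hx; apply: contrapT => h.
have : csupp (phi 0%N) x by apply: subset_closure; exact/eqP.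
by case: hphi => _ + _ _ _ => /[apply]; rewrite /eball /= ltNge hx.
Qed.

Lemma phiS_eq0 j x : enorm x < 2 ^+ j \/ 2 ^+ j.+2 <= enorm x -> phi j.+1 x = 0.
Proof.
move=> hx; apply: contrapT => h.
have : csupp (phi j.+1) x by apply: subset_closure; exact/eqP.
case: hphi => _ _ /(_ j) + _ _ => /[apply] -[]; rewrite /eball /= => h1 h2.
by case: hx => [//|]; rewrite leNgt h1.
Qed.

Definition psum M (x : Rn) : C := \sum_(0 <= j < M.+1) phi j x.

Lemma csmooth_psum M : csmooth (psum M).
Proof. by apply: csmooth_sum => j; exact: sch_smooth (sch_phi j). Qed.

(** All later terms vanish at [x], so the partial sums are stationary and equal to their limit. *)
Lemma psum_eq1 M x : enorm x < 2 ^+ M -> psum M x = 1.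
Proof.
move=> hx; case: hphi => _ _ _ _ /(_ x)[hr hi].
have E m : (M.+1 <= m)%N -> \sum_(0 <= j < m) phi j x = psum M x.
  move=> Mm; rewrite /psum (big_cat_nat (n := M.+1))//= [X in _ + X](_ : _ = 0) ?addr0//.
  rewrite big_nat_cond big1// => j.
  rewrite andbT; case: j => [|j] //= /andP[Mj _]; apply: phiS_eq0; left.
  by apply: (lt_le_trans hx); rewrite ler_weXn2l ?ler1n.
have sumRe m : \sum_(0 <= j < m) complex.Re (phi j x) = complex.Re (\sum_(0 <= j < m) phi j x).
  elim: m => [|m IH]; first by rewrite !big_geq.
  by rewrite !big_nat_recr//= IH cE.
have sumIm m : \sum_(0 <= j < m) complex.Im (phi j x) = complex.Im (\sum_(0 <= j < m) phi j x).
  elim: m => [|m IH]; first by rewrite !big_geq.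
  by rewrite !big_nat_recr//= IH cE.
apply: cext => /=.
  have := cvg_lim (@Rhausdorff R) hr => <-; apply/esym.
  apply: cvg_lim => //; apply: cvg_near_cst; near=> m.
  by rewrite sumRe E//; near: m; exact: nbhs_infty_ge.
have := cvg_lim (@Rhausdorff R) hi => <-; apply/esym.
apply: cvg_lim => //; apply: cvg_near_cst; near=> m.
by rewrite sumIm E//; near: m; exact: nbhs_infty_ge.
Unshelve. all: by end_near. Qed.

Lemma enorm0 : enorm (0 : Rn) = 0.
Proof. by rewrite /enorm big1 ?sqrtr0// => i _; rewrite mxE expr0n. Qed.

Lemma enormZ (c : R) (x : Rn) : enorm (c *: x) = `|c| * enorm x.
Proof.
rewrite /enorm; under eq_bigr do rewrite mxE exprMn.
by rewrite -mulr_sumr sqrtrM ?sqr_ge0// sqrtr_sqr.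
Qed.

(** It is 1 for [enorm x < 4] and 0 for [enorm x >= 8], and has three uses: as summability factor in
    Fourier inversion, as the multiplier that reproduces a dyadic block, and, in space, as a cutoff
    function. *)
Definition bump : Rn -> C := psum 2.

Lemma sch_psum M : sch (psum M).
Proof.
rewrite /psum; elim: M => [|M IH].
  rewrite (_ : (fun x => _) = phi 0%N); first exact: sch_phi.
  by apply/funext => x; rewrite big_nat1.
rewrite (_ : (fun x => _) = fun x => \sum_(0 <= j < M.+1) phi j x + phi M.+1 x).
  exact: (sfamD IH (sch_phi M.+1)).
by apply/funext => x; rewrite big_nat_recr.
Qed.

Lemma bump_eq1 x : enorm x < 4 -> bump x = 1.
Proof. by move=> hx; apply: psum_eq1; rewrite (lt_le_trans hx)// expr2; lra. Qed.

Lemma bump0 : bump 0 = 1.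
Proof. by apply: bump_eq1; rewrite enorm0. Qed.

Lemma bump_eq0 x : 8 <= enorm x -> bump x = 0.
Proof.
move=> hx; rewrite /bump /psum !big_nat_recl//= big_geq// addr0.
rewrite phi0_eq0 ?(le_trans _ hx)//; last by lra.
by rewrite !phiS_eq0 ?addr0//; right; apply: le_trans hx; rewrite !exprS expr0; lra.
Qed.

Lemma phi_bump j xi : phi j xi * bump ((2 ^+ j)^-1 *: xi + 0) = phi j xi.
Proof.
have [h|h] := ltP (enorm xi) (2 ^+ j.+1).
  rewrite bump_eq1 ?mulr1// addr0 enormZ ger0_norm ?invr_ge0 ?exprn_ge0//.
  rewrite mulrC ltr_pdivrMr ?exprn_gt0// (lt_le_trans h)// exprS ler_wpM2r ?exprn_ge0//; lra.
suff -> : phi j xi = 0 by rewrite mul0r.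
by case: j h => [|j] h; [exact: phi0_eq0|apply: phiS_eq0; right].
Qed.

Lemma cpartials_psum M l : cpartials l (psum M) = fun x => \sum_(0 <= j < M.+1) cpartials l (phi j) x.
Proof.
elim: M => [|M IH].
  rewrite (_ : psum 0 = phi 0%N); first by apply/funext => x; rewrite big_nat1.
  by apply/funext => x; rewrite /psum big_nat1.
rewrite (_ : psum M.+1 = fun x => psum M x + phi M.+1 x); last first.
  by apply/funext => x; rewrite /psum big_nat_recr.
rewrite (cpartialsD l (csmooth_psum M) (sch_smooth (sch_phi M.+1))) IH.
by apply/funext => x; rewrite [RHS]big_nat_recr.
Qed.

Lemma ball_enorm_lt (x : Rn) (r : R) : n%:R * `|x| < r -> enorm x < r.
Proof. by move=> h; exact: le_lt_trans (enorm_le_norm x) h. Qed.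

Lemma open_normlt (r : R) : open [set x : Rn | n%:R * `|x| < r].
Proof.
have -> : [set x : Rn | n%:R * `|x| < r] = (fun x : Rn => n%:R * `|x|) @^-1` [set t | t < r] by [].
apply: open_comp; last exact: open_lt.
move=> x _; apply: (@row_continuousM R n (fun=> n%:R) (fun x => `|x|)).
  exact: row_continuous_cst.
by move=> y; exact: norm_continuous.
Qed.

(* [1 - psum M] vanishes for [enorm x < 2 ^+ M], where the growth of
   derivatives is traded for the factor [2 ^- M]. *)
Lemma mfam_tail : mfam (fun M => 2 ^- M) (fun M x => 1 - psum M x).
Proof.
have cs M : csmooth (fun x => 1 - psum M x).
  rewrite (_ : (fun x => _) = fun x => (fun=> 1) x + (-1) * psum M x).
    exact: (csmoothD (csmooth_cst n 1) (csmoothM (csmooth_cst n (-1)) (csmooth_psum M))).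
  by apply/funext => x; rewrite mulN1r.
split=> // l.
have [c hc] : exists c : R, forall j x, Normc.normc (cpartials l (phi j) x) <= c.
  case: hphi => _ _ _ /(_ l)[c hc] _; exists `|c| => j x; apply: (le_trans (hc j x)).
  rewrite -[leRHS]mulr1; apply: le_trans (ler_wpM2r _ (ler_norm c)) _; first by rewrite invr_ge0 exprn_ge0.
  by rewrite ler_wpM2l// invf_le1 ?exprn_gt0// exprn_ege1// ler1n.
have c0 : 0 <= c by apply: le_trans (hc 0%N 0); exact: normc_ge0.
exists 2%N, (2 * (1 + c) * n%:R ^+ 2); first by rewrite !mulr_ge0 ?addr_ge0.
move=> M x.
have [h|h] := ltP (n%:R * `|x|) (2 ^+ M).
  rewrite (cpartials_near0 (U := [set x | n%:R * `|x| < 2 ^+ M]))//; last 2 first.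
  - exact: open_normlt.
  - by move=> y /= hy; rewrite psum_eq1 ?subrr//; exact: ball_enorm_lt.
  by rewrite Normc.normc0 !mulr_ge0 ?addr_ge0 ?invr_ge0 ?exprn_ge0 ?addr_ge0.
(* In this region [2 ^+ M <= n * (1 + |x|)]. The [M + 1] terms are together at most a multiple of
   [2 ^+ M = 2 ^- M * (2 ^+ M) ^+ 2], whence the growth exponent 2. *)
apply: (@le_trans _ _ (1 + c * M.+1%:R)).
  rewrite (_ : (fun x => _) = fun x => (fun=> 1) x + (-1) * psum M x); last first.
    by apply/funext => y; rewrite mulN1r.
  rewrite (cpartialsD l (csmooth_cst n 1) (csmoothM (csmooth_cst n (-1)) (csmooth_psum M))).
  rewrite (cpartialsZ l (-1) (csmooth_psum M)) cpartials_psum.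
  apply: (le_trans (normcD _ _)); apply: lerD.
    case/lastP: l {hc} => [|l k]; first by rewrite cpartials_nil Normc.normc1.
    rewrite cpartials_rcons cD_cst.
    have -> : cpartials l (fun _ : Rn => 0 : C) = fun=> 0.
      elim/last_ind: l => [|l k' IH]; first by rewrite cpartials_nil.
      by rewrite cpartials_rcons cD_cst.
    by rewrite Normc.normc0.
  rewrite mulN1r normcN; elim: (M.+1) => [|k IH]; first by rewrite big_geq// Normc.normc0 mulr0.
  rewrite big_nat_recr//= (le_trans (normcD _ _))// -natr1 mulrDr mulr1 lerD//.
have hM : M.+1%:R <= 2 ^+ M :> R by rewrite -natrX ler_nat ltn_expl.
apply: (@le_trans _ _ ((1 + c) * 2 ^+ M)).
  have : 1 <= 2 ^+ M :> R by apply: le_trans hM; rewrite ler1n.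
  by nra.
rewrite (_ : 2 * (1 + c) * _ * _ * _ = (1 + c) * (2 ^- M * (2 * (n%:R * (1 + `|x|)) ^+ 2))); last by ring.
rewrite ler_wpM2l ?addr_ge0//.
rewrite mulrC ler_pdivlMr ?exprn_gt0//.
have h2 : 2 ^+ M <= n%:R * (1 + `|x|) by rewrite (le_trans h)// ler_wpM2l// lerDr.
have : 0 <= 2 ^+ M :> R by rewrite exprn_ge0.
by nra.
Qed.

Section representation.
Variables (u : (Rn -> C) -> C) (tu : tempered u).

Lemma tempered_lin a (f g : Rn -> C) : sch f -> sch g ->
  u (fun x => a * f x + g x) = a * u f + u g.
Proof. by move=> /schwartzE Sf /schwartzE Sg; case: tu => + _; apply. Qed.

Lemma sch0 : sch (fun _ : Rn => 0).
Proof.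
have := sfamZ 0 (fun=> ler01) (sch_phi 0); apply: sfam_eq => i x; by rewrite mul0r.
Qed.

Lemma tempered0 : u (fun=> 0) = 0.
Proof.
have := tempered_lin 1 sch0 sch0.
under eq_fun do rewrite mul1r addr0.
by rewrite mul1r => /eqP; rewrite -subr_eq0 opprD addNKr oppr_eq0 => /eqP.
Qed.

Lemma temperedZ a (f : Rn -> C) : sch f -> u (fun x => a * f x) = a * u f.
Proof.
move=> Sf; have := tempered_lin a Sf sch0; rewrite tempered0 addr0 => <-.
by congr u; apply/funext => x; rewrite addr0.
Qed.

Lemma temperedD (f g : Rn -> C) : sch f -> sch g -> u (fun x => f x + g x) = u f + u g.
Proof.
move=> Sf Sg; have := tempered_lin 1 Sf Sg; rewrite mul1r => <-.
by congr u; apply/funext => x; rewrite mul1r.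
Qed.

Lemma mfam_sch (f : Rn -> C) : sch f -> mfam (fun _ : unit => 1) (fun _ => f).
Proof.
move=> Sf; split=> [_|l]; first exact: sch_smooth.
have [_ /(_ 0%N l)[B B0 hB]] := Sf; exists 0%N, B => // i x.
by have := hB i x; rewrite !expr0 mul1r !mulr1.
Qed.

Lemma schM (f g : Rn -> C) : sch f -> sch g -> sch (fun x => f x * g x).
Proof.
move=> Sf Sg; have := sfam_mul (fun=> ler01) (fun=> ler01) (mfam_sch Sf) Sg.
by under eq_fun do rewrite mulr1.
Qed.

Lemma fourierD (f g : Rn -> C) x : sch f -> sch g ->
  fourier (fun y => f y + g y) x = fourier f x + fourier g x.
Proof.
have icis (f' : Rn -> C) : sch f' -> cintegrable (fun y => f' y * cis (- dotp y x)).
  move=> Sf; rewrite (_ : (fun y => _) = fun y => f' y * cis (dotp y (- x))).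
    apply: cintegrableM_bounded => //; first exact: cmeasurable_cis.
    by exists 1 => z; rewrite normc_cis.
  by apply/funext => y; rewrite [dotp y (- _)]dotpC -(scaleN1r x) dotpZl mulN1r dotpC.
move=> Sf Sg; rewrite /fourier -cintegralD; [|exact: icis|exact: icis].
by congr cintegral; apply/funext => y; rewrite mulrDl.
Qed.

Lemma psum_blocks M (psi : Rn -> C) : sch psi ->
  u (fourier (fun xi => psum M xi * inv_fourier psi xi)) =
  \sum_(0 <= j < M.+1) dyadic_block phi j u psi.
Proof.
move=> Sp; have Si := sch_inv_fourier Sp.
elim: M => [|M IH].
  by rewrite big_nat1; congr (u (fourier _)); apply/funext => x; rewrite /psum big_nat1.
rewrite big_nat_recr//= -IH -temperedD; last 2 first.
- by apply: sch_fourier; apply: schM => //; exact: sch_psum.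
- by apply: sch_fourier; apply: schM => //; exact: sch_phi.
congr u; apply/funext => x; rewrite -fourierD.
- by congr (fourier _ x); apply/funext => y; rewrite /psum big_nat_recr// mulrDl.
- by apply: schM => //; exact: sch_psum.
- by apply: schM => //; exact: sch_phi.
Qed.

(** The difference is the value of [u] at the Fourier transform of [(1 - psum M) * inv_fourier psi],
    whose Schwartz seminorms are [O(2 ^- M)] by [mfam_tail]. The factor [inv_cst] comes from Fourier
    inversion. *)
Lemma blocks_cvg (psi : Rn -> C) : sch psi -> exists B, forall M,
  Normc.normc (inv_cst bump * u psi - \sum_(0 <= j < M.+1) dyadic_block phi j u psi) <= B * 2 ^- M.
Proof.
move=> Sp; have Si := sch_inv_fourier Sp.
have w0 M : 0 <= (2 ^- M : R) by rewrite invr_ge0 exprn_ge0.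
have Ft := sfam_mul w0 (fun=> ler01) mfam_tail (w := fun M => 2 ^- M) (v := fun=> 1)
  (f := fun _ => inv_fourier psi).
have Fi : sfam (fun _ : nat => 1) (fun _ => inv_fourier psi).
  have [s h] := Si; split=> [_|N l]; first exact: s tt.
  by have [B B0 hB] := h N l; exists B => // _ x; exact: hB tt x.
have {Ft}Fi := sfam_fourier (fun i => mulr_ge0 (w0 i) ler01) (Ft Fi).
have [B hB] := tempered_sfam tu (fun i => mulr_ge0 (w0 i) ler01) Fi.
exists B => M; have := hB M; rewrite mulr1; congr (_ <= _); congr Normc.normc.
rewrite -psum_blocks// -temperedZ//.
have E : (fun x => inv_cst bump * psi x) = fourier (inv_fourier psi).
  by apply/funext => x; rewrite (fourier_inversion (sch_psum 2) bump0).
rewrite E; apply/eqP; rewrite eq_sym subr_eq -temperedD; last 2 first.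
- exact: (sfam_sch M Fi).
- by apply: sch_fourier; apply: schM => //; exact: sch_psum.
apply/eqP; congr u; apply/funext => x; rewrite -fourierD.
- by congr (fourier _ x); apply/funext => y; rewrite mulrBl mul1r subrK.
- apply: (@sfam_sch R n nat (fun i => 2 ^- i * 1) (fun M x => (1 - psum M x) * inv_fourier psi x) M).
  apply: (sfam_mul w0 (fun=> ler01) mfam_tail).
  have [s h] := Si; split=> [_|N l]; first exact: s tt.
  by have [B' B0' hB'] := h N l; exists B' => // _ z; exact: hB' tt z.
- by apply: schM => //; exact: sch_psum.
Qed.

End representation.

End dyadic.

(** * From the Besov norm to functions representing the blocks *)

Section besov_pieces.
Context (R : realType) (n : nat).
Local Notation Rn := 'rV[R]_n.
Local Notation C := R[i].
Local Notation mu := (lebesgue_row R n).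
Variables (phi : nat -> Rn -> C).

(** All that is kept of membership in a Besov space. The exponents [s] and [q] have disappeared, so
    the critical and the supercritical cases are treated alike from here on. *)
Definition pieces (p : R) (u : (Rn -> C) -> C) (g : nat -> Rn -> C) (nu : nat -> R) : Prop :=
  [/\ forall j, cmeasurable setT (g j),
      forall j, 0 <= nu j,
      nu @ \oo --> 0,
      forall j, (\int[mu]_x (Normc.normc (g j x) `^ p)%:E <= (2 ^- j * nu j)%:E)%E &
      forall j psi, sch psi -> dyadic_block phi j u psi = cintegral setT (fun x => g j x * psi x)].

Lemma distr_Lnorm_ge0 p (v : (Rn -> C) -> C) : (0 <= distr_Lnorm p v :> \bar R)%E.
Proof. by apply: le_ereal_inf_tmp => _ [g _ <-]; exact: Lnorm_ge0. Qed.

Lemma cvg_powR0 (y : nat -> R) p : 1 <= p -> (forall j, 0 <= y j) ->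
  y @ \oo --> 0 -> (fun j => y j `^ p) @ \oo --> 0.
Proof.
move=> p1 y0 cy; apply: (@squeeze_cvgr _ _ _ _ (fun=> 0) y) => //; last exact: cvg_cst.
have hy : \forall j \near \oo, y j < 1 by apply: cvgr_lt cy _ _.
near=> j; rewrite powR_ge0/=.
have [yj0|yj0] := eqVneq (y j) 0; first by rewrite yj0 powR0// gt_eqF// (lt_le_trans _ p1).
apply: ge1r_powR => //; rewrite lt0r yj0 y0/=; apply/ltW; near: j; exact: hy.
Unshelve. all: by end_near. Qed.

(** [distr_Lnorm] is an infimum, so representatives are chosen within [4 ^- j] of it. This error
    contributes at most [2 ^- j] to [y j], because [1 / p <= 1]. *)
Lemma pieces_exist p u : 1 <= p -> (forall j, (distr_Lnorm p (dyadic_block phi j u) < +oo)%E) ->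
  (fun j => 2 `^ (j%:R / p) * fine (distr_Lnorm p (dyadic_block phi j u))) @ \oo --> (0 : R) ->
  exists g nu, pieces p u g nu.
Proof.
move=> p1 Lfin cL; have p0 : p != 0 by rewrite gt_eqF// (lt_le_trans _ p1).
set L := fun j => distr_Lnorm p (dyadic_block phi j u).
have Lf j : L j \is a fin_num by rewrite ge0_fin_numE ?distr_Lnorm_ge0//; exact: Lfin.
have L0 j : 0 <= fine (L j) by rewrite fine_ge0// distr_Lnorm_ge0.
have /choice[g hg] : forall j, exists g, (LpC p g /\
     forall f, schwartz f -> dyadic_block phi j u f = regular_distr setT g f) /\
     (cLnorm p g < L j + (4 ^- j)%:E)%E.
  move=> j; have e0 : 0 < 4 ^- j :> R by rewrite invr_gt0 exprn_gt0.
  have [_ [g hg <-] lg] := lb_ereal_inf_adherent e0 (Lf j).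
  by exists g.
pose y j := 2 `^ (j%:R / p) * (fine (L j) + 4 ^- j).
have y0 j : 0 <= y j by rewrite mulr_ge0 ?powR_ge0// addr_ge0// invr_ge0 exprn_ge0.
have cy : y @ \oo --> 0.
  rewrite /y -[X in _ --> X]addr0; under eq_fun do rewrite mulrDr.
  apply: cvgD; first exact: cL.
  apply: (@squeeze_cvgr _ _ _ _ (fun=> 0) (fun j => 2 ^- j)); last 2 first.
  - exact: cvg_cst.
  - exact: two_pow_cvg0.
  near=> j; rewrite mulr_ge0 ?powR_ge0 ?invr_ge0 ?exprn_ge0//=.
  rewrite ler_pdivrMr ?exprn_gt0//.
  apply: (@le_trans _ _ (2 ^+ j)).
    by rewrite -powR_mulrn// ler_powR ?ler1n// ler_pdivrMr ?(lt_le_trans _ p1)// ler_peMr.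
  rewrite (_ : 4 = 2 * 2 :> R); last by rewrite -natrM.
  by rewrite exprMn mulrA mulVf ?mul1r// expf_neq0.
exists g, (fun j => y j `^ p); split.
- by move=> j; have [[[mg _] _] _] := hg j.
- by move=> j; exact: powR_ge0.
- exact: cvg_powR0.
- move=> j; have [[[mg gfin] _] lg] := hg j.
  have E : (\int[mu]_x (Normc.normc (g j x) `^ p)%:E = (cLnorm p (g j)) `^ p)%E.
    rewrite /cLnorm [RHS](poweR_Lnorm _ _ p0); apply: eq_integral => x _.
    by rewrite /= ger0_norm ?normc_ge0// poweR_EFin.
  have cf : cLnorm p (g j) \is a fin_num by rewrite ge0_fin_numE ?Lnorm_ge0.
  rewrite E -(fineK cf) poweR_EFin lee_fin.
  have cle : fine (cLnorm p (g j)) <= fine (L j) + 4 ^- j.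
    by rewrite -lee_fin fineK// EFinD fineK// ltW.
  rewrite powRM ?powR_ge0 ?addr_ge0 ?invr_ge0 ?exprn_ge0// -powRrM divfK// powR_mulrn//.
  rewrite mulrA mulVf ?mul1r ?expf_neq0//.
  rewrite ge0_ler_powR ?nnegrE ?(le_trans _ p1) ?fine_ge0 ?Lnorm_ge0//.
  by rewrite addr_ge0 ?invr_ge0 ?exprn_ge0.
- by move=> j psi /schwartzE Sp; have [[_ h] _] := hg j; rewrite h.
Unshelve. all: by end_near. Qed.

Lemma two_powR_decay (d : R) : 0 < d -> (fun j : nat => 2 `^ (- (d * j%:R)) : R) @ \oo --> 0.
Proof.
move=> d0; have -> : (fun j : nat => 2 `^ (- (d * j%:R)) : R) = fun j => (2 `^ (- d)) ^+ j.
  by apply/funext => j; rewrite -mulNr powRrM powR_mulrn// powR_ge0.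
apply: cvg_expr; rewrite ger0_norm ?powR_ge0// powRN invf_lt1 ?powR_gt0//.
rewrite -[ltLHS](powRr0 (2 : R)) lt_neqAle ler_powR ?ler1n ?ltW// andbT.
apply/eqP => /(congr1 (@ln R)); rewrite !ln_powR mul0r => /esym/eqP.
rewrite mulf_eq0 gt_eqF//= gt_eqF// ln_gt0// ltr1n//.
Qed.

(* For [q < +oo] the terms of a convergent series tend to 0; for [q = +oo] they
   are only bounded, and [p^-1 < s] yields the factor [2 ^ (- (s - p^-1) j)]. *)
Lemma besov_pieces (s p : R) (q : \bar R) u : 1 <= p -> 0 < s -> (1 <= q)%E ->
  (s * p = 1 /\ (q < +oo)%E) \/ 1 < s * p ->
  (besov_norm phi s p q u < +oo)%E -> exists g nu, pieces p u g nu.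
Proof.
move=> p1 s0 q1 hsp; have p0 : 0 < p by rewrite (lt_le_trans _ p1).
have sp : p^-1 <= s.
  by rewrite -div1r ler_pdivrMr//; case: hsp => [[->]|/ltW].
set L := fun j => distr_Lnorm p (dyadic_block phi j u).
have L0 j : (0 <= L j)%E by exact: distr_Lnorm_ge0.
suff main : (forall j, (L j < +oo)%E) /\
    ((fun j => 2 `^ (s * j%:R) * fine (L j)) @ \oo --> (0 : R) \/
     (p^-1 < s /\ exists B : R, forall j, 2 `^ (s * j%:R) * fine (L j) <= B)) -> exists g nu, pieces p u g nu.
  case: q q1 hsp => [r| |] // r1 hsp.
  - rewrite /besov_norm => hN; apply: main.
    have r0 : 0 < r by rewrite (lt_le_trans _ (r1 : (1 <= r))).
    have r0' : r != 0 by rewrite gt_eqF.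
    set T := fun j : nat => ((2 `^ (s * j%:R * r))%:E * L j `^ r)%E.
    have T0 j : (0 <= T j)%E by rewrite mule_ge0 ?lee_fin ?powR_ge0// poweR_ge0.
    have Sfin : (\sum_(0 <= j <oo) T j < +oo)%E.
      by apply: (lty_poweRy (r := r^-1)) => //; rewrite invr_eq0.
    have Tle N : (T N <= \sum_(N <= j <oo) T j)%E.
      by rewrite (nneseries_split N 1)// addn1 big_nat1 leeDl// nneseries_ge0.
    have Tlt j : (T j < +oo)%E.
      apply: le_lt_trans Sfin; apply: (le_trans (Tle j)).
      by rewrite [leRHS](nneseries_split 0 j)// ?add0n leeDr// sume_ge0.
    have Llt j : (L j < +oo)%E.
      apply: (lty_poweRy r0'); rewrite ltNge leye_eq; apply/negP => /eqP h.
      by have := Tlt j; rewrite /T h mulry gtr0_sg ?powR_gt0// mul1e.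
    split=> //; left.
    have Lf j : L j \is a fin_num by rewrite ge0_fin_numE.
    have TE j : T j = ((2 `^ (s * j%:R) * fine (L j)) `^ r)%:E.
      rewrite /T -{1}(fineK (Lf j)) poweR_EFin -EFinM powRM ?powR_ge0 ?fine_ge0//.
      by rewrite -powRrM.
    have cT := nneseries_tail_cvg Sfin (fun j _ => T0 j).
    apply/cvgrPdist_lt => e e0.
    have e1 : (0 < (e `^ r)%:E :> \bar R)%E by rewrite lte_fin powR_gt0.
    have [N _ hN'] : \forall N \near \oo, (\sum_(N <= k <oo) T k < (e `^ r)%:E)%E.
      exact: (cT _ (open_ereal_lt' e1)).
    exists N => // j /= Nj.
    rewrite sub0r normrN ger0_norm ?mulr_ge0 ?powR_ge0 ?fine_ge0//.
    have := le_lt_trans (Tle j) (hN' j Nj); rewrite TE lte_fin => h.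
    rewrite ltNge; apply/negP => he; move: h; rewrite ltNge => /negP; apply.
    have X0 : 0 <= 2 `^ (s * j%:R) * fine (L j) by rewrite mulr_ge0 ?powR_ge0 ?fine_ge0.
    exact: (ge0_ler_powR (ltW r0) (ltW e0) X0 he).
  - rewrite /besov_norm => hN; apply: main.
    have hs : p^-1 < s by case: hsp => [[]//|h]; rewrite -div1r ltr_pdivrMr.
    set S := ereal_sup _ in hN.
    have hT j : ((2 `^ (s * j%:R))%:E * L j <= S)%E by apply: ereal_sup_ubound; exists j.
    have Llt j : (L j < +oo)%E.
      rewrite ltNge leye_eq; apply/negP => /eqP h.
      by have := le_lt_trans (hT j) hN; rewrite h mulry gtr0_sg ?powR_gt0// mul1e.
    split=> //; right; split=> //; exists (fine S) => j.
    have Lf : L j \is a fin_num by rewrite ge0_fin_numE.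
    rewrite -lee_fin fineK; first by rewrite EFinM fineK.
    rewrite ge0_fin_numE//; apply: le_trans (hT j).
    by rewrite mule_ge0// lee_fin powR_ge0.
move=> [Llt hL]; apply: pieces_exist => //.
have L0f j : 0 <= fine (L j) by rewrite fine_ge0.
case: hL => [cL|[hs [B hB]]].
  apply: (@squeeze_cvgr _ _ _ _ (fun=> 0) (fun j => 2 `^ (s * j%:R) * fine (L j))) => //; last exact: cvg_cst.
  near=> j; apply/andP; split.
    apply: mulr_ge0; [exact: powR_ge0|exact: L0f].
  apply: ler_wpM2r; first exact: L0f.
  by rewrite ler_powR ?ler1n// mulrC ler_wpM2r.
have d0 : 0 < s - p^-1 by rewrite subr_gt0.
apply: (@squeeze_cvgr _ _ _ _ (fun=> 0) (fun j => B * 2 `^ (- ((s - p^-1) * j%:R)))); last 2 first.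
- exact: cvg_cst.
- by rewrite -[X in _ --> X](mulr0 B); apply: cvgMl_tmp; exact: two_powR_decay.
near=> j; apply/andP; split.
  apply: mulr_ge0; [exact: powR_ge0|exact: L0f].
have -> : 2 `^ (j%:R / p) = 2 `^ (s * j%:R) * 2 `^ (- ((s - p^-1) * j%:R)) :> R.
  rewrite -powRD; last by apply/implyP => _; rewrite pnatr_eq0.
  by congr (_ `^ _); ring.
by rewrite mulrAC ler_wpM2r ?powR_ge0.
Unshelve. all: by end_near. Qed.

End besov_pieces.

(** * Localisation: testing against cutoffs, compact supports, decay *)

Section cutoffs.
Context (R : realType) (n : nat).
Local Notation Rn := 'rV[R]_n.
Local Notation C := R[i].
Local Notation mu := (lebesgue_row R n).

(** Localised complex form of [ae_eq0_smooth]: the factor [beta] provides integrability and confines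
    the conclusion to the points where it does not vanish. *)
Lemma cfundamental (h : Rn -> C) (beta : Rn -> R) :
  cintegrable (fun x => h x * (beta x)%:C) ->
  (forall chi : Rn -> R, smooth chi -> (forall x, 0 <= chi x <= 1) ->
    cintegral setT (fun x => h x * (beta x * chi x)%:C) = 0) ->
  {ae mu, forall x, beta x != 0 -> h x = 0}.
Proof.
move=> [Ir Ii] h0.
have Er x : complex.Re (h x * (beta x)%:C) = complex.Re (h x) * beta x by rewrite cE /= mulr0 subr0.
have Ei x : complex.Im (h x * (beta x)%:C) = complex.Im (h x) * beta x by rewrite cE /= mulr0 add0r.
have r0 : {ae mu, forall x, complex.Re (h x * (beta x)%:C) = 0}.
  apply: ae_eq0_smooth => // chi schi chi01; have := congr1 (@complex.Re R) (h0 chi schi chi01).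
  move=> /= <-; apply: eq_Rintegral => x _.
  by rewrite !cE /= !mulr0 !subr0 mulrA.
have i0 : {ae mu, forall x, complex.Im (h x * (beta x)%:C) = 0}.
  apply: ae_eq0_smooth => // chi schi chi01; have := congr1 (@complex.Im R) (h0 chi schi chi01).
  move=> /= <-; apply: eq_Rintegral => x _.
  by rewrite !cE /= !mulr0 !add0r mulrA.
apply: filterS2 r0 i0 => x; rewrite Er Ei => /eqP; rewrite mulf_eq0 => /orP[/eqP e1|/eqP ->]; last by rewrite eqxx.
move=> /eqP; rewrite mulf_eq0 => /orP[/eqP e2 _|/eqP ->]; last by rewrite eqxx.
exact: cext.
Qed.

Lemma normc_continuous_bounded (f : Rn -> C) (r : R) : csmooth f ->
  exists2 M, 0 <= M & forall x, `|x| <= r -> Normc.normc (f x) <= M.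
Proof.
move=> [fr fi]; have [r0|r0] := ltP r 0.
  by exists 0 => // x /le_lt_trans/(_ r0); rewrite ltNge normr_ge0.
pose K := [set x : Rn | `|x| <= r].
have cK : compact K.
  apply: bounded_closed_compact.
    by exists r; split; [exact: num_real|move=> M rM x /= /le_trans; apply; exact: ltW].
  rewrite (_ : K = (fun x : Rn => `|x|) @^-1` [set t | t <= r])//.
  by apply: closed_comp; [move=> x _; exact: norm_continuous|exact: closed_le].
have K0 : K !=set0 by exists 0; rewrite /K /= normr0.
have bd (g : Rn -> R) : continuous g -> exists M, forall x, K x -> `|g x| <= M.
  move=> cg; have cg' : {within K, continuous (fun x => `|g x|)}.
    by apply: continuous_subspaceT => x; apply: continuous_comp; [exact: cg|exact: norm_continuous].
  have [x0 _ hx0] := EVT_max_rV K0 cK cg'.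
  by exists `|g x0| => x Kx; apply: hx0; rewrite inE.
have [M1 h1] := bd _ (smooth_continuous fr); have [M2 h2] := bd _ (smooth_continuous fi).
exists (`|M1| + `|M2|); first exact: addr_ge0.
move=> x Kx; apply: (le_trans (normc_le _)); apply: lerD.
  exact: le_trans (h1 x Kx) (ler_norm _).
exact: le_trans (h2 x Kx) (ler_norm _).
Qed.

Lemma csmooth_cpartials l (f : Rn -> C) : csmooth f -> csmooth (cpartials l f).
Proof.
elim/last_ind: l f => [|l i IH] f sf; first by rewrite cpartials_nil.
by rewrite cpartials_rcons; apply: IH; exact: csmooth_cD.
Qed.

Lemma compact_sch (f : Rn -> C) (r : R) : 0 <= r -> csmooth f -> (forall x, r < `|x| -> f x = 0) -> sch f.
Proof.
move=> r0 sf f0; apply/schE; split=> // N l.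
have [M M0 hM] := normc_continuous_bounded r (csmooth_cpartials l sf).
exists ((1 + r) ^+ N * M) => x; have [xr|xr] := leP `|x| r.
  apply: ler_pM; rewrite ?exprn_ge0 ?normc_ge0 ?hM//.
  by rewrite lerXn2r ?nnegrE ?addr_ge0// lerD2l.
have oU : open [set x : Rn | r < `|x|].
  rewrite (_ : mkset _ = (fun x : Rn => `|x|) @^-1` [set t | r < t])//.
  by apply: open_comp; [move=> y _; exact: norm_continuous|exact: open_gt].
by rewrite (cpartials_near0 l oU f0 xr) Normc.normc0 mulr0 mulr_ge0// exprn_ge0// addr_ge0.
Qed.

Lemma measurable_normc (f : Rn -> C) : cmeasurable setT f -> measurable_fun setT (fun x => Normc.normc (f x)).
Proof.
move=> [fr fi].
rewrite (_ : (fun x => _) = fun x => Num.sqrt (complex.Re (f x) ^+ 2 + complex.Im (f x) ^+ 2)); last first.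
  by apply/funext => x; case: (f x).
apply: (measurableT_comp (f := @Num.sqrt R)).
  by apply: continuous_measurable_fun; exact: sqrt_continuous.
by apply: measurable_funD; exact: measurable_funX.
Qed.

(** Peetre's inequality [1 + |x| <= (1 + |x - y|) * (1 + |y|)], raised to the power [2 n]. *)
Lemma decay_sub (x y : Rn) : decay (x - y) * decay y <= decay x.
Proof.
rewrite /decay -invfM -exprMn lef_pV2 ?posrE ?exprn_gt0 ?mulr_gt0 ?norm1_gt0//.
rewrite lerXn2r ?nnegrE ?mulr_ge0 ?(ltW (norm1_gt0 _))//.
have : `|x| <= `|x - y| + `|y| by rewrite -[in leLHS](subrK y x) ler_normD.
have := normr_ge0 (x - y); have := normr_ge0 y; nra.
Qed.

Lemma decay_le1 (x : Rn) : decay x <= 1.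
Proof. by rewrite /decay invf_le1 ?norm1X_gt0// exprn_ege1// norm1_ge1. Qed.

End cutoffs.

(** * Second differences of a dyadic block *)

Section kernel_representation.
Context (R : realType) (n : nat).
Local Notation Rn := 'rV[R]_n.
Local Notation C := R[i].
Local Notation mu := (lebesgue_row R n).
Variables (phi : nat -> Rn -> C) (hphi : dyadic_partition phi).
Variables (p : R) (p1 : 1 <= p) (u : (Rn -> C) -> C) (tu : tempered u).
Variables (g : nat -> Rn -> C) (nu : nat -> R) (hg : pieces phi p u g nu).

Let K := inv_cst (bump phi).

Lemma K_neq0 : K != 0.
Proof. exact: (inv_cst_neq0 (sch_psum hphi 2) (bump0 hphi)). Qed.

(* Equal to 1 on the support of [phi j]. *)
Definition lowpass j (xi : Rn) : C := bump phi ((2 ^+ j)^-1 *: xi + 0).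

Lemma sch_lowpass j : sch (lowpass j).
Proof. by apply: sch_scale; [rewrite invr_eq0 expf_neq0|exact: sch_psum]. Qed.

(** [lowpass j] is 1 on the support of [phi j], so inserting it changes nothing; [K] appears because
    the inner Fourier transform is undone only up to that constant. *)
Lemma block_lowpass j psi : sch psi ->
  K * dyadic_block phi j u psi =
  dyadic_block phi j u (fourier (fun xi => lowpass j xi * inv_fourier psi xi)).
Proof.
move=> Sp; have Si := sch_inv_fourier Sp.
have Sw : sch (fun xi => lowpass j xi * inv_fourier psi xi).
  by apply: schM => //; exact: sch_lowpass.
have Spi : sch (fun xi => phi j xi * inv_fourier psi xi) by apply: schM => //; exact: sch_phi.
rewrite /dyadic_block /distr_inv_fourier /distr_mul /distr_fourier.
rewrite -(temperedZ hphi tu K (sch_fourier Spi)).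
congr u; apply/funext => x; rewrite -(fourierZ _ _ Spi).
congr (fourier _ x); apply/funext => xi.
rewrite (inv_fourier_inversion (sch_psum hphi 2) (bump0 hphi) xi Sw) -/K.
by rewrite -{1}(phi_bump hphi j xi) /lowpass; ring.
Qed.

Lemma g_measurable j : cmeasurable setT (g j). Proof. by case: hg. Qed.

Definition gp j x : R := Normc.normc (g j x) `^ p.

Lemma gp_ge0 j x : 0 <= gp j x. Proof. exact: powR_ge0. Qed.

Lemma measurable_gp j : measurable_fun setT (gp j).
Proof.
apply: (measurableT_comp (f := fun t : R => t `^ p)); first exact: measurable_powR.
by apply: measurable_normc; exact: g_measurable.
Qed.

Lemma integrable_gp j : mu.-integrable setT (EFin \o gp j).
Proof.
apply/integrableP; split; first by apply/measurable_EFinP; exact: measurable_gp.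
under eq_integral do rewrite /= ger0_norm ?gp_ge0//.
by case: hg => _ _ _ /(_ j) h _; apply: (le_lt_trans h); rewrite ltry.
Qed.

(** A substitute for Hölder's inequality: where [|g| > lam], one has
    [|g| = |g| ^ (1 - p) * |g| ^ p], and the first factor is at most [lam ^ (1 - p)] since [p >= 1].
    The parameter [lam] will be 1 for integrability, [rate ^+ j] for local summability, and adapted
    to the threshold in [weak_low]. *)
Lemma normc_gp (lam : R) j x : 0 < lam ->
  Normc.normc (g j x) <= lam + lam `^ (1 - p) * gp j x.
Proof.
move=> l0; have [h|h] := leP (Normc.normc (g j x)) lam.
  by rewrite (le_trans h)// lerDl mulr_ge0 ?powR_ge0.
have g0 : 0 < Normc.normc (g j x) by exact: lt_trans h.
have gE : Normc.normc (g j x) = Normc.normc (g j x) `^ (1 - p) * gp j x.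
  by rewrite /gp -powRD ?subrK ?powRr1 ?normc_ge0// gt_eqF ?implybT.
apply: (@le_trans _ _ (lam `^ (1 - p) * gp j x)); last by rewrite lerDr ltW.
rewrite [X in X <= _]gE; apply: ler_wpM2r; first exact: gp_ge0.
rewrite -opprB !powRN lef_pV2 ?posrE ?powR_gt0//.
by rewrite ge0_ler_powR ?nnegrE ?subr_ge0// ltW.
Qed.

Definition gN j : R := \int[mu]_x gp j x.

Lemma gN_ge0 j : 0 <= gN j.
Proof. by apply: Rintegral_ge0 => x _; exact: gp_ge0. Qed.

Lemma gN_le j : gN j <= 2 ^- j * nu j.
Proof.
rewrite -lee_fin /gN /Rintegral fineK; first by case: hg => _ _ _ /(_ j).
exact: integrable_fin_num (integrable_gp j).
Qed.

(** Two factors, because in [blockrep_psi] one is consumed by [decay_sub] while the other keeps the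
    bound integrable in [y]. *)
Lemma sch_decay2 (f : Rn -> C) : sch f -> exists2 B, 0 <= B & forall x, Normc.normc (f x) <= B * decay x * decay x.
Proof.
move=> /schE[_ h]; have [B hB] := h (n * 2 + n * 2)%N [::].
exists `|B| => // x; have := hB x; rewrite cpartials_nil exprD => /le_trans/(_ (ler_norm B)).
by move=> h1; rewrite /decay -!mulrA -invfM ler_pdivlMr ?mulr_gt0 ?norm1X_gt0// mulrC.
Qed.

Lemma sch_decay1 (f : Rn -> C) : sch f -> exists2 B, 0 <= B & forall x, Normc.normc (f x) <= B * decay x.
Proof.
by move=> /sfam_decaying[B B0 hB]; exists B => // x; have := hB tt x; rewrite mulr1.
Qed.

Lemma integrable_gp1_decay j (z : Rn) : mu.-integrable setT (EFin \o (fun x => (1 + gp j x) * decay (x + z))).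
Proof.
have Id := proj1 (row_translate z (integrable_decay R n)).
have md : measurable_fun setT (fun x : Rn => decay (x + z)) by apply/measurable_EFinP; exact: measurable_int Id.
apply: (@integrable_dom _ _ _ (fun x => decay (x + z) + gp j x)).
- apply: measurable_funM => //; apply: measurable_funD => //; exact: measurable_gp.
- by apply: integrableDR => //; exact: integrable_gp.
- move=> x; rewrite ger0_norm ?mulr_ge0 ?addr_ge0 ?gp_ge0 ?(ltW (decay_gt0 _))//.
  by rewrite mulrDl mul1r lerD2l ler_piMr ?gp_ge0// decay_le1.
Qed.

Lemma normc_gp1 j x : Normc.normc (g j x) <= 1 + gp j x.
Proof. by have := normc_gp j x (@ltr01 R); rewrite powR1 mul1r. Qed.

Lemma cintegrable_g_sch j (f : Rn -> C) (z : Rn) : sch f -> cintegrable (fun x => g j x * f (x + z)).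
Proof.
move=> Sf; have [B B0 hB] := sch_decay1 Sf.
have mf : cmeasurable setT (fun x => f (x + z)).
  have := csmooth_measurable (sch_smooth (sch_scale z (oner_neq0 R) Sf)).
  by under eq_fun do rewrite scale1r.
apply: (@cintegrable_dom _ _ _ (fun x => B * ((1 + gp j x) * decay (x + z)))).
- by apply: cmeasurableM => //; exact: g_measurable.
- by apply: integrableZR; exact: integrable_gp1_decay.
- move=> x; rewrite normcM mulrCA ler_pM ?normc_ge0//; exact: normc_gp1.
Qed.

Definition lowker j : Rn -> C := kernel_of (lowpass j).

Lemma sch_lowker j : sch (lowker j).
Proof. by apply: sch_kernel; exact: sch_lowpass. Qed.

(** The block, up to the factor [K], reproduced from itself by a smooth kernel at scale [2 ^- j]:
    differences of [g j] can then be moved onto the kernel. *)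
Definition blockrep j (y : Rn) : C := cintegral setT (fun x => g j x * lowker j (x - y)).

(** The reproducing identity [K * g j = blockrep j] tested against [psi]: [block_lowpass] inserts
    the multiplier, [fourier_mul_inv] turns it into a convolution, and Fubini moves the kernel next
    to [g j]. *)
Lemma blockrep_psi j (psi : Rn -> C) : sch psi ->
  cintegrable (fun y => psi y * blockrep j y) /\
  K * cintegral setT (fun x => g j x * psi x) = cintegral setT (fun y => psi y * blockrep j y).
Proof.
move=> Sp; have [B B0 hB] := sch_decay2 Sp; have [B' B0' hB'] := sch_decay1 (sch_lowker j).
have mxy : measurable_fun setT (fun z : Rn * Rn => z.2 - z.1).
  by apply: measurable_rowD; [exact: measurable_snd|apply: measurable_rowN; exact: measurable_fst].
have [mpr mpi] := csmooth_measurable (sch_smooth Sp).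
have [mkr mki] := csmooth_measurable (sch_smooth (sch_lowker j)).
have [mgr mgi] := g_measurable j.
have a1 := measurableT_comp mpr (@measurable_fst _ _ Rn Rn).
have a2 := measurableT_comp mpi (@measurable_fst _ _ Rn Rn).
have a3 := measurableT_comp mgr (@measurable_snd _ _ Rn Rn).
have a4 := measurableT_comp mgi (@measurable_snd _ _ Rn Rn).
have a5 := measurableT_comp mkr mxy.
have a6 := measurableT_comp mki mxy.
pose F y x := psi y * (g j x * lowker j (x - y)).
have [I1 E1] : cintegrable (fun y => cintegral setT (F y)) /\
  cintegral setT (fun y => cintegral setT (F y)) = cintegral setT (fun x => cintegral setT (fun y => F y x)).
  apply: (@cFubini _ _ F (fun y => B * B' * decay y) (fun x => (1 + gp j x) * decay (x + 0))).
  - rewrite /F; under eq_fun do rewrite !cE.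
    apply: measurable_funB; apply: measurable_funM => //.
      by apply: measurable_funB; exact: measurable_funM.
    by apply: measurable_funD; exact: measurable_funM.
  - rewrite /F; under eq_fun do rewrite !cE.
    apply: measurable_funD; apply: measurable_funM => //.
      by apply: measurable_funD; exact: measurable_funM.
    by apply: measurable_funB; exact: measurable_funM.
  - by move=> y; rewrite !mulr_ge0// ltW// decay_gt0.
  - by move=> x; rewrite mulr_ge0 ?addr_ge0 ?gp_ge0// ltW// decay_gt0.
  - by apply: integrableZR; exact: integrable_decay.
  - exact: integrable_gp1_decay.
  - move=> y x; rewrite /F (normcM (psi y)) (normcM (g j x)) addr0.
    have := hB y; have := hB' (x - y); have := normc_gp1 j x; have := decay_sub x y.
    have := decay_gt0 y; have := decay_gt0 x; have := decay_gt0 (x - y).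
    have := normc_ge0 (psi y); have := normc_ge0 (g j x); have := normc_ge0 (lowker j (x - y)).
    move: (Normc.normc (psi y)) (Normc.normc (g j x)) (Normc.normc _) (gp_ge0 j x) => P G L g0 L0 G0 P0 d1 d2 d3 dd hG hL hP.
    apply: (@le_trans _ _ ((B * decay y * decay y) * ((1 + gp j x) * (B' * decay (x - y))))).
      have GL0 : 0 <= G * L by exact: mulr_ge0.
      exact: (ler_pM P0 GL0 hP (ler_pM G0 L0 hG hL)).
    have -> : B * decay y * decay y * ((1 + gp j x) * (B' * decay (x - y))) =
      (B * B' * decay y * (1 + gp j x)) * (decay (x - y) * decay y) by ring.
    rewrite [leRHS]mulrA; apply: ler_wpM2l => //.
    apply: mulr_ge0; last exact: addr_ge0.
    by apply: mulr_ge0; [exact: mulr_ge0|exact: ltW].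
have FE y : cintegral setT (F y) = psi y * blockrep j y.
  exact: (cintegralZ (psi y) (cintegrable_g_sch j (- y) (sch_lowker j))).
have FE' : (fun y => cintegral setT (F y)) = fun y => psi y * blockrep j y by apply/funext => y; exact: FE.
split; first by rewrite -FE'.
rewrite -FE'; apply: etrans (esym E1).
have [_ _ _ _ hb] := hg.
have SS : sch (fourier (fun xi => lowpass j xi * inv_fourier psi xi)).
  by apply: sch_fourier; apply: schM; [exact: sch_lowpass|exact: sch_inv_fourier].
rewrite -(hb j psi Sp) (block_lowpass j Sp) (hb j _ SS).
congr cintegral; apply/funext => x.
rewrite (fourier_mul_inv x (sch_lowpass j) Sp) /conv -cintegralZ.
  by congr cintegral; apply/funext => y; rewrite /F mulrCA.
have -> : (fun x0 => psi x0 * (fourier_cst R n * fourier (lowpass j) (x - x0))) =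
  fun x0 => psi x0 * (fun y => lowker j (-1 *: y + x)) x0.
  by apply/funext => y; rewrite scaleN1r [- y + x]addrC.
have S1 : sch (fun y => lowker j (-1 *: y + x)).
  by apply: (sch_scale x _ (sch_lowker j)); rewrite oppr_eq0 oner_eq0.
apply: (cintegrableM_bounded Sp); first exact: csmooth_measurable (sch_smooth S1).
by have [M _ hM] := sch_bounded S1; exists M.
Qed.

End kernel_representation.

Section ae_tools.
Context (R : realType) (n : nat).
Local Notation Rn := 'rV[R]_n.
Local Notation C := R[i].
Local Notation mu := (lebesgue_row R n).

Lemma measurable_translate (v : Rn) (A : set Rn) : measurable A -> measurable ((fun x => x + v) @^-1` A).
Proof.
move=> mA; rewrite -[X in measurable X]setTI.
by apply: (measurable_rowD (@measurable_id _ Rn setT) (@measurable_cst _ _ Rn Rn setT v)).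
Qed.

Lemma measure_translate (v : Rn) (A : set Rn) : measurable A -> mu ((fun x => x + v) @^-1` A) = mu A.
Proof.
move=> mA; have := measure_row_affine v (oner_neq0 R) mA.
rewrite normr1 expr1n mul1e => <-; congr (mu _).
by apply/seteqP; split=> x /=; rewrite scale1r.
Qed.

Lemma ae_translate (P : Rn -> Prop) (v : Rn) :
  {ae mu, forall x, P x} -> {ae mu, forall x, P (x + v)}.
Proof.
move=> [A [mA A0 sub]]; exists ((fun x => x + v) @^-1` A); split.
- exact: measurable_translate.
- by rewrite measure_translate.
- by move=> x /= h; exact: sub.
Qed.

End ae_tools.

Section cutoff.
Context (R : realType) (n : nat).
Local Notation Rn := 'rV[R]_n.
Local Notation C := R[i].
Local Notation mu := (lebesgue_row R n).
Variables (phi : nat -> Rn -> C) (hphi : dyadic_partition phi).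

Definition cutoff (c : R) (x0 x : Rn) : R := complex.Re (bump phi (c *: x + - (c *: x0))).

Lemma smooth_cutoff c x0 : smooth (cutoff c x0).
Proof. by have [] := csmooth_affine c (- (c *: x0)) (sch_smooth (sch_psum hphi 2)). Qed.

(** The factor [n] bounds the Euclidean norm, in which [bump] is controlled, by the sup norm. *)
Lemma cutoff_eq1 c x0 x : 0 < c -> n%:R * c * `|x - x0| < 4 -> cutoff c x0 x = 1.
Proof.
move=> c0 h; rewrite /cutoff -scalerBr (bump_eq1 hphi)// enormZ ger0_norm ?ltW//.
apply: le_lt_trans h; rewrite [n%:R * c]mulrC -mulrA; apply: ler_wpM2l; first exact: ltW.
exact: enorm_le_norm.
Qed.

Lemma cutoff_eq0 c x0 x : 0 < c -> 8 <= c * `|x - x0| -> cutoff c x0 x = 0.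
Proof.
move=> c0 h; rewrite /cutoff -scalerBr (bump_eq0 hphi)// enormZ (ger0_norm (ltW c0)).
apply: (le_trans h); apply: ler_wpM2l; first exact: ltW.
exact: norm_le_enorm.
Qed.

Lemma cutoff_bounded : exists2 B, 0 <= B & forall c x0 x, `|cutoff c x0 x| <= B.
Proof.
have [B B0 hB] := sch_bounded (sch_psum hphi 2); exists B => // c x0 x.
by apply: le_trans (hB _); exact: Re_le_normc.
Qed.

Lemma cutoffM_eq0 c x0 (chi : Rn -> R) x : 0 < c -> 8 / c < `|x - x0| ->
  (cutoff c x0 x * chi x)%:C = 0 :> C.
Proof.
by move=> c0 h; rewrite cutoff_eq0 ?mul0r// mulrC -ler_pdivrMr// ltW.
Qed.

Lemma csmooth_cutoffM c x0 (chi : Rn -> R) : smooth chi ->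
  csmooth (fun x => (cutoff c x0 x * chi x)%:C : C).
Proof. by move=> sc; apply: csmooth_real; exact: (smoothM (smooth_cutoff c x0) sc). Qed.

Lemma sch_cutoffM c x0 (chi : Rn -> R) : 0 < c -> smooth chi ->
  sch (fun x => (cutoff c x0 x * chi x)%:C : C).
Proof.
move=> c0 sc; apply: (@compact_sch _ _ _ (8 / c + `|x0|)).
- by rewrite addr_ge0// divr_ge0// ltW.
- exact: csmooth_cutoffM.
- move=> x hx; apply: cutoffM_eq0 => //.
  by have := ler_normB x x0; have := ler_distD x0 x 0; rewrite !subr0; lra.
Qed.

Lemma test_cutoffM c x0 (chi : Rn -> R) (U : set Rn) : 0 < c -> smooth chi ->
  (forall x, `|x - x0| <= 8 / c -> U x) ->
  test_function U (fun x => (cutoff c x0 x * chi x)%:C : C).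
Proof.
move=> c0 sc hU.
pose K := [set x : Rn | `|x - x0| <= 8 / c].
have cK : closed K.
  rewrite (_ : K = closed_ball x0 (8 / c)); first exact: closed_ball_closed.
  by rewrite closed_ballE ?divr_gt0//; apply/seteqP; split=> x; rewrite /K /closed_ball_/= distrC.
have sK : csupp (fun x => (cutoff c x0 x * chi x)%:C : C) `<=` K.
  rewrite (closure_id K).1// /csupp; apply: closure_subset => x /=.
  by apply: contraNP => /negP; rewrite -ltNge => /cutoffM_eq0 ->.
split; [exact: csmooth_cutoffM| |by move=> x /sK /hU].
apply: (subclosed_compact _ _ sK); first exact: closed_closure.
apply: bounded_closed_compact => //.
exists (8 / c + `|x0|); split; [exact: num_real|move=> M hM x /= hx].
by apply: le_trans (ltW hM); have := ler_distD x0 x 0; rewrite !subr0; move: hx; rewrite /K/=; lra.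
Qed.

End cutoff.

(** * Second differences of a Schwartz kernel *)

Section difference_kernel.
Context (R : realType) (n : nat).
Local Notation Rn := 'rV[R]_n.
Local Notation C := R[i].
Local Notation mu := (lebesgue_row R n).

Definition dif (v : Rn) (f : Rn -> C) (y : Rn) : C := f (y + (v + v)) - 2%:C * f (y + v) + f y.

(** The mean value inequality twice: for the first difference [f (y + t *: 'e_i) - f y], then for
    the partial derivative of [f]. *)
Lemma second_difference (f : Rn -> R) (i : 'I_n) (w : Rn) (t M : R) : smooth f -> 0 <= t ->
  (forall s s', 0 <= s <= t -> 0 <= s' <= t ->
    `|'D_('e_i) (fun y => 'D_('e_i) f y) (s' *: 'e_i + (s *: 'e_i + w))| <= M) ->
  `|f (t *: 'e_i + (t *: 'e_i + w)) - 2 * f (t *: 'e_i + w) + f w| <= t * (t * M).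
Proof.
move=> sf t0 hM; have sd := smooth_derive i sf.
have dA y : derivable (fun y => f (1 *: y + t *: 'e_i)) y 'e_i.
  exact: (@smooth_derivable _ _ _ i y (smooth_affine 1 (t *: 'e_i) sf)).
have := @mvt_line _ _ (fun y => f (1 *: y + t *: 'e_i) - f y) w 'e_i t (t * M) t0.
rewrite !scale1r !(addrC _ (t *: 'e_i)) => h.
have -> : f (t *: 'e_i + (t *: 'e_i + w)) - 2 * f (t *: 'e_i + w) + f w =
  f (t *: 'e_i + (t *: 'e_i + w)) - f (t *: 'e_i + w) - (f (t *: 'e_i + w) - f w) by ring.
apply: h => [y|s hs].
  by apply: derivableB; [exact: dA|exact: smooth_derivable].
rewrite (deriveB_row (dA _) (@smooth_derivable _ _ _ i _ sf)).
rewrite (derive_affine (@smooth_derivable _ _ _ i _ sf)) mul1r scale1r [_ + t *: _]addrC.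
apply: (mvt_line (f := fun y => 'D_('e_i) f y) t0) => [y|s' hs'].
  exact: (smooth_derivable sd).
exact: hM.
Qed.

Lemma decay_shift2 (x y : Rn) : `|y| <= 1 -> decay x <= 2 ^+ (n * 2) * decay (x + y) :> R.
Proof.
by move=> y1; rewrite -{1}(addrK y x); apply: decay_shift; rewrite normrN.
Qed.

(** The factor [t ^+ 2] is gained without loss of decay, since shifts of norm at most 1 change
    [decay] by a bounded factor. The sign is negative because shifting [y] by [v] shifts the
    argument [x - y] of a kernel by [- v]. *)
Lemma dif_kernel_bound (k : Rn -> C) : sch k -> exists2 A, 0 < A & forall i t z, 0 <= t <= 1 ->
  Normc.normc (dif (- (t *: 'e_i)) k z) <= A * t ^+ 2 * decay z.
Proof.
move=> Sk.
have /choice[B hB] : forall i : 'I_n, exists B, 0 <= B /\ forall x, Normc.normc (cD i (cD i k) x) <= B * decay x.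
  move=> i; have [B B0 hB] := sch_decay1 (sfam_cD i (sfam_cD i Sk)).
  by exists B.
pose D : R := 2 ^+ (n * 2); have D0 : 0 <= D by rewrite exprn_ge0.
pose BB := \sum_i B i; have BB0 : 0 <= BB by rewrite sumr_ge0// => i _; have [] := hB i.
exists (2 * (BB * (D * (D * (D * (D * 1))))) + 1) => [|i t z /andP[t0 t1]].
  by rewrite ltr_wpDl// !mulr_ge0.
(* The last of the three points, from which [second_difference] steps forward. Two unit shifts
   relate [w] to [z] and two more reach the intermediate points, whence four factors [D]. *)
pose w := z - (t *: 'e_i + t *: 'e_i).
have e1 (s : R) : 0 <= s <= t -> `|s *: 'e_i : Rn| <= 1.
  by move=> /andP[s0 st]; apply: norm_delta_le1; rewrite ger0_norm// (le_trans st).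
have tt' : 0 <= t <= t by rewrite t0 lexx.
have wz : decay w <= D * (D * decay z).
  have h1 : `|t *: 'e_i : Rn| <= 1 by exact: e1.
  apply: (le_trans (decay_shift2 w h1)); apply: ler_wpM2l => //.
  apply: (le_trans (decay_shift2 _ h1)); apply: ler_wpM2l => //.
  by rewrite /w -addrA subrK.
have bd s s' : 0 <= s <= t -> 0 <= s' <= t ->
    Normc.normc (cD i (cD i k) (s' *: 'e_i + (s *: 'e_i + w))) <= BB * (D * (D * (D * (D * decay z)))).
  move=> hs hs'; have [Bi0 hBi] := hB i; apply: le_trans (hBi _) _.
  apply: ler_pM => //; first exact/ltW/decay_gt0.
    by rewrite /BB (bigD1 i)//= lerDl sumr_ge0// => i' _; have [] := hB i'.
  rewrite addrC; apply: le_trans (decay_shift _ (e1 _ hs')) _; apply: ler_wpM2l => //.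
  rewrite addrC; apply: le_trans (decay_shift _ (e1 _ hs)) _; apply: ler_wpM2l => //.
have [kr ki] := sch_smooth Sk.
have r1 := second_difference kr t0 (fun s s' hs hs' => le_trans (Re_le_normc _) (bd s s' hs hs')).
have r2 := second_difference ki t0 (fun s s' hs hs' => le_trans (Im_le_normc _) (bd s s' hs hs')).
have wE : t *: 'e_i + (t *: 'e_i + w) = z by rewrite /w addrA addrC subrK.
have wE1 : t *: 'e_i + w = z + - (t *: 'e_i) by rewrite -wE [RHS]addrC addKr.
have wE2 : w = z + (- (t *: 'e_i) + - (t *: 'e_i)) by rewrite -opprD.
rewrite wE wE1 in r1 r2; rewrite wE2 in r1 r2.
apply: (le_trans (normc_le _)).
have dz := decay_gt0 z.
rewrite /dif !cE /= !mul0r subr0 addr0.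
set X := complex.Re (k (z + (_ + _))) in r1 *; set Y := complex.Im (k (z + (_ + _))) in r2 *.
rewrite [X - _ + _]addrAC [Y - _ + _]addrAC.
have -> : X + complex.Re (k z) - 2 * complex.Re (k (z - t *: 'e_i)) =
   complex.Re (k z) - 2 * complex.Re (k (z - t *: 'e_i)) + X by ring.
have -> : Y + complex.Im (k z) - 2 * complex.Im (k (z - t *: 'e_i)) =
   complex.Im (k z) - 2 * complex.Im (k (z - t *: 'e_i)) + Y by ring.
apply: le_trans (lerD r1 r2) _.
have : 0 <= t ^+ 2 * decay z by rewrite mulr_ge0 ?sqr_ge0// ltW.
nra.
Qed.

End difference_kernel.

(** * Weak-type bounds for the second difference of one block *)

Section weak_estimates.
Context (R : realType) (n : nat).
Local Notation Rn := 'rV[R]_n.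
Local Notation C := R[i].
Local Notation mu := (lebesgue_row R n).
Variables (phi : nat -> Rn -> C) (hphi : dyadic_partition phi).
Variables (p : R) (p1 : 1 <= p) (u : (Rn -> C) -> C) (tu : tempered u).
Variables (g : nat -> Rn -> C) (nu : nat -> R) (hg : pieces phi p u g nu).

Let K := inv_cst (bump phi).
Let mg j : cmeasurable setT (g j) := g_measurable hg j.

(** [blockrep_psi] for products of a cutoff with arbitrary smooth functions gives equality where the
    cutoff is nonzero; the cutoffs of scale [1 / (m + 1)] exhaust the space. *)
Lemma blockrep_ae j : {ae mu, forall y, K * g j y = blockrep phi g j y}.
Proof.
suff H : forall m : nat, {ae mu, forall y, cutoff phi (m.+1%:R^-1) 0 y != 0 -> K * g j y + -1 * blockrep phi g j y = 0}.
  move/ae_foralln: H; apply: filterS => y H.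
  have /archi_boundP : 0 <= n%:R * `|y| by rewrite mulr_ge0.
  set m := Num.bound _ => hm.
  have /eqP : K * g j y + -1 * blockrep phi g j y = 0.
    apply: (H m); rewrite (cutoff_eq1 hphi) ?oner_eq0// ?invr_gt0// subr0.
    rewrite mulrAC ltr_pdivrMr//; apply: lt_le_trans hm _.
    by rewrite -natr1; have : 0 <= m%:R :> R by []; lra.
  by rewrite mulN1r subr_eq0 => /eqP.
move=> m; have c0 : 0 < m.+1%:R^-1 :> R by rewrite invr_gt0.
pose b := cutoff phi m.+1%:R^-1 0.
have main chi : smooth chi ->
    cintegrable (fun x => (K * g j x + -1 * blockrep phi g j x) * (b x * chi x)%:C) /\
    cintegral setT (fun x => (K * g j x + -1 * blockrep phi g j x) * (b x * chi x)%:C) = 0.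
  move=> sc; have Sb := sch_cutoffM hphi 0 c0 sc.
  have [I1 E1] := blockrep_psi hphi p1 tu hg j Sb.
  have I2 := cintegrable_g_sch p1 hg j 0 Sb.
  have E x : (K * g j x + -1 * blockrep phi g j x) * (b x * chi x)%:C =
     K * (g j x * (b (x + 0) * chi (x + 0))%:C) + -1 * ((b x * chi x)%:C * blockrep phi g j x).
    by rewrite addr0; ring.
  split; first by under eq_fun do rewrite E; apply: cintegrableD; exact: cintegrableZ.
  under [in LHS]eq_fun do rewrite E.
  rewrite (cintegralD (cintegrableZ K I2) (cintegrableZ (-1) I1)) (cintegralZ K I2) (cintegralZ (-1) I1).
  rewrite -E1 mulN1r; apply/eqP; rewrite subr_eq0; apply/eqP; congr (_ * _).
  by congr cintegral; apply/funext => x; rewrite addr0.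
apply: (cfundamental (beta := b)) => [|chi sc _].
  have [I _] := main _ (@smooth_cst R n 1).
  by under eq_fun do rewrite -[b _]mulr1.
by have [] := main _ sc.
Qed.

Lemma dif_rep j v : {ae mu, forall y,
  K * dif v (g j) y = cintegral setT (fun x => g j x * dif (- v) (lowker phi j) (x - y))}.
Proof.
have h0 := blockrep_ae j.
apply: filterS3 h0 (ae_translate v h0) (ae_translate (v + v) h0) => y e0 e1 e2.
have I w := cintegrable_g_sch p1 hg j (- w) (sch_lowker hphi j).
have -> : K * dif v (g j) y = K * g j (y + (v + v)) + (- 2%:C * (K * g j (y + v)) + K * g j y).
  by rewrite /dif; ring.
rewrite e0 e1 e2 /blockrep -(cintegralZ (- 2%:C) (I _)).
rewrite -(cintegralD (cintegrableZ _ (I _)) (I _)) -(cintegralD (I _) (cintegrableD (cintegrableZ _ (I _)) (I _))).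
congr cintegral; apply/funext => x.
have a1 : x - y + (- v + - v) = x + - (y + (v + v)) by rewrite -opprD -addrA -opprD.
have a2 : x - y + - v = x + - (y + v) by rewrite -addrA -opprD.
rewrite /dif a1 a2.
move: (lowker _ _ _) (lowker _ _ _) (lowker _ _ _) (g j x) => k1 k2 k3 G; ring.
Qed.

(** Dilate of [decay] to scale [2 ^- j], normalised so that its integral is [I0] for every [j]. *)
Let d j (z : Rn) : R := (2 ^+ j) ^+ n * decay (2 ^+ j *: z).
Let I0 : R := \int[mu]_x decay x.

(** By scaling, step [t] for the kernel at level [j] is step [2 ^+ j * t] for the kernel of [bump];
    so one constant [A] serves all levels. *)
Lemma dif_lowker_bound : exists2 A, 0 < A & forall i t j z, 0 <= 2 ^+ j * t <= 1 ->
  Normc.normc (dif (- (t *: 'e_i)) (lowker phi j) z) <= A * (2 ^+ j * t) ^+ 2 * d j z.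
Proof.
have [A A0 hA] := dif_kernel_bound (sch_kernel (sch_psum hphi 2)); exists A => // i t j z ht.
have j0 : 0 < 2 ^+ j :> R by rewrite exprn_gt0.
have E w : lowker phi j w = ((2 ^+ j) ^+ n)%:C * kernel_of (bump phi) (2 ^+ j *: w).
  exact: (kernel_scale (sch_psum hphi 2) w j0).
have -> : dif (- (t *: 'e_i)) (lowker phi j) z =
   ((2 ^+ j) ^+ n)%:C * dif (- ((2 ^+ j * t) *: 'e_i)) (kernel_of (bump phi)) (2 ^+ j *: z).
  rewrite /dif !E !scalerDr !scalerN !scalerA.
  by move: (kernel_of _ _) (kernel_of _ _) (kernel_of _ _) (_%:C) => k1 k2 k3 c; ring.
have := hA i (2 ^+ j * t) (2 ^+ j *: z) ht.
set D := dif _ _ _ => h.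
rewrite (normcM _ D) normcR ger0_norm ?exprn_ge0 ?(ltW j0)//.
rewrite /d mulrCA; apply: ler_wpM2l => //; by rewrite !exprn_ge0.
Qed.

Lemma I0_gt0 : 0 < I0.
Proof.
apply: (@Rintegral_gt0 _ _ _ 0); last exact: decay_gt0.
- move=> x; pose h (t : R) := ((1 + t) ^+ (n * 2))^-1.
  apply: (@continuous_comp _ _ _ (fun x : Rn => `|x|) h x (@norm_continuous _ _ x)).
  apply: continuousV; first by rewrite gt_eqF// norm1X_gt0.
  apply: (@continuous_comp _ _ _ (fun t : R => 1 + t) (fun t : R => t ^+ (n * 2))); last exact: exprn_continuous.
  by apply: cvgD; [exact: cvg_cst|exact: cvg_id].
- by move=> x; exact/ltW/decay_gt0.
- exact: integrable_decay.
Qed.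

Lemma d_ge0 j z : 0 <= d j z.
Proof. by rewrite mulr_ge0 ?exprn_ge0// ltW// decay_gt0. Qed.

Lemma measurable_decay : measurable_fun setT (@decay R n).
Proof. by apply/measurable_EFinP; exact: measurable_int (integrable_decay R n). Qed.

Lemma measurable_d j : measurable_fun setT (d j).
Proof.
apply: measurable_funM => //; apply: (measurableT_comp measurable_decay).
exact: (measurable_rowZ _ (@measurable_id _ Rn setT)).
Qed.

Lemma integral_d (c : R) (z : Rn) j : `|c| = 1 -> (\int[mu]_x (d j (c *: x + z))%:E = I0%:E)%E.
Proof.
move=> c1; have j0 : 0 < 2 ^+ j :> R by rewrite exprn_gt0.
have c0 : c != 0 by rewrite -normr_gt0 c1.
have -> : I0%:E = (\int[mu]_x (decay x)%:E)%E.
  by rewrite /I0 /Rintegral fineK//; exact: integrable_fin_num (integrable_decay R n).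
have mE : measurable_fun setT (EFin \o @decay R n).
  by apply/measurable_EFinP; exact: measurable_decay.
rewrite -(ge0_integral_affine (c := 2 ^+ j * c) (2 ^+ j *: z) _ mE); last 2 first.
- by rewrite mulf_neq0// gt_eqF.
- by move=> x; rewrite lee_fin ltW// decay_gt0.
have ma : measurable_fun setT (fun x : Rn => (EFin \o @decay R n) ((2 ^+ j * c) *: x + 2 ^+ j *: z)).
  apply: (measurableT_comp mE); apply: measurable_rowD => //; exact: (measurable_rowZ _ (@measurable_id _ Rn setT)).
have a0 (x : Rn) : setT x -> (0 <= (EFin \o @decay R n) ((2 ^+ j * c) *: x + 2 ^+ j *: z)%R)%E.
  by rewrite lee_fin ltW// decay_gt0.
have k0 : (0 <= (`|2 ^+ j * c| ^+ n)%:E :> \bar R)%E by rewrite lee_fin exprn_ge0.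
rewrite -(ge0_integralZl mu measurableT ma a0 k0).
apply: eq_integral => x _; rewrite /= -EFinM /d normrM c1 mulr1 ger0_norm ?exprn_ge0 ?(ltW j0)//.
by rewrite scalerDr scalerA.
Qed.

(** [|g j| ^ p] averaged at scale [2 ^- j]. Its integral is [I0] times that of [|g j| ^ p], so
    Chebyshev's inequality bounds the exceptional set of [weak_low]. *)
Definition smear j (y : Rn) : \bar R := (\int[mu]_x (gp p g j x * d j (x - y))%:E)%E.

Let mF j : measurable_fun [set: Rn * Rn] (fun z : Rn * Rn => (gp p g j z.2 * d j (z.2 - z.1))%:E).
Proof.
apply/measurable_EFinP; apply: measurable_funM.
  by apply: (measurableT_comp (measurable_gp hg j)); exact: measurable_snd.
apply: (measurableT_comp (measurable_d j)).
by apply: measurable_rowD; [exact: measurable_snd|apply: measurable_rowN; exact: measurable_fst].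
Qed.

Let F0 j (z : Rn * Rn) : (0 <= (gp p g j z.2 * d j (z.2 - z.1))%:E)%E.
Proof. by rewrite lee_fin mulr_ge0 ?gp_ge0 ?d_ge0. Qed.

Lemma measurable_smear j : measurable_fun setT (smear j).
Proof. exact: (measurable_fun_fubini_tonelli_F _ (@mF j) (@F0 j)). Qed.

Lemma smear_ge0 j y : (0 <= smear j y)%E.
Proof. by apply: integral_ge0 => x _; exact: (F0 j (y, x)). Qed.

Lemma integral_smear j : (\int[mu]_y smear j y = (gN p g j * I0)%:E)%E.
Proof.
rewrite (fubini_tonelli _ (@mF j) (@F0 j)) /=.
have E x : (\int[mu]_y (gp p g j x * d j (x - y))%:E = (gp p g j x)%:E * I0%:E)%E.
  have md : measurable_fun setT (fun y : Rn => (d j (-1 *: y + x))%:E).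
    apply/measurable_EFinP; apply: (measurableT_comp (measurable_d j)).
    by apply: measurable_rowD => //; exact: (measurable_rowZ _ (@measurable_id _ Rn setT)).
  have d0 (y : Rn) : setT y -> (0 <= (d j (-1 *: y + x))%:E)%E by rewrite lee_fin d_ge0.
  have g0 : (0 <= (gp p g j x)%:E)%E by rewrite lee_fin gp_ge0.
  have := ge0_integralZl mu measurableT md d0 g0.
  rewrite (integral_d x j (normrN1 R)) => <-.
  by apply: eq_integral => y _; rewrite scaleN1r [- y + x]addrC EFinM.
under eq_integral do rewrite E.
rewrite ge0_integralZr//; last 3 first.
- by apply/measurable_EFinP; exact: measurable_gp hg j.
- by move=> x _; rewrite lee_fin gp_ge0.
- by rewrite lee_fin ltW// I0_gt0.
rewrite EFinM; congr (_ * _)%E; rewrite /gN /Rintegral fineK//; exact: integrable_fin_num (integrable_gp hg j).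
Qed.

Lemma chebyshev_row (F : Rn -> \bar R) (a : R) : 0 < a -> measurable_fun setT F ->
  (forall x, (0 <= F x)%E) ->
  measurable [set x | (a%:E <= F x)%E] /\
  (mu [set x | (a%:E <= F x)%E] <= (a^-1)%:E * \int[mu]_x F x)%E.
Proof.
move=> a0 mF' F0'; have mS : measurable [set x | (a%:E <= F x)%E].
  rewrite -[X in measurable X]setTI.
  by have := emeasurable_fun_c_infty measurableT mF' a%:E.
split=> //.
have h : (a%:E * mu [set x | (a%:E <= F x)%E] <= \int[mu]_x F x)%E.
  rewrite -integral_cst//; apply: (@le_trans _ _ (\int[mu]_(x in [set x | (a%:E <= F x)%E]) F x)%E).
    by apply: ge0_le_integral => //; [move=> x _; rewrite lee_fin ltW|exact: measurable_funTS].
  by apply: ge0_subset_integral.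
have aV : (0 <= (a^-1)%:E :> \bar R)%E by rewrite lee_fin invr_ge0 ltW.
have := lee_wpmul2l aV h; rewrite muleA -EFinM mulVf ?gt_eqF// mul1e.
exact.
Qed.

Lemma integrable_d j y : mu.-integrable setT (EFin \o (fun x => d j (x - y))) /\
  \int[mu]_x d j (x - y) = I0.
Proof.
have E : (\int[mu]_x (d j (x - y))%:E = I0%:E)%E.
  rewrite -(integral_d (- y) j (normr1 R)).
  by apply: eq_integral => x _; rewrite scale1r.
split; last by rewrite /Rintegral E.
apply/integrableP; split.
  apply/measurable_EFinP; apply: (measurableT_comp (measurable_d j)).
  exact: (measurable_rowD (@measurable_id _ Rn setT) (@measurable_cst _ _ Rn Rn setT (- y))).
under eq_integral do rewrite /= ger0_norm ?d_ge0//.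
by rewrite E ltry.
Qed.

Lemma integrable_gpd j y (s : R) : (smear j y < s%:E)%E ->
  mu.-integrable setT (EFin \o (fun x => gp p g j x * d j (x - y))) /\
  \int[mu]_x (gp p g j x * d j (x - y)) < s.
Proof.
move=> h; have sf : smear j y \is a fin_num.
  by rewrite ge0_fin_numE ?smear_ge0// (lt_trans h)// ltry.
split; last by rewrite -lte_fin /Rintegral fineK.
apply/integrableP; split.
  apply/measurable_EFinP; apply: measurable_funM; first exact: measurable_gp hg j.
  apply: (measurableT_comp (measurable_d j)).
  exact: (measurable_rowD (@measurable_id _ Rn setT) (@measurable_cst _ _ Rn Rn setT (- y))).
rewrite (_ : (\int[mu]_x _)%E = smear j y) -?ge0_fin_numE ?smear_ge0//.
by apply: eq_integral => x _; rewrite /= ger0_norm// mulr_ge0 ?gp_ge0 ?d_ge0.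
Qed.

Lemma powRV_gt0 (a : R) : 0 < a -> a^-1 `^ p = (a `^ p)^-1.
Proof.
move=> a0; have ap0 : a `^ p != 0 by rewrite gt_eqF// powR_gt0.
apply: (mulfI ap0); rewrite divff// -powRM ?invr_ge0 ?ltW//.
by rewrite divff ?gt_eqF// powR1.
Qed.

(* Split [|g_j| <= lam + lam `^ (1 - p) * |g_j| `^ p]: with [lam] of order
   [c / tau ^+ 2], the first term contributes at most half of [c]. *)
Lemma weak_low : exists2 A, 0 < A & forall i t j c, 0 < t -> 2 ^+ j * t <= 1 -> 0 < c ->
  exists F : set Rn, [/\ measurable F,
    (mu F <= ((A * (2 ^+ j * t) ^+ 2 / c) `^ p * gN p g j)%:E)%E &
    {ae mu, forall y, c <= Normc.normc (dif (t *: 'e_i) (g j) y) -> F y}].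
Proof.
have [A A0 hA] := dif_lowker_bound.
have K0 : 0 < Normc.normc K.
  rewrite lt_neqAle normc_ge0 andbT eq_sym; apply/eqP => /Normc.eq0_normc.
  by apply/eqP; exact: K_neq0 hphi.
have I00 := I0_gt0.
exists (4 * A * I0 / Normc.normc K) => [|i t j c t0 t1 c0].
  by rewrite divr_gt0// !mulr_gt0.
set tau := 2 ^+ j * t in t1 *.
have tau0 : 0 < tau by rewrite mulr_gt0// exprn_gt0.
(* Chosen so that [4 * A * tau ^+ 2 * I0 * lam] is [c] times the modulus of [K]; the 4 is the factor
   2 of [cintegral_dom] times the two terms of the split. Off the exceptional set the second term is
   strictly smaller than the first, so the threshold is not reached. *)
pose lam := c * Normc.normc K / (4 * A * tau ^+ 2 * I0).
have lam0 : 0 < lam by rewrite divr_gt0// !mulr_gt0// exprn_gt0.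
have a0 : 0 < lam `^ p * I0 by rewrite mulr_gt0// powR_gt0.
have [mF1 muF] := chebyshev_row a0 (measurable_smear j) (smear_ge0 j).
exists [set y | ((lam `^ p * I0)%:E <= smear j y)%E]; split=> //.
  apply: (le_trans muF); rewrite integral_smear -EFinM lee_fin.
  have -> : 4 * A * I0 / Normc.normc K * tau ^+ 2 / c = lam^-1.
    by rewrite /lam; field; rewrite !gt_eqF// exprn_gt0.
  rewrite (powRV_gt0 lam0) [gN _ _ _ * _]mulrC mulrA invfM -[_ * _ * I0]mulrA mulVf ?gt_eqF// mulr1.
  exact: lexx.
apply: filterS (dif_rep j (t *: 'e_i)) => y rep cy.
rewrite /= leNgt; apply/negP => sy.
have [Id Ed] := integrable_d j y; have [Ig Eg] := integrable_gpd sy.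
pose G x := A * tau ^+ 2 * (lam * d j (x - y) + lam `^ (1 - p) * (gp p g j x * d j (x - y))).
have IG : mu.-integrable setT (EFin \o G).
  by apply: integrableZR; apply: integrableDR; exact: integrableZR.
have EG : \int[mu]_x G x = A * tau ^+ 2 * (lam * I0 + lam `^ (1 - p) * \int[mu]_x (gp p g j x * d j (x - y))).
  rewrite /G RintegralZl//; last by apply: integrableDR; exact: integrableZR.
  rewrite RintegralD//; [|exact: integrableZR..].
  by rewrite RintegralZl// RintegralZl// Ed.
have mk : cmeasurable setT (fun x => g j x * dif (- (t *: 'e_i)) (lowker phi j) (x - y)).
  apply: cmeasurableM; first exact: mg.
  have sl := sch_smooth (sch_lowker hphi j).
  have sh w : csmooth (fun x => lowker phi j (x + w)).
    by have := csmooth_affine 1 w sl; under eq_fun do rewrite scale1r.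
  apply: csmooth_measurable; rewrite /dif; under eq_fun do rewrite -!addrA.
  have s2 := csmoothM (csmooth_cst n (- 2%:C)) (sh (- y - t *: 'e_i)).
  have := csmoothD (sh (- y + (- (t *: 'e_i) - t *: 'e_i))) (csmoothD s2 (sh (- y))).
  by under eq_fun do rewrite mulNr.
have bnd x : Normc.normc (g j x * dif (- (t *: 'e_i)) (lowker phi j) (x - y)) <= G x.
  have ht : 0 <= 2 ^+ j * t <= 1 by rewrite ltW.
  have h1 := hA i t j (x - y) ht; have h2 := normc_gp p1 g j x lam0.
  rewrite (normcM (g j x)); apply: (le_trans (ler_pM (normc_ge0 _) (normc_ge0 _) h2 h1)).
  by rewrite /G -/tau le_eqVlt; apply/orP; left; apply/eqP; ring.
have := cintegral_dom mk IG bnd; rewrite -rep (normcM K) EG.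
apply/negP; rewrite -ltNge.
have lE : lam `^ (1 - p) * (lam `^ p * I0) = lam * I0.
  by rewrite mulrA -powRD ?subrK ?powRr1 ?(ltW lam0)// gt_eqF ?implybT.
have cK : c * Normc.normc K = 4 * A * tau ^+ 2 * I0 * lam.
  by rewrite /lam; field; rewrite !gt_eqF// exprn_gt0.
have h3 : lam `^ (1 - p) * \int[mu]_x (gp p g j x * d j (x - y)) < lam * I0.
  by rewrite -lE ltr_pM2l// powR_gt0.
apply: (@lt_le_trans _ _ (c * Normc.normc K)); last by rewrite mulrC ler_pM2l.
rewrite cK (_ : 4 * A * tau ^+ 2 * I0 * lam = 2 * (A * tau ^+ 2 * (lam * I0 + lam * I0))); last by ring.
by rewrite !ltr_pM2l ?mulr_gt0 ?exprn_gt0// ltrD2l.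
Qed.

(** The coefficients 1, 2, 1 add up to 4, so a second difference of size [c] needs a value of size
    [c / 4] at one of the three points. For steps longer than the scale of the block, smoothness
    would gain nothing. *)
Lemma weak_high v j c : 0 < c ->
  exists F : set Rn, [/\ measurable F,
    (mu F <= (3 * ((4 / c) `^ p * gN p g j))%:E)%E &
    forall y, c <= Normc.normc (dif v (g j) y) -> F y].
Proof.
move=> c0; have a0 : 0 < (c / 4) `^ p by rewrite powR_gt0// divr_gt0.
have m1 : measurable_fun setT (fun x => (gp p g j x)%:E).
  by apply/measurable_EFinP; exact: measurable_gp hg j.
have [mE muE] := chebyshev_row a0 m1 (fun x => gp_ge0 p g j x).
set E := [set x | _] in mE muE.
have muE' : (mu E <= ((4 / c) `^ p * gN p g j)%:E)%E.
  apply: (le_trans muE); rewrite -(powRV_gt0 (divr_gt0 c0 _)) ?ltr0n// invf_div EFinM.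
  by rewrite /gN /Rintegral fineK//; exact: integrable_fin_num (integrable_gp hg j).
have inE x : c / 4 <= Normc.normc (g j x) -> E x.
  have p0 : 0 <= p by exact: le_trans p1.
  have c4 : 0 <= c / 4 by rewrite divr_ge0// ltW.
  by move=> h; rewrite /E /= lee_fin; exact: (ge0_ler_powR p0 c4 (normc_ge0 _) h).
have mv w := measurable_translate w mE.
have le w : (mu ((fun x => (x + w)%R) @^-1` E) <= ((4 / c) `^ p * gN p g j)%:E)%E.
  by rewrite (measure_translate w mE).
exists ((fun x => x + (v + v)) @^-1` E `|` (fun x => x + v) @^-1` E `|` E); split.
- by apply: measurableU => //; exact: measurableU.
- rewrite (_ : 3 * _ = (4 / c) `^ p * gN p g j + (4 / c) `^ p * gN p g j + (4 / c) `^ p * gN p g j); last by ring.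
  rewrite !EFinD; apply: (le_trans (measureU2 _ _ _)) => //; first exact: measurableU.
  apply: leeD => //; apply: (le_trans (measureU2 _ _ _)) => //.
  exact: (leeD (le (v + v)) (le v)).
- move=> y cy; apply: contrapT => /not_orP[/not_orP[n1 n2] n3].
  have lt4 x : ~ E x -> Normc.normc (g j x) < c / 4.
    by move=> nE; rewrite ltNge; apply/negP => /inE.
  have := lt4 _ n1; have := lt4 _ n2; have := lt4 _ n3; move: cy; rewrite /dif.
  have := normcD (g j (y + (v + v)) - 2%:C * g j (y + v)) (g j y).
  have := normcD (g j (y + (v + v))) (- (2%:C * g j (y + v))).
  rewrite -mulNr (normcM (- 2%:C)) -(rmorphN (real_complex R)) normcR normrN ger0_norm//.
  lra.
Qed.

End weak_estimates.

(** * Local convergence of the dyadic series *)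

Section beppo_levi.
Context (R : realType) (n : nat).
Local Notation Rn := 'rV[R]_n.
Local Notation C := R[i].
Local Notation mu := (lebesgue_row R n).

Lemma Rintegral_sum (a : nat -> Rn -> R) M : (forall j, mu.-integrable setT (EFin \o a j)) ->
  mu.-integrable setT (EFin \o (fun x => \sum_(0 <= j < M) a j x)) /\
  \int[mu]_x (\sum_(0 <= j < M) a j x) = \sum_(0 <= j < M) \int[mu]_x a j x.
Proof.
move=> Ia; elim: M => [|M [IH1 IH2]].
  under [X in _.-integrable _ (EFin \o X)]eq_fun do rewrite big_geq//.
  under eq_Rintegral do rewrite big_geq//.
  by rewrite big_geq// Rintegral_cst// mul0r; split=> //; exact: integrable0.
under [X in _.-integrable _ (EFin \o X)]eq_fun do rewrite big_nat_recr//=.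
under eq_Rintegral do rewrite big_nat_recr//=.
by rewrite RintegralD// IH2 big_nat_recr//=; split=> //; exact: integrableDR.
Qed.

Lemma beppo_levi (a : nat -> Rn -> R) (T : R) :
  (forall j, mu.-integrable setT (EFin \o a j)) ->
  (forall M, \sum_(0 <= j < M) \int[mu]_x `|a j x| <= T) ->
  exists l : Rn -> R, [/\ mu.-integrable setT (EFin \o l),
    {ae mu, forall x, \sum_(0 <= j < M) a j x @[M --> \oo] --> l x} &
    forall chi : Rn -> R, measurable_fun setT chi -> (forall x, `|chi x| <= 1) ->
      \sum_(0 <= j < M) \int[mu]_x (a j x * chi x) @[M --> \oo] --> \int[mu]_x (l x * chi x)].
Proof.
move=> Ia hT.
have ma j : measurable_fun setT (a j) by apply/measurable_EFinP; exact: measurable_int (Ia j).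
have mabs j : measurable_fun setT (fun x => (`|a j x|)%:E).
  by apply/measurable_EFinP; exact: measurableT_comp.
have Iabs j : mu.-integrable setT (EFin \o (fun x => `|a j x|)).
  by apply: (integrable_dom _ (integrable_abse (Ia j))) => // [|x]; [exact: measurableT_comp|rewrite normr_id].
pose G x := (\sum_(k <oo) (`|a k x|)%:E)%E.
have G0 x : (0 <= G x)%E by apply: nneseries_ge0 => k _ _; rewrite lee_fin.
have mG : measurable_fun setT G by exact: ge0_emeasurable_sum.
have Gfin : (\int[mu]_x G x < +oo)%E.
  rewrite integral_nneseries//; apply: (@le_lt_trans _ _ T%:E); last exact: ltry.
  apply: lime_le; first by apply: is_cvg_nneseries => k _ _; apply: integral_ge0 => x _; rewrite lee_fin.
  apply: nearW => M; apply: le_trans (_ : ((\sum_(0 <= j < M) \int[mu]_x `|a j x|)%:E <= _)%E); last by rewrite lee_fin.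
  rewrite -sumEFin; apply: lee_sum => j _.
  by rewrite /Rintegral fineK//; exact: integrable_fin_num (Iabs j).
have IG : mu.-integrable setT G.
  by apply/integrableP; split=> //; under eq_integral do rewrite gee0_abs//.
pose D := [set x | (G x < +oo)%E].
have mD : measurable D.
  by rewrite -[X in measurable X]setTI; exact: emeasurable_fun_infty_o.
have aeD : {ae mu, forall x, D x}.
  by apply: filterS (integrable_ae measurableT IG) => x /(_ I); rewrite /D /= ge0_fin_numE.
pose s M x := (\sum_(0 <= j < M) a j x) * \1_D x.
pose H x := fine (G x) * \1_D x.
have sumle x M : D x -> \sum_(0 <= j < M) `|a j x| <= fine (G x).
  move=> Dx; rewrite -lee_fin fineK ?ge0_fin_numE// -sumEFin.
  by apply: nneseries_lim_ge => k _ _; rewrite lee_fin.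
have sH M x : `|s M x| <= H x.
  rewrite /s /H indicE; have [Dx|nDx] := boolP (x \in D); last by rewrite !mulr0 normr0.
  rewrite !mulr1; apply: (le_trans (ler_norm_sum _ _ _)); apply: sumle.
  by rewrite inE in Dx.
have m1 : measurable_fun setT (\1_D : Rn -> R) by exact: measurable_indic.
have ms M : measurable_fun setT (s M).
  by apply: measurable_funM => //; exact: measurable_sum.
have IH : mu.-integrable setT (EFin \o H).
  apply: (le_integrable _ _ _ IG) => // [|x _].
    apply/measurable_EFinP; apply: measurable_funM => //.
    by apply: measurableT_comp => //; exact: measurable_fine.
  rewrite /= /H indicE; have [Dx|nDx] := boolP (x \in D); last by rewrite /= mulr0 normr0 abse_ge0.
  rewrite /= mulr1 -abse_EFin fineK// ge0_fin_numE//.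
  by rewrite inE in Dx.
have cs x : cvgn (s ^~ x).
  rewrite /s indicE; have [Dx|nDx] := boolP (x \in D); last first.
    by under eq_fun do rewrite mulr0; exact: is_cvg_cst.
  under eq_fun do rewrite mulr1.
  apply: (@normed_cvg R R (fun j => a j x)).
  apply: nondecreasing_is_cvgn.
    by apply: nondecreasing_series => k _ _; exact: normr_ge0.
  exists (fine (G x)) => _ [M _ <-]; apply: sumle.
  by rewrite inE in Dx.
pose l x := limn (s ^~ x).
have cl x : s M x @[M --> \oo] --> l x by exact: cs.
have ml : measurable_fun setT l by apply: (measurable_fun_cvg ms) => x _; exact: cl.
have lH x : `|l x| <= H x.
  apply: (@ler_cvg_to _ \oo _ _ (fun M => `|s M x|) (fun=> H x)).
  - exact: cvg_norm.
  - exact: cvg_cst.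
  - by apply: nearW => M; exact: sH.
exists l; split.
- exact: integrable_dom ml IH lH.
- apply: filterS aeD => x Dx; have := cl x; rewrite /s indicE mem_set//.
  by under eq_fun do rewrite mulr1.
- move=> chi mchi chi1.
  have Iac j : mu.-integrable setT (EFin \o (fun x => a j x * chi x)).
    apply: (integrable_dom _ (Iabs j)) => [|x]; first exact: measurable_funM.
    by rewrite normrM ler_piMr.
  have -> : (fun M => \sum_(0 <= j < M) \int[mu]_x (a j x * chi x)) = fun M => \int[mu]_x (s M x * chi x).
    apply/funext => M; have [I1 <-] := Rintegral_sum M Iac.
    congr fine; apply: ae_eq_integral => //.
    - exact: measurable_int I1.
    - by apply/measurable_EFinP; exact: measurable_funM.
    - apply: filterS aeD => x Dx _; congr EFin.
      by rewrite /s indicE mem_set// mulr1 mulr_suml.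
  apply: (Rintegral_dct (G := H)) => //.
  - by move=> m; exact: measurable_funM.
  - by move=> m x; rewrite normrM -[leRHS]mulr1; apply: ler_pM.
  - by move=> x; apply: cvgM; [exact: cl|exact: cvg_cst].
Qed.

End beppo_levi.

Section local_sum.
Context (R : realType) (n : nat).
Local Notation Rn := 'rV[R]_n.
Local Notation C := R[i].
Local Notation mu := (lebesgue_row R n).
Variables (phi : nat -> Rn -> C) (hphi : dyadic_partition phi).
Variables (p : R) (p1 : 1 <= p) (u : (Rn -> C) -> C) (tu : tempered u).
Variables (g : nat -> Rn -> C) (nu : nat -> R) (hg : pieces phi p u g nu).

Let K := inv_cst (bump phi).

(* [rate ^ p] lies strictly between 1/2 and 1: the thresholds [rate ^ |J - j|] are
   summable, and the loss [rate ^ (- p |J - j|)] is less than [2 ^ |J - j|]. *)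
Definition rate : R := (3 / 4) `^ p^-1.

Lemma rate_gt0 : 0 < rate. Proof. by rewrite powR_gt0// divr_gt0. Qed.

Lemma rateX : rate `^ p = 3 / 4.
Proof. by rewrite /rate -powRrM mulVf ?powRr1 ?divr_ge0// gt_eqF// (lt_le_trans _ p1). Qed.

Lemma rate_lt1 : rate < 1.
Proof.
rewrite ltNge; apply/negP => h; have := rateX; have p0 : 0 <= p by exact: le_trans p1.
have : 1 `^ p <= rate `^ p by apply: ge0_ler_powR => //; rewrite nnegrE ltW// rate_gt0.
by rewrite powR1; lra.
Qed.

Lemma rateXn k : (rate ^+ k) `^ p = (3 / 4) ^+ k.
Proof. by rewrite -!powR_mulrn ?(ltW rate_gt0)// ?divr_ge0// -powRrM mulrC powRrM rateX. Qed.

Lemma geometric_le (r : R) M : 0 <= r -> r < 1 -> \sum_(0 <= j < M) r ^+ j <= (1 - r)^-1.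
Proof.
move=> r0 r1; have r1' : 0 < 1 - r by rewrite subr_gt0.
rewrite -div1r ler_pdivlMr//.
have -> : (\sum_(0 <= j < M) r ^+ j) * (1 - r) = 1 - r ^+ M.
  elim: M => [|M IH]; first by rewrite big_geq// mul0r expr0 subrr.
  by rewrite big_nat_recr//= mulrDl IH exprSr; ring.
by rewrite gerBl exprn_ge0.
Qed.

Lemma nu_bounded : exists2 V, 0 <= V & forall j, nu j <= V.
Proof.
have [_ nu0 cnu _ _] := hg.
have [M [_ hM]] : bounded_fun nu by apply: cvg_seq_bounded; apply/cvg_ex; exists 0.
exists (`|M| + 1); first by rewrite addr_ge0.
by move=> j; apply: le_trans (hM _ _ j I); [exact: ler_norm|rewrite (le_lt_trans (ler_norm M))// ltrDl].
Qed.

(** [normc_gp] with [lam = rate ^+ j]: the first term is geometric in [j], and the second is at most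
    a multiple of [rate ^+ j * (4 / 3) ^+ j * 2 ^- j], hence of [rate ^+ j]. *)
Lemma block_integral_le (b : Rn -> R) (B : R) (a : nat -> Rn -> R) :
  mu.-integrable setT (EFin \o b) -> (forall x, `|b x| <= B) ->
  (forall j, measurable_fun setT (a j)) ->
  (forall j x, `|a j x| <= Normc.normc (g j x) * `|b x|) ->
  (forall j, mu.-integrable setT (EFin \o a j)) /\
  exists T, forall M, \sum_(0 <= j < M) \int[mu]_x `|a j x| <= T.
Proof.
move=> Ib hB ma hab; have [V V0 hV] := nu_bounded.
have B0 : 0 <= B by exact: le_trans (normr_ge0 _) (hB 0).
have Ib' : mu.-integrable setT (EFin \o (fun x => `|b x|)).
  have mb : measurable_fun setT b by apply/measurable_EFinP; exact: measurable_int Ib.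
  by apply: (integrable_dom _ (integrable_abse Ib)) => // [|x]; [exact: measurableT_comp|rewrite normr_id].
have q0 j : 0 < rate ^+ j by rewrite exprn_gt0// rate_gt0.
pose dom j x := rate ^+ j * `|b x| + B * (rate ^+ j) `^ (1 - p) * gp p g j x.
have Id j : mu.-integrable setT (EFin \o dom j).
  by apply: integrableDR; apply: integrableZR => //; exact: integrable_gp hg j.
have adom j x : `|a j x| <= dom j x.
  apply: (le_trans (hab j x)); have h := normc_gp p1 g j x (q0 j).
  apply: (le_trans (ler_wpM2r (normr_ge0 _) h)); rewrite mulrDl lerD2l.
  rewrite (_ : B * _ * _ = (rate ^+ j) `^ (1 - p) * gp p g j x * B); last by ring.
  by apply: ler_wpM2l; [rewrite mulr_ge0 ?powR_ge0 ?gp_ge0|exact: hB].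
split=> [j|]; first exact: integrable_dom (ma j) (Id j) (adom j).
exists ((\int[mu]_x `|b x| + B * V) * (1 - rate)^-1) => M.
apply: le_trans (ler_wpM2l _ (geometric_le M (ltW rate_gt0) rate_lt1)); last first.
  by rewrite addr_ge0// ?mulr_ge0// Rintegral_ge0.
rewrite mulr_sumr; apply: ler_sum => j _.
have Ia : mu.-integrable setT (EFin \o (fun x => `|a j x|)).
  by apply: (integrable_dom _ (Id j)) => [|x]; [exact: measurableT_comp|rewrite normr_id].
apply: (@le_trans _ _ (\int[mu]_x dom j x)); first exact: le_Rintegral.
rewrite RintegralD//; [|by apply: integrableZR => //; exact: integrable_gp hg j..].
rewrite !RintegralZl//; last exact: integrable_gp hg j.
rewrite mulrDl; apply: lerD; first by rewrite mulrC.
have hN := gN_le hg j; rewrite -/(gN p g j).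
have qE : (rate ^+ j) `^ (1 - p) = rate ^+ j * (4 / 3) ^+ j.
  rewrite powRD; last by apply/implyP => _; rewrite gt_eqF.
  rewrite powRr1 ?ltW// powRN rateXn -exprVn; congr (_ * _ ^+ _).
  by rewrite invf_div.
rewrite qE; apply: (@le_trans _ _ (B * (rate ^+ j * (4 / 3) ^+ j) * (2 ^- j * V))).
  have t0 : 0 <= (4 / 3) ^+ j :> R by rewrite exprn_ge0// divr_ge0.
  apply: ler_wpM2l; first by rewrite mulr_ge0// mulr_ge0// ltW.
  apply: (le_trans hN); apply: ler_wpM2l; last exact: hV.
  by rewrite invr_ge0 exprn_ge0.
rewrite (_ : _ * _ = B * V * rate ^+ j * ((4 / 3) ^+ j * 2 ^- j)); last by ring.
rewrite -exprVn -exprMn ler_piMr//; last by rewrite exprn_ile1// ?divr_ge0//; lra.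
by rewrite !mulr_ge0// ltW.
Qed.

(** Multiplied by a cutoff, the partial sums converge a.e. to some integrable [l] by [beppo_levi],
    and as distributions to [K] times [u] by [blocks_cvg]; testing against smooth functions
    identifies the two limits. Real and imaginary parts are handled together through [w]. *)
Lemma local_sum_part (w : C -> R) (f : Rn -> R) (x0 : Rn) (r : R) : 0 < r ->
  w = @complex.Re R \/ w = @complex.Im R ->
  mu.-integrable setT (EFin \o f) ->
  (forall psi, test_function (ball x0 r) psi -> u psi = cintegral setT (fun x => (f x)%:C * psi x)) ->
  {ae mu, forall x, cutoff phi (16 / r) x0 x = 1 ->
    \sum_(0 <= j < M) w (g j x) @[M --> \oo] --> w (K * (f x)%:C)}.
Proof.
move=> r0 hw If hu; pose c := 16 / r; have c0 : 0 < c by rewrite divr_gt0.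
pose b := cutoff phi c x0.
have [B B0 hB] := cutoff_bounded hphi.
have sb : smooth b by exact: smooth_cutoff.
have mb : measurable_fun setT b by exact: continuous_measurable_row (smooth_continuous sb).
have wZ z (t : R) : w (z * t%:C) = w z * t.
  by case: hw => ->; rewrite !cE /= mulr0 ?subr0 ?add0r.
have wle z : `|w z| <= Normc.normc z by case: hw => ->; [exact: Re_le_normc|exact: Im_le_normc].
have wD z z' : w (z + z') = w z + w z' by case: hw => ->; rewrite !cE.
have w0 : w 0 = 0 by case: hw => ->.
have wsum M (F : nat -> C) : w (\sum_(0 <= j < M) F j) = \sum_(0 <= j < M) w (F j).
  elim: M => [|M IH]; first by rewrite !big_geq.
  by rewrite !big_nat_recr//= wD IH.
have mw j : measurable_fun setT (fun x => w (g j x)).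
  by have [h1 h2] := g_measurable hg j; case: hw => ->.
have wint (F : Rn -> C) : w (cintegral setT F) = \int[mu]_x w (F x) by case: hw => ->.
have Ib : mu.-integrable setT (EFin \o b).
  have [+ _] := sch_cintegrable (sch_cutoffM hphi x0 c0 (@smooth_cst R n 1)).
  by under [X in _.-integrable _ (EFin \o X)]eq_fun do rewrite /= mulr1.
pose a j x := w (g j x) * b x.
have ma j : measurable_fun setT (a j) by exact: measurable_funM.
have ale j x : `|a j x| <= Normc.normc (g j x) * `|b x|.
  by rewrite normrM ler_wpM2r.
have [Ia [T hT]] := block_integral_le Ib (hB c x0) ma ale.
have [l [Il al cl]] := beppo_levi Ia hT.
have mf : measurable_fun setT f by apply/measurable_EFinP; exact: measurable_int If.
have Ifb : mu.-integrable setT (EFin \o (fun x => w K * (f x * b x))).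
  apply: integrableZR.
  apply: (@integrable_dom _ _ _ (fun x => B * `|f x|)) => [| |x]; first exact: measurable_funM.
    apply: integrableZR.
    by apply: (integrable_dom _ (integrable_abse If)) => // [|x]; [exact: measurableT_comp|rewrite normr_id].
  by rewrite normrM mulrC; apply: ler_wpM2r => //; exact: hB.
have e0 : {ae mu, forall x, w K * (f x * b x) - l x = 0}.
  apply: ae_eq0_smooth; first exact: integrableBR.
  move=> chi sc chi01; have mc : measurable_fun setT chi by exact: continuous_measurable_row (smooth_continuous sc).
  have chi1 x : `|chi x| <= 1 by rewrite ger0_norm; have /andP[] := chi01 x.
  have Sb := sch_cutoffM hphi x0 c0 sc.
  have tb : test_function (ball x0 r) (fun x => (b x * chi x)%:C : C).
    apply: test_cutoffM => // x; rewrite -ball_normE /ball_/= distrC => /le_lt_trans; apply.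
    rewrite /c invf_div mulrA ltr_pdivrMr//; lra.
  have [BB hBB] := blocks_cvg hphi tu Sb.
  have lim1 : \sum_(0 <= j < M) \int[mu]_x (a j x * chi x) @[M --> \oo] --> w (K * u (fun x => (b x * chi x)%:C)).
    rewrite -cvg_shiftS; apply/cvgrPdist_le => e e_gt0.
    have [N _ hN] : \forall M \near \oo, BB * 2 ^- M < e.
      have : (fun M => BB * 2 ^- M) @ \oo --> BB * 0 by apply: cvgMl_tmp; exact: two_pow_cvg0.
      by rewrite mulr0 => h; apply: cvgr_lt h _ _.
    exists N => // M /= NM; apply: le_trans (ltW (hN M NM)); apply: le_trans (hBB M).
    apply: le_trans (wle _); rewrite wD.
    rewrite [X in _ <= `|_ + X|](_ : _ = - \sum_(0 <= j < M.+1) \int[mu]_x (a j x * chi x))//.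
    have -> : w (- (\sum_(0 <= j < M.+1) dyadic_block phi j u (fun x => (b x * chi x)%:C))) =
       - w (\sum_(0 <= j < M.+1) dyadic_block phi j u (fun x => (b x * chi x)%:C)).
      by case: hw => ->; rewrite !cE.
    rewrite wsum; congr (- _); apply: eq_bigr => j _.
    have [_ _ _ _ hbl] := hg; rewrite (hbl j _ Sb) wint.
    by apply: eq_Rintegral => x _; rewrite wZ mulrA.
  have := cvg_unique (@Rhausdorff R) lim1 (cl chi mc chi1) => E.
  have Il' : mu.-integrable setT (EFin \o (fun x => l x * chi x)).
    apply: (@integrable_dom _ _ _ (fun x => `|l x|)) => [| |x].
    - by apply: measurable_funM => //; apply/measurable_EFinP; exact: measurable_int Il.
    - have ml : measurable_fun setT l by apply/measurable_EFinP; exact: measurable_int Il.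
      by apply: (integrable_dom _ (integrable_abse Il)) => // [|x]; [exact: measurableT_comp|rewrite normr_id].
    - by rewrite normrM ler_piMr.
  have If' : mu.-integrable setT (EFin \o (fun x => w K * (f x * b x) * chi x)).
    apply: (@integrable_dom _ _ _ (fun x => `|w K * (f x * b x)|)) => [| |x].
    - by apply: measurable_funM => //; apply/measurable_EFinP; exact: measurable_int Ifb.
    - have ml : measurable_fun setT (fun x => w K * (f x * b x)) by apply/measurable_EFinP; exact: measurable_int Ifb.
      by apply: (integrable_dom _ (integrable_abse Ifb)) => // [|x]; [exact: measurableT_comp|rewrite normr_id].
    - by rewrite normrM ler_piMr.
  under eq_Rintegral do rewrite mulrBl.
  rewrite RintegralB//; apply/eqP; rewrite subr_eq0; apply/eqP; rewrite -E (hu _ tb).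
  rewrite -cintegralZ; last first.
    split => /=.
      have Ifb1 : mu.-integrable setT (EFin \o (fun x => f x * (b x * chi x))).
        apply: (@integrable_dom _ _ _ (fun x => B * `|f x|)) => [| |x].
        - by apply: measurable_funM => //; exact: measurable_funM.
        - by apply: integrableZR; apply: (integrable_dom _ (integrable_abse If)) => // [|x]; [exact: measurableT_comp|rewrite normr_id].
        - rewrite normrM mulrC; apply: ler_wpM2r => //.
          by rewrite normrM -[leRHS]mulr1; apply: ler_pM => //; exact: hB.
      by apply: eq_integrable Ifb1 => // x _; rewrite /= ?cE /=; congr EFin; ring.
    rewrite (_ : EFin \o _ = cst 0%E); first exact: integrable0.
    by apply/funext => x /=; congr EFin; rewrite ?cE /=; ring.
  rewrite wint; apply: eq_Rintegral => x _.
  by rewrite -rmorphM wZ; ring.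
apply: filterS2 e0 al => x e1 al b1; have := al; rewrite /a /b /c.
rewrite b1; under eq_fun do under eq_bigr do rewrite mulr1.
by move: e1; rewrite /b /c b1 mulr1 => /eqP; rewrite subr_eq0 => /eqP <-; rewrite wZ.
Qed.

End local_sum.

(** * Second differences of a Besov function *)

Section small_oscillation.
Context (R : realType) (n : nat).
Local Notation Rn := 'rV[R]_n.
Local Notation C := R[i].
Local Notation mu := (lebesgue_row R n).

(* [(J - j) + (j - J)] is [|J - j|]: one of the truncated differences is 0. *)
Definition gap (J j : nat) : nat := ((J - j) + (j - J))%N.

Lemma gap_le J j : (j <= J)%N -> (gap J j + j = J)%N.
Proof. by rewrite /gap => h; lia. Qed.

Lemma gap_gt J j : (J < j)%N -> (J + gap J j = j)%N.
Proof. by rewrite /gap => h; lia. Qed.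

Lemma sum_gap_le (r : R) J M : 0 <= r -> r < 1 ->
  \sum_(0 <= j < M) r ^+ gap J j <= 2 / (1 - r).
Proof.
move=> r0 r1; have r1' : 0 < 1 - r by rewrite subr_gt0.
rewrite ler_pdivlMr//.
(* The extra term [- r ^+ J.+1] makes an induction shifting [J] and [M] together possible: it pays
   for the new first summand [r ^+ gap J.+1 0]. *)
suff : (\sum_(0 <= j < M) r ^+ gap J j) * (1 - r) <= 1 + r - r ^+ J.+1.
  by move/le_trans; apply; have : 0 <= r ^+ J.+1 by [rewrite exprn_ge0]; lra.
elim: J M => [|J IH] M.
  rewrite expr1 addrK; have := geometric_le M r0 r1; rewrite -div1r ler_pdivlMr//.
  by under [in X in _ -> X]eq_bigr do rewrite /gap sub0n subn0 add0n.
case: M => [|M].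
  rewrite big_geq// mul0r; have : r ^+ J.+2 <= 1 by rewrite exprn_ile1// ltW.
  lra.
rewrite big_nat_recl//= mulrDl.
under eq_bigr do rewrite /gap !subSS -/(gap J _).
have := IH M; rewrite /gap subn0 sub0n addn0 [r ^+ J.+2]exprSr; lra.
Qed.

(** A null sequence averaged with geometric weights centred at [J]. The indices [j >= N] contribute
    at most [e' * (2 / (1 - r)) = e / 2]; the others, at most [N] in number, have weight at most
    [r ^+ k] because [J >= k + N]. *)
Lemma null_gap_sum (nu : nat -> R) (V r : R) : 0 <= r -> r < 1 ->
  (forall j, 0 <= nu j <= V) -> nu @ \oo --> 0 ->
  forall e, 0 < e -> exists J0, forall J, (J0 <= J)%N -> forall M,
    \sum_(0 <= j < M) r ^+ gap J j * nu j <= e.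
Proof.
move=> r0 r1 hnu cnu e e0; have r1' : 0 < 1 - r by rewrite subr_gt0.
have V0 : 0 <= V by have /andP[h1 h2] := hnu 0%N; exact: le_trans h2.
pose e' := e * (1 - r) / 4; have e'0 : 0 < e' by rewrite divr_gt0// mulr_gt0.
have [N _ hN] : \forall j \near \oo, nu j < e' by apply: cvgr_lt cnu _ _.
have cr : (fun k : nat => V * N%:R * r ^+ k) @ \oo --> V * N%:R * 0.
  by apply: cvgMl_tmp; apply: cvg_expr; rewrite ger0_norm.
have [k _ hk] : \forall k \near \oo, V * N%:R * r ^+ k < e / 2.
  by apply: cvgr_lt cr _ _; rewrite mulr0 divr_gt0.
exists (k + N)%N => J hJ M.
have rk : V * N%:R * r ^+ k <= e / 2 by apply: ltW; apply: hk => /=.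
have bnd j : r ^+ gap J j * nu j <= V * r ^+ k * (j < N)%:R + e' * r ^+ gap J j.
  have /andP[n0 nV] := hnu j; have g0 : 0 <= r ^+ gap J j by rewrite exprn_ge0.
  have [jN|Nj] := ltnP j N.
    rewrite mulr1; apply: ler_wpDr; first by rewrite mulr_ge0 ?(ltW e'0).
    rewrite mulrC; apply: ler_pM => //.
    by rewrite ler_wiXn2l ?(ltW r1)// /gap; lia.
  by rewrite mulr0 add0r mulrC ler_wpM2r// ltW// hN.
apply: (le_trans (ler_sum _ (fun j _ => bnd j))).
rewrite big_split/= -!mulr_sumr.
have hc : \sum_(0 <= j < M) ((j < N)%N%:R : R) <= N%:R.
  rewrite -natr_sum ler_nat; elim: M => [|M IH]; first by rewrite big_geq.
  have : (\sum_(0 <= j < M) (j < N) <= minn M N)%N.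
    elim: M {IH} => [|M IH]; first by rewrite big_geq.
    rewrite big_nat_recr//=; apply: (leq_trans (leq_add IH (leqnn _))).
    by case: ltnP => ?; lia.
  by rewrite big_nat_recr//=; case: ltnP => ?; lia.
have hg := sum_gap_le J M r0 r1.
have h1 := ler_wpM2l (mulr_ge0 V0 (exprn_ge0 k r0)) hc.
have h2 := ler_wpM2l (ltW e'0) hg.
apply: (le_trans (lerD h1 h2)).
have -> : e' * (2 / (1 - r)) = e / 2 by rewrite /e'; field; rewrite gt_eqF.
by rewrite mulrAC; lra.
Qed.

(** Second differences are small in measure at the rate [o(2 ^- J)]. With [t0] fixed, [2 ^ J] steps
    [h] make up exactly [t0 *: 'e_i]. All three points are kept in the ball because [f] is known to
    represent the distribution only near [x0]. *)
Definition osc_null (f : Rn -> R) (x0 : Rn) (rho : R) : Prop :=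
  forall i t0 c e, 0 < t0 -> t0 <= 1 -> 0 < c -> 0 < e ->
  exists J0, forall J, (J0 <= J)%N -> exists F : set Rn,
    [/\ measurable F, (mu F <= (e * 2 ^- J)%:E)%E &
     {ae mu, forall x, let h := (2 ^- J * t0) *: 'e_i in
       ball x0 rho x -> ball x0 rho (x + h) -> ball x0 rho (x + (h + h)) ->
       c < `|f (x + (h + h)) - 2 * f (x + h) + f x| -> F x}].

Variables (phi : nat -> Rn -> C) (hphi : dyadic_partition phi).
Variables (p : R) (p1 : 1 <= p) (u : (Rn -> C) -> C) (tu : tempered u).
Variables (g : nat -> Rn -> C) (nu : nat -> R) (hg : pieces phi p u g nu).

Let K := inv_cst (bump phi).

Lemma local_sum (f : Rn -> R) (x0 : Rn) (r : R) : 0 < r ->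
  mu.-integrable setT (EFin \o f) ->
  (forall psi, test_function (ball x0 r) psi -> u psi = cintegral setT (fun x => (f x)%:C * psi x)) ->
  exists2 rho, 0 < rho & {ae mu, forall x, ball x0 rho x ->
    ccvg (fun M => \sum_(0 <= j < M) g j x) (K * (f x)%:C)}.
Proof.
move=> r0 If hu.
have h1 := local_sum_part hphi p1 tu hg r0 (or_introl erefl) If hu.
have h2 := local_sum_part hphi p1 tu hg r0 (or_intror erefl) If hu.
have n1 : 0 < n%:R + 1 :> R by rewrite ltr_wpDl.
have c0 : 0 < 16 / r by rewrite divr_gt0.
(* On this ball [cutoff_eq1] applies; [n + 1] in place of [n] keeps the denominator positive. *)
exists (4 / ((n%:R + 1) * (16 / r))); first by rewrite divr_gt0// mulr_gt0.
apply: filterS2 h1 h2 => x h1 h2 bx.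
have b1 : cutoff phi (16 / r) x0 x = 1.
  apply: cutoff_eq1 => //; move: bx; rewrite -ball_normE /ball_/= distrC.
  have nr : 0 < (n%:R + 1) * (16 / r) by exact: mulr_gt0.
  rewrite ltr_pdivlMr// => bx; apply: le_lt_trans bx.
  rewrite mulrC; apply: ler_wpM2l => //; apply: ler_wpM2r; first exact: ltW.
  by rewrite lerDl.
have Res M : complex.Re (\sum_(0 <= j < M) g j x) = \sum_(0 <= j < M) complex.Re (g j x).
  elim: M => [|M IH]; first by rewrite !big_geq.
  by rewrite !big_nat_recr//= -IH cE.
have Ims M : complex.Im (\sum_(0 <= j < M) g j x) = \sum_(0 <= j < M) complex.Im (g j x).
  elim: M => [|M IH]; first by rewrite !big_geq.
  by rewrite !big_nat_recr//= -IH cE.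
split; [under eq_fun do rewrite Res; exact: h1|under eq_fun do rewrite Ims; exact: h2].
Qed.

(** Both regimes lead to the ratio [2 / 3]. With [d = gap J j], the case [j <= J] gives
    [4 ^- d * (4 / 3) ^+ d] times [2 ^- j = 2 ^- J * 2 ^+ d], and the case [j > J] gives
    [(4 / 3) ^+ d] times [2 ^- j = 2 ^- J * 2 ^- d]. *)
Lemma weak_at (c : R) : 0 < c -> exists2 A, 0 <= A & forall i t0 J j, 0 < t0 -> t0 <= 1 ->
  exists F : set Rn, [/\ measurable F,
    (mu F <= (A * (2 ^- J * ((2 / 3) ^+ gap J j * nu j)))%:E)%E &
    {ae mu, forall y, c * rate p ^+ gap J j <= Normc.normc (dif ((2 ^- J * t0) *: 'e_i) (g j) y) -> F y}].
Proof.
move=> c0; have [A A0 hA] := weak_low hphi p1 tu hg.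
have p0 : 0 <= p by exact: le_trans p1.
have [_ nu0 _ _ _] := hg.
have q0 d : 0 < rate p ^+ d by rewrite exprn_gt0// rate_gt0.
have qV d : (rate p ^+ d)^-1 `^ p = (4 / 3) ^+ d.
  by rewrite powRV_gt0// rateXn// -exprVn invf_div.
have B1 : 0 <= (A / c) `^ p by exact: powR_ge0.
have B2 : 0 <= 3 * (4 / c) `^ p by rewrite mulr_ge0// powR_ge0.
exists ((A / c) `^ p + 3 * (4 / c) `^ p) => [|i t0 J j t00 t01]; first by rewrite addr_ge0.
set d := gap J j; have cq : 0 < c * rate p ^+ d by rewrite mulr_gt0.
have T0 : 0 <= 2 ^- J * ((2 / 3) ^+ d * nu j) by rewrite !mulr_ge0 ?invr_ge0 ?exprn_ge0// divr_ge0.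
have [jJ|Jj] := leqP j J.
  have t0' : 0 < 2 ^- J * t0 by rewrite mulr_gt0// invr_gt0 exprn_gt0.
  have tE : 2 ^+ j * (2 ^- J * t0) = 2 ^- d * t0.
    have -> : 2 ^+ J = 2 ^+ d * 2 ^+ j :> R by rewrite -exprD gap_le.
    by field; rewrite !expf_neq0.
  have d1 : 2 ^- d * t0 <= 1.
    have a1 : 0 <= 2 ^- d :> R by rewrite invr_ge0 exprn_ge0.
    have a2 : 2 ^- d <= 1 :> R by rewrite invf_le1 ?exprn_gt0// exprn_ege1// ler1n.
    exact: (mulr_ile1 a1 (ltW t00) a2 t01).
  have := hA i (2 ^- J * t0) j _ t0'; rewrite tE => /(_ _ d1 cq)[F [mF muF aeF]].
  exists F; split=> //; apply: (le_trans muF); rewrite lee_fin.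
  apply: (@le_trans _ _ ((A / c) `^ p * (2 ^- J * ((2 / 3) ^+ d * nu j)))); last first.
    by apply: ler_wpM2r => //; rewrite lerDl.
  (* Here [t0] is bounded by 1, the power of the threshold is evaluated by [rateXn], and the [p]-th
     power of [4 ^- d] is bounded by [4 ^- d] because [p >= 1]. *)
  have hp : (A * (2 ^- d * t0) ^+ 2 / (c * rate p ^+ d)) `^ p <= (A / c) `^ p * (4 ^- d * (4 / 3) ^+ d).
    apply: (@le_trans _ _ ((A / c * (4 ^- d * (rate p ^+ d)^-1)) `^ p)).
      apply: ge0_ler_powR => //.
      - by rewrite nnegrE mulr_ge0 ?invr_ge0 ?(ltW cq)// mulr_ge0 ?(ltW A0)// sqr_ge0.
      - by rewrite nnegrE !mulr_ge0 ?invr_ge0 ?exprn_ge0 ?(ltW A0) ?(ltW c0)// ltW// rate_gt0.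
      rewrite (_ : A * _ / _ = A / c * ((2 ^- d * t0) ^+ 2 * (rate p ^+ d)^-1)); last first.
        by field; rewrite !gt_eqF.
      apply: ler_wpM2l; first by rewrite divr_ge0 ?ltW.
      apply: ler_wpM2r; first by rewrite invr_ge0 ltW.
      rewrite exprMn exprVn -exprM mulnC exprM (_ : 2 ^+ 2 = 4 :> R); last by rewrite expr2 -natrM.
      by rewrite ler_piMr ?invr_ge0 ?exprn_ge0// exprn_ile1// ltW.
    have c4 : 0 <= 4 ^- d :> R by rewrite invr_ge0 exprn_ge0.
    have qi : 0 <= (rate p ^+ d)^-1 by rewrite invr_ge0 ltW.
    have Ac0 : 0 <= A / c by rewrite divr_ge0// ltW.
    rewrite (powRM _ Ac0 (mulr_ge0 c4 qi)) (powRM _ c4 qi) qV.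
    apply: ler_wpM2l => //; apply: ler_wpM2r; first by rewrite exprn_ge0// divr_ge0.
    have [->|d0] := posnP d; first by rewrite expr0 invr1 powR1.
    apply: ge1r_powR => //.
    by rewrite invr_gt0 exprn_gt0//= invf_le1 ?exprn_gt0// exprn_ege1// ler1n.
  apply: (@le_trans _ _ ((A / c) `^ p * (4 ^- d * (4 / 3) ^+ d) * (2 ^- j * nu j))).
    apply: ler_pM => //; [exact: powR_ge0|exact: gN_ge0|exact: gN_le hg j].
  rewrite le_eqVlt; apply/orP; left; apply/eqP.
  have -> : 2 ^- j = 2 ^- J * 2 ^+ d :> R.
    have -> : 2 ^+ J = 2 ^+ d * 2 ^+ j :> R by rewrite -exprD gap_le.
    by field; rewrite !expf_neq0.
  rewrite -exprVn (_ : 2 / 3 = 4^-1 * (4 / 3) * 2 :> R); last by lra.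
  by rewrite !exprMn; ring.
have [F [mF muF hF]] := weak_high p1 hg ((2 ^- J * t0) *: 'e_i) j cq.
exists F; split=> //; last by apply: aeW.
apply: (le_trans muF); rewrite lee_fin.
apply: (@le_trans _ _ (3 * (4 / c) `^ p * (2 ^- J * ((2 / 3) ^+ d * nu j)))); last first.
  by apply: ler_wpM2r => //; rewrite lerDr.
have -> : (4 / (c * rate p ^+ d)) `^ p = (4 / c) `^ p * (4 / 3) ^+ d.
  rewrite -qV -powRM ?divr_ge0 ?invr_ge0 ?ltW//; congr (_ `^ _).
  by rewrite invfM mulrA.
apply: (@le_trans _ _ (3 * ((4 / c) `^ p * (4 / 3) ^+ d * (2 ^- j * nu j)))).
  apply: ler_wpM2l => //; apply: ler_wpM2l; last exact: gN_le hg j.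
  by rewrite mulr_ge0 ?powR_ge0// exprn_ge0// divr_ge0.
rewrite le_eqVlt; apply/orP; left; apply/eqP.
have -> : 2 ^- j = 2 ^- J * 2 ^- d :> R.
  have -> : 2 ^+ j = 2 ^+ J * 2 ^+ d :> R by rewrite -exprD gap_gt.
  by rewrite invfM.
rewrite -!exprVn (_ : 2 / 3 = (4 / 3) * 2^-1 :> R); last by lra.
by rewrite !exprMn; ring.
Qed.

(** The exceptional sets of all blocks are united. Off the union, the second differences of the
    blocks are bounded by thresholds geometric in the gap; their sum bounds the limit of the series,
    which is [K] times the second difference of [f]. *)
Lemma small_second_difference (f : Rn -> R) (x0 : Rn) (r : R) : 0 < r ->
  mu.-integrable setT (EFin \o f) ->
  (forall psi, test_function (ball x0 r) psi -> u psi = cintegral setT (fun x => (f x)%:C * psi x)) ->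
  exists2 rho, 0 < rho & osc_null f x0 rho.
Proof.
move=> r0 If hu; have [rho rho0 hrho] := local_sum r0 If hu; exists rho => // i t0 c e t00 t01 c0 e0.
have K0 : 0 < Normc.normc K.
  rewrite lt_neqAle normc_ge0 andbT eq_sym; apply/eqP => /Normc.eq0_normc.
  by apply/eqP; exact: K_neq0 hphi.
have q1 := rate_lt1 p1; have q0 := rate_gt0 p.
(* [S] bounds the sum of the thresholds by [sum_gap_le]. In [c1] below, [c] is halved because real
   and imaginary parts are estimated separately. *)
pose S := 2 / (1 - rate p); have S0 : 0 < S by rewrite divr_gt0// subr_gt0.
pose c1 := Normc.normc K * c / 2; have c10 : 0 < c1 by rewrite divr_gt0// mulr_gt0.
have c10' : 0 < c1 / S by rewrite divr_gt0.
have [A A0 hA] := weak_at c10'.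
have [V V0 hV] := nu_bounded hg; have [_ nu0 cnu _ _] := hg.
have hnu j : 0 <= nu j <= V by rewrite nu0 hV.
have r23 : 0 <= 2 / 3 :> R by rewrite divr_ge0.
have r23' : 2 / 3 < 1 :> R by lra.
have eA : 0 < e / (A + 1) by rewrite divr_gt0// ltr_wpDl.
have [J0 hJ0] := null_gap_sum r23 r23' hnu cnu eA.
exists J0 => J /hJ0 hJ.
have /choice[F hF] := fun j => hA i t0 J j t00 t01.
set h := (2 ^- J * t0) *: 'e_i in hF *.
have mF j : measurable (F j) by have [] := hF j.
exists (\bigcup_j F j); split; first exact: bigcup_measurable.
  have mU : measurable (\bigcup_j F j) by exact: bigcup_measurable.
  have sub : (mu (\bigcup_j F j) <= \sum_(j <oo) mu (F j))%E by exact: measure_sigma_subadditive.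
  apply: (le_trans sub).
  apply: lime_le; first by apply: is_cvg_nneseries.
  apply: nearW => M; apply: (@le_trans _ _ (\sum_(0 <= j < M) (A * (2 ^- J * ((2 / 3) ^+ gap J j * nu j)))%:E)%E).
    by apply: lee_sum => j _; have [] := hF j.
  rewrite sumEFin lee_fin -!mulr_sumr mulrCA mulrC; apply: ler_wpM2r; first by rewrite invr_ge0 exprn_ge0.
  apply: (le_trans (ler_wpM2l A0 (hJ M))).
  rewrite mulrCA ler_piMr ?(ltW e0)// ler_pdivrMr ?ltr_wpDl// mul1r lerDl//.
have aeF : {ae mu, forall y j, c1 / S * rate p ^+ gap J j <= Normc.normc (dif h (g j) y) -> F j y}.
  by apply: ae_foralln => j; have [] := hF j.
have ae3 : {ae mu, forall x, [/\ ball x0 rho x -> ccvg (fun M => \sum_(0 <= j < M) g j x) (K * (f x)%:C),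
    ball x0 rho (x + h) -> ccvg (fun M => \sum_(0 <= j < M) g j (x + h)) (K * (f (x + h))%:C) &
    ball x0 rho (x + (h + h)) -> ccvg (fun M => \sum_(0 <= j < M) g j (x + (h + h))) (K * (f (x + (h + h)))%:C)]}.
  by apply: filterS3 hrho (ae_translate h hrho) (ae_translate (h + h) hrho) => x.
apply: filterS2 aeF ae3 => x hx [l0 l1 l2] b0 b1 b2.
move: {l0 l1 l2}(l0 b0) (l1 b1) (l2 b2) => l0 l1 l2.
set Df := f (x + (h + h)) - 2 * f (x + h) + f x => cD; apply: contrapT => nF.
have small j : Normc.normc (dif h (g j) x) <= c1 / S * rate p ^+ gap J j.
  rewrite leNgt; apply/negP => /ltW /hx Fj; apply: nF; by exists j.
have part (w : C -> R) : w = @complex.Re R \/ w = @complex.Im R -> `|w (K * Df%:C)| <= c1.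
  move=> hw.
  have wle z : `|w z| <= Normc.normc z by case: hw => ->; [exact: Re_le_normc|exact: Im_le_normc].
  have wD z z' : w (z + z') = w z + w z' by case: hw => ->; rewrite !cE.
  have wN z : w (- z) = - w z by case: hw => ->; rewrite !cE.
  have wZ z (t : R) : w (z * t%:C) = w z * t.
    by case: hw => ->; rewrite !cE /= mulr0 ?subr0 ?add0r.
  have w0 : w 0 = 0 by case: hw => ->.
  have wlim z l : ccvg z l -> w (z M) @[M --> \oo] --> w l by case: hw => -> [].
  pose s M := w (\sum_(0 <= j < M) g j (x + (h + h))) - w (\sum_(0 <= j < M) g j (x + h)) * 2
     + w (\sum_(0 <= j < M) g j x).
  have sE M : s M = \sum_(0 <= j < M) w (dif h (g j) x).
    rewrite /s; elim: M => [|M IH]; first by rewrite !big_geq// w0 mul0r subr0 addr0.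
    by rewrite !big_nat_recr//= -IH /dif !wD wN [2%:C * _]mulrC wZ; ring.
  have cs : s M @[M --> \oo] --> w (K * Df%:C).
    have -> : w (K * Df%:C) = w (K * (f (x + (h + h)))%:C) - w (K * (f (x + h))%:C) * 2 + w (K * (f x)%:C).
      by rewrite !wZ /Df; ring.
    by apply: cvgD; [apply: cvgB; [exact: wlim|apply: cvgMr_tmp; exact: wlim]|exact: wlim].
  apply: (@ler_cvg_to _ \oo _ _ (fun M => `|s M|) (fun=> c1)).
  - exact: cvg_norm.
  - exact: cvg_cst.
  - apply: nearW => M; rewrite sE; apply: (le_trans (ler_norm_sum _ _ _)).
    apply: (@le_trans _ _ (\sum_(0 <= j < M) c1 / S * rate p ^+ gap J j)).
      by apply: ler_sum => j _; exact: le_trans (wle _) (small j).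
    rewrite -mulr_sumr; apply: (le_trans (ler_wpM2l (ltW c10') (sum_gap_le J M (ltW q0) q1))).
    by rewrite divfK// gt_eqF.
have := lerD (part _ (or_introl erefl)) (part _ (or_intror erefl)).
have := normc_le (K * Df%:C); rewrite (normcM K) normcR => h1 h2.
have h3 : Normc.normc K * `|Df| <= Normc.normc K * c.
  by apply: le_trans h1 (le_trans h2 _); rewrite /c1 -splitr.
by move: h3; rewrite ler_pM2l// leNgt cD.
Qed.

End small_oscillation.

(** * Integer-valued functions *)

Section integer_step.
Context (R : realType) (n : nat).
Local Notation Rn := 'rV[R]_n.
Local Notation mu := (lebesgue_row R n).

Lemma osc_null_le (f : Rn -> R) x0 (rho rho' : R) : rho' <= rho -> osc_null f x0 rho -> osc_null f x0 rho'.
Proof.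
move=> hr hf i t0 c e t00 t01 c0 e0; have [J0 hJ] := hf i t0 c e t00 t01 c0 e0.
exists J0 => J /hJ[F [mF muF aeF]]; exists F; split=> //.
by apply: filterS aeF => x h b0 b1 b2; apply: h; apply: le_ball; eauto.
Qed.

Lemma osc_null0 x0 (rho : R) : osc_null (fun _ : Rn => 0) x0 rho.
Proof.
move=> i t0 c e t00 t01 c0 e0; exists 0%N => J _; exists set0; split=> //.
  by rewrite measure0 lee_fin mulr_ge0 ?invr_ge0 ?exprn_ge0// ltW.
apply: aeW => x _ _ _ /=; rewrite mulr0 subr0 addr0 normr0 => /(lt_trans c0).
by rewrite ltxx.
Qed.

Lemma osc_nullD (f1 f2 : Rn -> R) x0 (rho : R) : osc_null f1 x0 rho -> osc_null f2 x0 rho ->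
  osc_null (fun x => f1 x + f2 x) x0 rho.
Proof.
move=> h1 h2 i t0 c e t00 t01 c0 e0.
have c2 : 0 < c / 2 by rewrite divr_gt0.
have e2 : 0 < e / 2 by rewrite divr_gt0.
have [J1 hJ1] := h1 i t0 _ _ t00 t01 c2 e2; have [J2 hJ2] := h2 i t0 _ _ t00 t01 c2 e2.
exists (maxn J1 J2) => J; rewrite geq_max => /andP[/hJ1[F1 [m1 mu1 a1]] /hJ2[F2 [m2 mu2 a2]]].
exists (F1 `|` F2); split; first exact: measurableU.
  apply: (le_trans (measureU2 _ m1 m2)); apply: (le_trans (leeD mu1 mu2)).
  by rewrite -EFinD lee_fin -mulrDl -splitr.
apply: filterS2 a1 a2 => x + + b0 b1 b2 => /(_ b0 b1 b2) k1 /(_ b0 b1 b2) k2.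
set h := _ *: _ in k1 k2 * => hc.
have [/k1|l1] := ltP (c / 2) `|f1 (x + (h + h)) - 2 * f1 (x + h) + f1 x|; first by left.
have [/k2|l2] := ltP (c / 2) `|f2 (x + (h + h)) - 2 * f2 (x + h) + f2 x|; first by right.
exfalso; move: hc; apply/negP; rewrite -leNgt.
have -> : f1 (x + (h + h)) + f2 (x + (h + h)) - 2 * (f1 (x + h) + f2 (x + h)) + (f1 x + f2 x) =
  (f1 (x + (h + h)) - 2 * f1 (x + h) + f1 x) + (f2 (x + (h + h)) - 2 * f2 (x + h) + f2 x) by ring.
by apply: (le_trans (ler_normD _ _)); rewrite [leRHS](splitr c) lerD.
Qed.

Lemma osc_null_sum k (f : 'I_k -> Rn -> R) x0 :
  (forall j, exists2 rho, 0 < rho & osc_null (f j) x0 rho) ->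
  exists2 rho, 0 < rho & osc_null (fun x => \sum_(j < k) f j x) x0 rho.
Proof.
elim: k f => [|k IH] f hf.
  by exists 1 => //; under eq_fun do rewrite big_ord0; exact: osc_null0.
have [r1 r10 h1] := IH _ (fun j => hf (widen_ord (leqnSn k) j)); have [r2 r20 h2] := hf ord_max.
exists (Num.min r1 r2); first by rewrite lt_min r10.
under eq_fun do rewrite big_ord_recr/=.
by apply: osc_nullD; [apply: osc_null_le h1|apply: osc_null_le h2]; rewrite ge_min lexx ?orbT.
Qed.

(** [E] may fail to be measurable; up to a null set it lies in an intersection of measurable sets of
    arbitrarily small measure. *)
Lemma ae_not_small (E : set Rn) :
  (forall e : R, 0 < e -> exists F : set Rn, [/\ measurable F, (mu F <= e%:E)%E & {ae mu, forall x, E x -> F x}]) ->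
  {ae mu, forall x, ~ E x}.
Proof.
move=> h; have e0 (m : nat) : 0 < m.+1%:R^-1 :> R by rewrite invr_gt0.
have /choice[F hF] := fun m => h _ (e0 m).
have mF m : measurable (F m) by have [] := hF m.
have mI : measurable (\bigcap_m F m) by exact: bigcap_measurable.
have I0 : mu (\bigcap_m F m) = 0%E.
  apply/eqP; rewrite eq_le measure_ge0 andbT; apply/lee_addgt0Pr => e eg0; rewrite add0e.
  have [m hm] : exists m : nat, m.+1%:R^-1 < e.
    have /archi_boundP : 0 <= e^-1 by rewrite invr_ge0 ltW.
    set m := Num.bound _ => hm; exists m; rewrite invf_plt ?posrE//.
    by rewrite (lt_trans hm)// ltr_nat.
  apply: (@le_trans _ _ (mu (F m))).
    by apply: le_measure; rewrite ?inE//; exact: bigcap_inf.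
  by have [_ h1 _] := hF m; apply: (le_trans h1); rewrite lee_fin ltW.
have aeF : {ae mu, forall x m, E x -> F m x} by apply: ae_foralln => m; have [] := hF m.
have aeI : {ae mu, forall x, ~ (\bigcap_m F m) x}.
  by exists (\bigcap_m F m); split=> // x /= /contrapT.
by apply: filterS2 aeF aeI => x hx nI Ex; apply: nI => m _; exact: hx.
Qed.

Lemma arith_progression (a : nat -> R) L :
  (forall m, (m.+2 <= L)%N -> a m.+2 - 2 * a m.+1 + a m = 0) ->
  forall m, (m <= L)%N -> a m = a 0%N + m%:R * (a 1%N - a 0%N).
Proof.
move=> h; pose P m := a m = a 0%N + m%:R * (a 1%N - a 0%N).
have H m : (m.+1 <= L)%N -> P m /\ P m.+1.
  elim: m => [_|m IH mL]; first by split; rewrite /P ?mul0r ?addr0// mul1r; ring.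
  have [e1 e2] := IH (ltnW mL); split=> //; have e3 := h m mL.
  rewrite /P in e1 e2 *; have -> : a m.+2 = 2 * a m.+1 - a m by lra.
  by rewrite e1 e2 -!natr1; ring.
case=> [_|m mL]; [by rewrite mul0r addr0|exact: (H m mL).2].
Qed.

Lemma int_lt1 (a : R) : a \is a Num.int -> `|a| < 1 -> a = 0.
Proof.
by move=> /intrP[m ->]; rewrite -intr_norm ltrz1 -[X in (_ < X)%R]/(1%:Z) => h; have -> : m = 0 by lia.
Qed.

Lemma int_step (f : Rn -> R) (x0 : Rn) (rho t : R) i : 0 < t -> t <= 1 -> t <= rho / 2 ->
  {ae mu, forall x, ball x0 rho x -> f x \is a Num.int} -> osc_null f x0 rho ->
  {ae mu, forall x, ball x0 (rho / 2) x -> f (x + t *: 'e_i) = f x}.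
Proof.
move=> t0 t1 tr fint fo.
(* Bounding the jump by [2 ^+ N] gives a set that does not depend on [J]: once [J >= N], no nonzero
   multiple of [2 ^+ J] is in range. Every jump is finite, so the sets [E N] exhaust the bad
   points. *)
pose E N := [set x : Rn | [/\ ball x0 (rho / 2) x, f (x + t *: 'e_i) != f x & `|f (x + t *: 'e_i) - f x| < 2 ^+ N]].
suff H N : {ae mu, forall x, ~ E N x}.
  have : {ae mu, forall x N, ~ E N x} by exact: ae_foralln.
  apply: filterS => x hx bx; apply/eqP/negP => /negP fne.
  have /archi_boundP := normr_ge0 (f (x + t *: 'e_i) - f x).
  set N := Num.bound _ => hN; apply: (hx N); split=> //.
  apply: (lt_le_trans hN); rewrite -natrX ler_nat; exact/ltnW/ltn_expl.
apply: ae_not_small => e e0.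
(* A threshold below 1: an integer of absolute value at most [1 / 2] is 0. *)
have h12 : 0 < 2^-1 :> R by rewrite invr_gt0.
have [J0 hJ0] := fo i t 2^-1 e t0 t1 h12 e0.
pose J := maxn J0 N; have [F [mF muF aeF]] := hJ0 J (leq_maxl _ _).
set h := (2 ^- J * t) *: 'e_i in aeF.
have J20 : 0 < 2 ^+ J :> R by rewrite exprn_gt0.
(* One translate of [F] for each of the [2 ^ J] positions along the progression; their total measure
   is at most [2 ^ J * (e * 2 ^- J) = e]. *)
exists (\big[setU/set0]_(m < 2 ^ J) ((fun x => x + m%:R *: h) @^-1` F)); split.
- by apply: bigsetU_measurable => m _; exact: measurable_translate.
- have mT (m : nat) : measurable ((fun x => x + m%:R *: h) @^-1` F) by exact: measurable_translate.
  apply: (le_trans (Boole_inequality mu (fun m (_ : (m < 2 ^ J)%N) => mT m))).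
  apply: (@le_trans _ _ (\sum_(m < 2 ^ J) (e * 2 ^- J)%:E)%E).
    by apply: lee_sum => m _; have := muF; rewrite -(measure_translate (m%:R *: h) mF).
  rewrite sumEFin sumr_const card_ord lee_fin -[_ *+ (2 ^ J)%N]mulr_natr natrX -mulrA mulVf ?mulr1//.
have a1 : {ae mu, forall x (m : nat), ball x0 rho (x + m%:R *: h) -> f (x + m%:R *: h) \is a Num.int}.
  by apply: ae_foralln => m; exact: (ae_translate (m%:R *: h) fint).
have a2 := ae_foralln (fun m : nat => ae_translate (m%:R *: h) aeF).
apply: filterS2 a1 a2 => x i1 i2 [bx fne flt]; apply: contrapT => nG.
have nG' m : (m < 2 ^ J)%N -> ~ F (x + m%:R *: h).
  move=> mJ Fx; apply: nG.
  have := @bigcup_mkord Rn (2 ^ J) (fun m => (fun x => x + m%:R *: h) @^-1` F) => <-.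
  by exists m.
(* The progression has length at most [t <= rho / 2] and starts in the half ball. *)
have inb m : (m <= 2 ^ J)%N -> ball x0 rho (x + m%:R *: h).
  move=> mJ; move: bx; rewrite -!ball_normE /ball_/= => bx.
  rewrite opprD addrA; apply: (le_lt_trans (ler_normB _ _)).
  rewrite [rho]splitr; apply: ltr_leD => //; apply: le_trans tr.
  have e1 : `|'e_i : Rn| <= 1 by rewrite -[X in `|X|]scale1r; apply: norm_delta_le1; rewrite normr1.
  have mJ' : m%:R * 2 ^- J <= 1 :> R by rewrite ler_pdivrMr// mul1r -natrX ler_nat.
  have m0 : 0 <= m%:R * 2 ^- J :> R by rewrite divr_ge0// ltW.
  rewrite /h scalerA mulrA normrZ ger0_norm ?mulr_ge0// ?(ltW t0)//.
  have h1 : m%:R * 2 ^- J * t <= t by rewrite ler_piMl// ltW.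
  apply: le_trans h1; apply: ler_piMr => //.
  by apply: mulr_ge0 => //; exact: ltW.
have step m : x + m%:R *: h + h = x + m.+1%:R *: h.
  by rewrite -natr1 scalerDl scale1r addrA.
have prog m : (m.+2 <= 2 ^ J)%N ->
    f (x + m.+2%:R *: h) - 2 * f (x + m.+1%:R *: h) + f (x + m%:R *: h) = 0.
  move=> mJ; have m0 := inb m (leq_trans (leqnSn _) (ltnW mJ)).
  have m1 := inb m.+1 (ltnW mJ); have m2 := inb m.+2 mJ.
  have := i2 m; rewrite /= addrA !step => /(_ m0 m1 m2) hF.
  apply: int_lt1.
    by rewrite rpredD ?i1// rpredB ?i1// rpredM ?i1// rpred_nat.
  apply: (@le_lt_trans _ _ 2^-1); last by lra.
  by rewrite leNgt; apply/negP => /hF; apply: nG'; exact: ltnW mJ.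
have := arith_progression (a := fun m => f (x + m%:R *: h)) prog (leqnn (2 ^ J)).
have -> : x + (2 ^ J)%:R *: h = x + t *: 'e_i.
  by rewrite /h scalerA natrX mulrA divff ?mul1r// gt_eqF.
rewrite scale0r addr0 => E1.
set b := f (x + 1%:R *: h) - f x in E1.
have bint : b \is a Num.int.
  have := i1 0%N; rewrite scale0r addr0 => k0; rewrite rpredB//.
    by apply: i1; apply: inb; rewrite expn_gt0.
  by apply: k0; have := inb 0%N (leq0n _); rewrite scale0r addr0.
have bn0 : b != 0.
  by apply: contra fne => /eqP b0; rewrite E1 b0 mulr0 addr0.
move: flt; rewrite E1 addrC addKr normrM natrX ger0_norm ?ltW//.
apply/negP; rewrite -leNgt.
have b1 : 1 <= `|b| by rewrite leNgt; apply: contra bn0 => /(int_lt1 bint) ->.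
apply: (@le_trans _ _ (2 ^+ J)); last by rewrite ler_peMr// ltW.
by rewrite ler_weXn2l// ?ler1n// leq_maxr.
Qed.

(** One coordinate at a time: [P k] keeps the first [k] coordinates of [h]. The intermediate points
    stay within [rho / 4] of [x], hence in the half ball where [int_step] applies. *)
Lemma translations (f : Rn -> R) (x0 h : Rn) (rho : R) : 0 < rho -> rho <= 1 ->
  {ae mu, forall x, ball x0 rho x -> f x \is a Num.int} -> osc_null f x0 rho ->
  (forall i, 0 < h 0 i < rho / 4) ->
  {ae mu, forall x, ball x0 (rho / 4) x -> f (x + h) = f x}.
Proof.
move=> rho0 rho1 fint fo hh.
pose P k : Rn := \row_i (if (i < k)%N then h 0 i else 0).
have Pn k : `|P k| <= rho / 4.
  rewrite row_norm_le; last by rewrite divr_ge0// ltW.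
  apply/forallP => i; rewrite mxE; have /andP[h0 h1] := hh i; case: ifP => _.
    by rewrite ger0_norm ltW.
  by rewrite normr0 divr_ge0// ltW.
suff H k : (k <= n)%N -> {ae mu, forall x, ball x0 (rho / 4) x -> f (x + P k) = f x}.
  have -> : h = P n by apply/rowP => i; rewrite mxE ltn_ord.
  exact: H.
elim: k => [_|k IH kn].
  have -> : P 0%N = 0 by apply/rowP => i; rewrite !mxE.
  by apply: aeW => x _; rewrite addr0.
pose i := Ordinal kn; have /andP[h0 h1] := hh i.
have PS : P k.+1 = P k + h 0 i *: 'e_i.
  apply/rowP => j; rewrite !mxE eqxx /= ltnS leq_eqVlt.
  have -> : (j == i) = (j == k :> nat) by [].
  by case: eqVneq => [jk|_]; rewrite ?jk ?ltnn ?mulr1 ?add0r ?mulr0 ?addr0//; congr (h 0 _); apply: val_inj.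
have h2 : h 0 i <= rho / 2 by lra.
have h3 : h 0 i <= 1 by lra.
have a1 := IH (ltnW kn).
have a2 := ae_translate (P k) (int_step i h0 h3 h2 fint fo).
apply: filterS2 a1 a2 => x e1 e2 bx.
rewrite PS addrA e2 ?e1//.
move: bx; rewrite -!ball_normE /ball_/= => bx; rewrite opprD addrA.
apply: (le_lt_trans (ler_normB _ _)); have := Pn k; lra.
Qed.

Lemma ae_exists (P : Rn -> Prop) (x0 : Rn) (r : R) : 0 < r -> {ae mu, forall x, P x} ->
  exists2 x, ball x0 r x & P x.
Proof.
move=> r0 [A [mA A0 sub]]; apply: contrapT => nex.
have bA : ball x0 r `<=` A.
  by move=> x bx; apply: sub => /= Px; apply: nex; exists x.
have mb : measurable (ball x0 r) by apply: open_measurable_row; exact: ball_open.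
have : (mu (ball x0 r) <= mu A)%E by apply: le_measure; rewrite ?inE.
by rewrite A0 row_ball_measure// lee_fin leNgt exprn_gt0// mulr_gt0.
Qed.

(** By Tonelli, for almost every base point [x] in the ball, [f (x + h) = f x] holds for almost
    every admissible [h]. A single such [x] from which a whole neighbourhood of [x0] is reached
    provides the constant [f x]. *)
Lemma const_of_translations (f : Rn -> R) (x0 : Rn) (s : R) : 0 < s -> measurable_fun setT f ->
  (forall h : Rn, (forall i, 0 < h 0 i < s) -> {ae mu, forall x, ball x0 s x -> f (x + h) = f x}) ->
  exists c, {ae mu, forall x, ball x0 (s / 4) x -> f x = c}.
Proof.
move=> s0 mf hf.
pose Q := [set h : Rn | forall i, 0 < h 0 i < s].
pose A := [set z : Rn * Rn | [/\ Q z.1, ball x0 s z.2 & f (z.2 + z.1) != f z.2]].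
have mQ : measurable Q.
  rewrite (_ : Q = \bigcap_(i : 'I_n) ((fun x : Rn => x 0 i) @^-1` `]0, s[)).
    apply: fin_bigcap_measurable => // i _; rewrite -[X in measurable X]setTI.
    by apply: measurable_coord => //; exact: measurable_itv.
  by apply/seteqP; split=> x /= hx i; [move=> _|]; have := hx i; rewrite /= in_itv/=; [|exact].
have mb : measurable (ball x0 s) by apply: open_measurable_row; exact: ball_open.
have mD : measurable_fun setT (fun z : Rn * Rn => f (z.2 + z.1) - f z.2).
  apply: measurable_funB.
    apply: (measurableT_comp mf); apply: measurable_rowD; [exact: measurable_snd|exact: measurable_fst].
  by apply: (measurableT_comp mf); exact: measurable_snd.
have mA : measurable A.
  rewrite (_ : A = (Q `*` ball x0 s) `&` ((fun z : Rn * Rn => f (z.2 + z.1) - f z.2) @^-1` ~` [set 0])).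
    apply: measurableI; first exact: measurableX.
    rewrite -[X in measurable X]setTI; apply: mD => //.
    by apply: measurableC; exact: measurable_set1.
  apply/seteqP; split=> z /=.
    by move=> [h1 h2 h3]; split=> // /eqP; rewrite subr_eq0; apply/negP.
  by move=> [[h1 h2] h3]; split=> //; apply/eqP => e; apply: h3; rewrite e subrr.
pose F (z : Rn * Rn) : \bar R := (\1_A z)%:E.
have mF : measurable_fun setT F by apply/measurable_EFinP; exact: measurable_indic.
have F0 z : (0 <= F z)%E by rewrite lee_fin indicE.
have E1 : (\int[mu]_h \int[mu]_x F (h, x) = 0)%E.
  apply: integral0_eq => h _.
  have [Qh|nQ] := pselect (Q h); last first.
    apply: integral0_eq => x _; rewrite /F indicE memNset//.
    by move=> [].
  have ms : measurable_fun setT (fun x => F (h, x)).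
    by apply: (measurableT_comp mF); exact: measurable_fun_pair.
  have := ae_eq_integral_abs mu measurableT ms.
  under eq_integral do rewrite gee0_abs//.
  move=> [_ -> //]; apply: filterS (hf h Qh) => x hx _.
  by rewrite /F indicE memNset// => -[_ /= /hx -> /eqP].
have E2 : (\int[mu]_x \int[mu]_h F (h, x) = 0)%E by rewrite -(fubini_tonelli F mF F0).
have mG : measurable_fun setT (fun x => \int[mu]_h F (h, x))%E.
  exact: (measurable_fun_fubini_tonelli_G F mF F0).
have aeG : {ae mu, forall x, (\int[mu]_h F (h, x) = 0)%E}.
  have := ae_eq_integral_abs mu measurableT mG.
  under eq_integral do rewrite gee0_abs ?integral_ge0//.
  by move=> [/(_ E2) + _]; apply: filterS => x; exact.
have s4 : 0 < s / 4 by rewrite divr_gt0.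
(* Only vectors [h] with positive coordinates are available, so the base point is taken within
   [s / 4] of [x0 - const_mx (s / 2)]: for [y] within [s / 4] of [x0], every coordinate of [y - x]
   then lies strictly between 0 and [s]. *)
have [x bx Ex] := ae_exists (x0 - const_mx (s / 2)) s4 aeG.
have aeh : {ae mu, forall h, ~ A (h, x)}.
  have ms : measurable_fun setT (fun h => F (h, x)).
    by apply: (measurableT_comp mF); exact: measurable_fun_pair.
  have := ae_eq_integral_abs mu measurableT ms.
  under eq_integral do rewrite gee0_abs//.
  move=> [/(_ Ex) + _]; apply: filterS => h /(_ I).
  by rewrite /F indicE => + Ah; rewrite mem_set//= => -[] /eqP; rewrite oner_eq0.
have bc i : - (s / 4) < x0 0 i - s / 2 - x 0 i < s / 4.
  move: bx; rewrite -ball_normE /ball_/= => /(le_lt_trans (row_coord_le _ i)).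
  by rewrite !mxE ltr_norml.
exists (f x); apply: filterS (ae_translate (- x) aeh) => y nA yb.
have yc i : - (s / 4) < x0 0 i - y 0 i < s / 4.
  move: yb; rewrite -ball_normE /ball_/= => /(le_lt_trans (row_coord_le _ i)).
  by rewrite !mxE ltr_norml.
apply/eqP/negP => /negP fne; apply: nA; split=> /=.
- by move=> i; rewrite !mxE; have := bc i; have := yc i; lra.
- rewrite -ball_normE /ball_/= row_norm_lt//; apply/forallP => i; rewrite !mxE.
  by rewrite ltr_norml; have := bc i; have := yc i; lra.
- by rewrite addrC subrK.
Qed.

End integer_step.

(** * Gluing local constants along a connected set *)

Section connectedness.
Context (R : realType) (n : nat).
Local Notation Rn := 'rV[R]_n.
Local Notation mu := (lebesgue_row R n).

(** Local constants at one point agree, since concentric balls share a ball of positive measure.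
    Hence the points of [U] with local constant [c1] form a subset both open and closed in [U]. *)
Lemma connected_ae_constant (U : set Rn) (F : Rn -> R) : connected U ->
  (forall x, U x -> exists s c, 0 < s /\ {ae mu, forall y, ball x s y -> F y = c}) ->
  exists c, {ae mu, forall x, U x -> F x = c}.
Proof.
move=> cU hloc; have [[x1 Ux1]|nU] := pselect (exists x, U x); last first.
  by exists 0; apply: aeW => x Ux; exfalso; apply: nU; exists x.
have [s1 [c1 [s10 h1]]] := hloc x1 Ux1; exists c1.
pose O (Q : R -> Prop) := [set x : Rn | exists s c, [/\ 0 < s, Q c & {ae mu, forall y, ball x s y -> F y = c}]].
have oO Q : open (O Q).
  rewrite openE => x [s [c [s0 Qc hc]]]; apply/nbhs_ballP; exists (s / 2); first by rewrite /= divr_gt0.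
  move=> y xy; exists (s / 2), c; split=> //; first by rewrite divr_gt0.
  by apply: filterS hc => z hz yz; apply: hz; rewrite [s]splitr; exact: ball_triangle xy yz.
have agree x s s' c c' : 0 < s -> 0 < s' -> {ae mu, forall y, ball x s y -> F y = c} ->
    {ae mu, forall y, ball x s' y -> F y = c'} -> c = c'.
  move=> s0 s'0 hc hc'; have m0 : 0 < Num.min s s' by rewrite lt_min s0.
  have [y xy [e1 e2]] := ae_exists x m0 (filterI hc hc').
  by rewrite -e1 -?e2//; apply: le_ball xy; rewrite ge_min lexx ?orbT.
have UE : U `&` O (fun c => c = c1) = U.
  apply: cU.
  - by exists x1; split=> //; exists s1, c1.
  - by exists (O (fun c => c = c1)).
  - exists (~` O (fun c => c <> c1)); first by rewrite closedC; exact: oO.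
    apply/seteqP; split=> x [Ux].
      move=> [s [c [s0 cc1 hc]]]; split=> // -[s' [c' [s'0 c'c1 hc']]].
      by apply: c'c1; rewrite -cc1; exact: agree s'0 s0 hc' hc.
    move=> nO; split=> //; have [s [c [s0 hc]]] := hloc x Ux.
    exists s, c; split=> //; apply: contrapT => ne; apply: nO; by exists s, c.
(* The balls form an uncountable family; the countably many dyadic cells on which [F] is a.e. [c1]
   still cover [U], and their null sets can be united. *)
pose good (k : nat) := if unpickle k is Some d then {ae mu, forall x, dyadic_cell d x -> F x = c1} else False.
have aek : {ae mu, forall x k, good k -> forall d, unpickle k = Some d -> dyadic_cell d x -> F x = c1}.
  apply: ae_foralln => k; have [gk|ngk] := pselect (good k); last by apply: aeW.
  move: (gk); rewrite /good; case E : unpickle => [d|] // hd.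
  by apply: filterS hd => x hx _ d' [<-].
apply: filterS aek => x hx Ux.
have [_ [s [c [s0 -> hc]]]] : (U `&` O (fun c => c = c1)) x by rewrite UE.
have [d [dx sub]] := dyadic_cell_nbhs (nbhsx_ballx x s s0).
apply: (hx (pickle d) _ d _ dx); last exact: pickleK.
by rewrite /good pickleK; apply: filterS hc => y hy dy; apply: hy; exact: sub.
Qed.

Lemma star_connected (U : set Rn) (a : Rn) : U a ->
  (forall x t, U x -> 0 <= t <= 1 -> U (a + t *: (x - a))) -> connected U.
Proof.
move=> Ua hU.
pose S (x : Rn) : set Rn := (fun t : R => a + t *: (x - a)) @` `[0, 1]%classic.
have -> : U = \bigcup_(x in U) S x.
  apply/seteqP; split=> [x Ux|_ [x Ux [t /= + <-]]].
    exists x => //; exists 1; first by rewrite /= in_itv/= ler01 lexx.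
    by rewrite scale1r addrC subrK.
  by rewrite in_itv/= => ht; exact: hU.
apply: bigcup_connected.
  exists a => x Ux /=; exists 0; first by rewrite /= in_itv/= ler01 lexx.
  by rewrite scale0r addr0.
move=> x Ux; apply: connected_continuous_connected; first exact: segment_connected.
apply: continuous_subspaceT => t.
apply: (@cvgD R Rn); first exact: cvg_cst.
by apply: (@cvgZr_tmp R Rn); exact: cvg_id.
Qed.

Lemma open_open_unit_cube : open (@open_unit_cube R n).
Proof.
(* In the sup norm the cube is the ball of radius [1 / 2] around its centre. *)
rewrite (_ : open_unit_cube = ball (const_mx 2^-1 : Rn) 2^-1); first exact: ball_open.
apply/seteqP; split=> x /=; rewrite -ball_normE /ball_/= row_norm_lt//.
  by move=> hx; apply/forallP => i; have := hx i; rewrite !mxE ltr_norml; lra.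
by move=> /forallP hx i; have := hx i; rewrite !mxE ltr_norml; lra.
Qed.

Lemma connected_open_unit_cube : connected (@open_unit_cube R n).
Proof.
apply: (@star_connected _ (const_mx 2^-1)) => [i|x t hx /andP[t0 t1] i].
  by rewrite mxE; lra.
by have := hx i; rewrite !mxE; nra.
Qed.

Lemma connected_setT_row : connected [set: Rn].
Proof. exact: (@star_connected _ 0). Qed.

End connectedness.

(** * Besov functions on a region *)

Section main.
Context (R : realType) (n : nat).
Local Notation Rn := 'rV[R]_n.
Local Notation C := R[i].
Local Notation mu := (lebesgue_row R n).
Variables (phi : nat -> Rn -> C) (hphi : dyadic_partition phi).

Lemma test_function_eq0 (U : set Rn) (psi : Rn -> C) x : test_function U psi -> ~ U x -> psi x = 0.
Proof.
move=> [_ _ sub] nU; apply: contrapT => px; apply: nU; apply: sub.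
by apply: subset_closure => /=; apply/eqP.
Qed.

Lemma test_functionS (U V : set Rn) (psi : Rn -> C) : U `<=` V -> test_function U psi -> test_function V psi.
Proof. by move=> UV [h1 h2 h3]; split=> //; exact: subset_trans h3 UV. Qed.

(** Brings the two kinds of region to one form: for an open region [u] is the extension to the whole
    space, for the torus it is the product with a cutoff equal to 1 near [x0]. *)
Lemma besov_local_distr (Om : region R n) (s p : R) (q : \bar R) (g : Rn -> R) (x0 : Rn) :
  open (carrier Om) -> carrier Om x0 ->
  besov phi Om s p q (regular_distr (carrier Om) (fun x => (g x)%:C)) ->
  exists u r, [/\ besov_Rn phi s p q u, 0 < r & forall psi, test_function (ball x0 r) psi ->
    u psi = regular_distr (carrier Om) (fun x => (g x)%:C) psi].
Proof.
case: Om => [U|] /= oU Ux0.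
  move=> [u bu hu]; have /nbhs_ballP[r r0 hr] := open_nbhs_nbhs (conj oU Ux0).
  exists u, r; split=> // psi tpsi; rewrite hu//; exact: test_functionS tpsi.
(* At this scale [n * c * |x - x0| < 2] on the unit ball, so the cutoff is 1 there. *)
move=> [_ _ hb]; have c0 : 0 < 2 / (n%:R + 1) :> R by rewrite divr_gt0// ltr_wpDl.
have tc := @test_cutoffM _ _ _ hphi _ x0 (fun=> 1) setT c0 (@smooth_cst R n 1) (fun _ _ => I).
eexists; exists 1; split; [exact: hb tc|by []|move=> psi tpsi].
rewrite /distr_mul; congr (regular_distr _ _ _); apply/funext => x.
have [bx|nbx] := pselect (ball x0 1 x); last by rewrite (test_function_eq0 tpsi nbx) mulr0.
rewrite (cutoff_eq1 hphi)// ?mul1r//; move: bx; rewrite -ball_normE /ball_/= distrC => bx.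
apply: (@le_lt_trans _ _ (2 * `|x - x0|)); last by lra.
apply: ler_wpM2r => //; rewrite mulrCA -[leRHS]mulr1; apply: ler_wpM2l => //.
by rewrite ler_pdivrMr ?ltr_wpDl// mul1r lerDl.
Qed.

(** [g] is only locally integrable. Restricting it to a compact ball inside the region gives an
    integrable [f'] defining the same distribution near [x0], as [small_second_difference]
    requires. *)
Lemma besov_local (Om : region R n) (s p : R) (q : \bar R) (f : Rn -> R) (x0 : Rn) :
  0 < s -> 1 <= p -> (1 <= q)%E -> (s * p = 1 /\ (q < +oo)%E) \/ 1 < s * p ->
  open (carrier Om) -> carrier Om x0 -> besov_fun phi Om s p q f ->
  exists f' rho, [/\ 0 < rho, measurable_fun setT f', osc_null f' x0 rho &
    {ae mu, forall x, ball x0 rho x -> f x = f' x}].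
Proof.
move=> s0 p1 q1 hsp oU Ux0 [g [[mg lg] fg bg]].
have [u [r [[tu bu] r0 hu]]] := besov_local_distr oU Ux0 bg.
have [h [nu hg]] := besov_pieces p1 s0 q1 hsp bu.
have /nbhs_ballP[r' /= r'0 hr'] := open_nbhs_nbhs (conj oU Ux0).
(* Halving [r'] keeps the closed ball of radius [d] inside the region. *)
pose d := Num.min r (r' / 2).
have d0 : 0 < d by rewrite lt_min r0 divr_gt0.
pose B := closed_ball x0 d.
have dr' : d < r' by rewrite gt_min; apply/orP; right; lra.
have BU : B `<=` carrier Om.
  move=> x; rewrite /B closed_ballE// => /= hx; apply: hr'; rewrite -ball_normE /=.
  exact: le_lt_trans hx dr'.
have cB : compact B.
  apply: bounded_closed_compact; last exact: closed_ball_closed.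
  exists (d + `|x0|); split; [exact: num_real|move=> M hM x /=].
  rewrite /B closed_ballE// => /= hx; apply: le_trans (ltW hM).
  by rewrite -[x](subrK x0); apply: (le_trans (ler_normD _ _)); rewrite lerD2r distrC.
have mB : measurable B by apply: closed_measurable_row; exact: closed_ball_closed.
pose f' := g \_ B.
have If' : mu.-integrable setT (EFin \o f').
  by rewrite /f' -restrict_EFin; apply/(integrable_mkcond _ mB); exact: lg.
have bB : ball x0 d `<=` B by exact: subset_closed_ball.
have hu' psi : test_function (ball x0 d) psi -> u psi = cintegral setT (fun x => (f' x)%:C * psi x).
  move=> tpsi; rewrite hu; last first.
    by apply: test_functionS tpsi; apply: le_ball; rewrite ge_min lexx.
  rewrite /regular_distr /cintegral.
  have E x : (fun x => (g x)%:C * psi x) x = (f' x)%:C * psi x.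
    rewrite /f' patchE; case: ifPn => // /negP xB; rewrite (test_function_eq0 tpsi) ?mulr0//.
    by move=> /bB bx; apply: xB; rewrite inE.
  have E0 x : ~ carrier Om x -> (f' x)%:C * psi x = 0.
    move=> nU; rewrite (test_function_eq0 tpsi) ?mulr0//.
    by move=> /bB /BU.
  congr (_ +i* _); rewrite Rintegral_mkcond; apply: eq_Rintegral => x _; rewrite patchE.
    by case: ifPn => [_|/negP nU]; [rewrite -E|rewrite E0//; move=> xU; apply: nU; rewrite inE].
  by case: ifPn => [_|/negP nU]; [rewrite -E|rewrite E0//; move=> xU; apply: nU; rewrite inE].
have [rho rho0 osc] := small_second_difference hphi p1 tu hg d0 If' hu'.
exists f', (Num.min rho d); split.
- by rewrite lt_min rho0.
- by apply/measurable_EFinP; exact: measurable_int If'.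
- by apply: osc_null_le osc; rewrite ge_min lexx.
- have fgU : {ae mu, forall x, carrier Om x -> f x = g x} := fg.
  apply: filterS fgU => x hx bx.
  have Bx : B x by apply: bB; apply: le_ball bx; rewrite ge_min lexx orbT.
  by rewrite (hx (BU _ Bx)) /f' patchE mem_set.
Qed.

Lemma min_radius k (r : 'I_k -> R) : (forall j, 0 < r j) -> exists2 r0, 0 < r0 & forall j, r0 <= r j.
Proof.
elim: k r => [|k IH] r hr; first by exists 1 => // -[].
have [r0 r00 h] := IH _ (fun j => hr (widen_ord (leqnSn k) j)).
exists (Num.min r0 (r ord_max)); first by rewrite lt_min r00 hr.
move=> j; rewrite ge_min; have [->|jk] := eqVneq j ord_max; first by rewrite lexx orbT.
have jk' : (j < k)%N by rewrite ltn_neqAle -ltnS ltn_ord andbT; apply: contra jk => /eqP jk; apply/eqP/val_inj.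
have -> : j = widen_ord (leqnSn k) (Ordinal jk') by apply: val_inj.
by rewrite h.
Qed.

Lemma ae_constant_sum (Om : region R n) k (s p : 'I_k -> R) (q : 'I_k -> \bar R) :
  open (carrier Om) -> connected (carrier Om) ->
  (forall j, [/\ 0 < s j, 1 <= p j & (1 <= q j)%E]) ->
  (forall j, (s j * p j = 1 /\ (q j < +oo)%E) \/ 1 < s j * p j) ->
  forall f : 'I_k -> Rn -> R,
    (forall j, besov_fun phi Om (s j) (p j) (q j) (f j)) ->
    integer_valued Om (fun x => \sum_(j < k) f j x) ->
    ae_constant Om (fun x => \sum_(j < k) f j x).
Proof.
move=> oU cU hspq hsp f bf fint; apply: (connected_ae_constant cU) => x0 Ux0.
have /choice[f' hf'] : forall j, exists f', exists rho, [/\ 0 < rho, measurable_fun setT f', osc_null f' x0 rho &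
    {ae mu, forall x, ball x0 rho x -> f j x = f' x}].
  by move=> j; have [s0 p1 q1] := hspq j; exact: besov_local s0 p1 q1 (hsp j) oU Ux0 (bf j).
have /choice[r hr] := hf'.
have [r1 r10 hr1] := min_radius (fun j => let: And4 h _ _ _ := hr j in h).
have [r2 r20 osc] := osc_null_sum (fun j => let: And4 h _ o _ := hr j in ex_intro2 _ _ (r j) h o).
have /nbhs_ballP[r3 /= r30 hr3] := open_nbhs_nbhs (conj oU Ux0).
(* The radius must serve all summands ([r1], [r2]), stay inside the region ([r3]), and be at most 1
   as [translations] requires. *)
pose rho := Num.min (Num.min r1 r2) (Num.min r3 1).
have rho0 : 0 < rho by rewrite !lt_min r10 r20 r30/=.
have rho1 : rho <= 1 by rewrite !ge_min lexx !orbT.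
pose F x := \sum_(j < k) f' j x.
have mF : measurable_fun setT F by apply: measurable_sum => j; have [] := hr j.
have FE : {ae mu, forall x, ball x0 rho x -> \sum_(j < k) f j x = F x}.
  have : {ae mu, forall x j, ball x0 (r j) x -> f j x = f' j x}.
    by apply: filter_forall => j; have [] := hr j.
  apply: filterS => x hx bx; apply: eq_bigr => j _; apply: hx.
  by apply: le_ball bx; apply: le_trans (hr1 j); rewrite !ge_min lexx.
have Fint : {ae mu, forall x, ball x0 rho x -> F x \is a Num.int}.
  apply: filterS2 FE fint => x e1 e2 bx; rewrite -e1//; apply: e2; apply: hr3.
  by apply: le_ball bx; rewrite !ge_min lexx !orbT.
have oF : osc_null F x0 rho by apply: osc_null_le osc; rewrite !ge_min lexx !orbT.
have rho4 : 0 < rho / 4 by rewrite divr_gt0.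
have [c hc] := const_of_translations rho4 mF (fun h => translations rho0 rho1 Fint oF).
exists (rho / 4 / 4), c; split; first by rewrite divr_gt0.
apply: filterS2 FE hc => x e1 e2 bx; rewrite e1 ?e2//.
by apply: le_ball bx; lra.
Qed.

Lemma admissible_open_connected (Om : region R n) : admissible Om -> open (carrier Om) /\ connected (carrier Om).
Proof.
case: Om => [U /= [[oU cU _ _]|->]|_] //=.
  by split; [exact: open_open_unit_cube|exact: connected_open_unit_cube].
by split; [exact: openT|exact: connected_setT_row].
Qed.

End main.

Theorem lemma6p25 (R : realType) (n : nat) (hn : (1 <= n)%N)
    (phi : nat -> 'rV[R]_n -> R[i]) (hphi : dyadic_partition phi)
    (Om : region R n) (hOm : admissible Om) :
  [/\ forall (s p q : R), 0 < s -> 1 <= p -> 1 <= q -> 1 <= s * p ->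
        forall f : 'rV[R]_n -> R,
          besov_fun phi Om s p q%:E f -> integer_valued Om f ->
          ae_constant Om f,
      forall (s p : R), 0 < s -> 1 <= p -> 1 < s * p ->
        forall f : 'rV[R]_n -> R,
          besov_fun phi Om s p +oo%E f -> integer_valued Om f ->
          ae_constant Om f &
      forall (k : nat), (1 <= k)%N ->
        forall (s p : 'I_k -> R) (q : 'I_k -> \bar R),
          (forall j, [/\ 0 < s j, 1 <= p j & (1 <= q j)%E]) ->
          (forall j, (s j * p j = 1 /\ (q j < +oo)%E) \/ 1 < s j * p j) ->
        forall f : 'I_k -> 'rV[R]_n -> R,
          (forall j, besov_fun phi Om (s j) (p j) (q j) (f j)) ->
          integer_valued Om (fun x => \sum_(j < k) f j x) ->
          ae_constant Om (fun x => \sum_(j < k) f j x)].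
Proof.
have [oU cU] := admissible_open_connected hOm.
(* The first two assertions are the case of a single summand. *)
have one (s p : R) (q : \bar R) : 0 < s -> 1 <= p -> (1 <= q)%E ->
    (s * p = 1 /\ (q < +oo)%E) \/ 1 < s * p ->
    forall f : 'rV[R]_n -> R, besov_fun phi Om s p q f -> integer_valued Om f -> ae_constant Om f.
  move=> s0 p1 q1 hsp f bf fint.
  have := @ae_constant_sum R n phi hphi Om 1 (fun=> s) (fun=> p) (fun=> q) oU cU
    (fun=> And3 s0 p1 q1) (fun=> hsp) (fun=> f) (fun=> bf).
  have -> : (fun x => \sum_(j < 1) f x) = f by apply/funext => x; rewrite big_ord1.
  exact.
split.
- move=> s p q s0 p1 q1 sp f; apply: one => //.
  by move: sp; rewrite le_eqVlt => /orP[/eqP <-|]; [left; rewrite ltry|right].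
- by move=> s p s0 p1 sp f; apply: one => //; [rewrite leey|right].
- by move=> k _ s p q hspq hsp f bf fint; exact: ae_constant_sum hspq hsp f bf fint.
Qed.
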